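(* Let $n \ge k \ge r \ge 3$ be integers. If $\mathcal H$ is an $n$-vertex Sperner $2$-connected hypergraph in which every edge has size at most $r$, and $\mathcal H$ has no Berge cycle of length $k$ or longer, then $$|E(\mathcal H)| \le \max\{f(n,k,r,\lfloor (k-1)/2\rfloor),\ f(n,k,r,2)\}.$$
   Context: A hypergraph is Sperner if no edge is contained in another edge (in particular there are no multiple edges). A Berge cycle of length $\ell$ in a hypergraph is a set of $\ell$ distinct vertices $\{v_1,\dots,v_\ell\}$ and $\ell$ distinct edges $\{e_1,\dots,e_\ell\}$ such that $\{v_i,v_{i+1}\}\subseteq e_i$ with indices taken modulo $\ell$. The incidence bigraph of $\mathcal H$ is the bipartite graph with parts $E(\mathcal H)$ and $V(\mathcal H)$ in which an edge $a$ of $\mathcal H$ is adjacent to a vertex $y$ iff $y\in a$. The hypergraph $\mathcal H$ is $2$-connected if its incidence bigraph is a $2$-connected graph. For integers $n,k,r,a$, $$f(n,k,r,a) := \binom{k-a}{\min\{r,\lfloor\frac{k-a}{2}\rfloor\}} + (n-k+a)\binom{a}{\min\{r-1,\lfloor a/2\rfloor\}}.$$ *)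

(* Defs.v *)
From mathcomp Require Import all_boot.

Set Implicit Arguments.
Unset Strict Implicit.
Unset Printing Implicit Defensive.

(* A graph on T is a symmetric irreflexive relation e : rel T; the subgraph
   induced by D is obtained by restricting e to D. *)
Definition induced_connected (T : finType) (e : rel T) (D : {set T}) : Prop :=
  {in D &, forall x y, connect [rel u v in D | e u v] x y}.

(* More than two vertices, and connected after the deletion of any set of
   fewer than two vertices (in particular, of no vertex). *)
Definition two_connected (T : finType) (e : rel T) : Prop :=
  2 < #|T| /\ forall X : {set T}, #|X| < 2 -> induced_connected e (~: X).

(* A hypergraph is given by its vertex type V and its edge set
   H : {set {set V}}; isolated vertices are allowed. Multiple edges are not
   represented, a Sperner hypergraph having none. *)
Definition sperner (V : finType) (H : {set {set V}}) : Prop :=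
  {in H &, forall A B : {set V}, A \subset B -> A = B}.

Definition incidence_vertex (V : finType) (H : {set {set V}}) : finType :=
  ({A : {set V} | A \in H} + V)%type.

Definition incidence (V : finType) (H : {set {set V}}) :
    rel (incidence_vertex H) :=
  fun x y => match x, y with
             | inl A, inr v => v \in val A
             | inr v, inl A => v \in val A
             | _, _ => false
             end.

Definition hypergraph_two_connected (V : finType) (H : {set {set V}}) : Prop :=
  two_connected (@incidence V H).

(* ordS is the cyclic successor i + 1 modulo l. As in the definition on paper,
   degenerate values l < 2 are not excluded; only lengths l >= 3 are used. *)
Definition has_berge_cycle (V : finType) (H : {set {set V}}) (l : nat) : Prop :=
  exists (v : 'I_l -> V) (e : 'I_l -> {set V}),
    [/\ injective v, injective e, (forall i, e i \in H)
      & forall i, [set v i; v (ordS i)] \subset e i].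

(* Subtraction on nat is truncated, so this agrees with the integer formula
   only when a <= k <= n and 0 < r. *)
Definition f (n k r a : nat) : nat :=
  'C(k - a, minn r ((k - a)./2)) + (n - k + a) * 'C(a, minn (r - 1) (a./2)).

(* Main.v *)
Require Import Defs.
From mathcomp Require Import all_boot zify.
From Stdlib Require Classical_Prop.

(** Put t = (k - 1)./2. The hypergraph question is turned into a question on an
ordinary graph, to which Kopylov's disintegration argument is applied.

From hyperedges to a graph. Match pairs of vertices with hyperedges that
contain them, injectively, using as many pairs as possible, and let G be the
graph of the matched pairs; each edge of G has a private hyperedge around it,
so a cycle of G is a Berge cycle of the same length. Let R consist of the
hyperedges that alternating sequences reach from the unmatched ones. As there
is no augmenting sequence, all pairs inside a member of R are matched, so the
members of R are cliques of G; replacing every hyperedge outside R by its pair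
turns H into a Sperner family of as many cliques of G, still of size at most r
([pair_representatives]). The incidence graph of H is 2-connected, but G need
not be, and this is what makes the rest longer than for graphs.

Counting. Suppose that K has k - a vertices and that the other vertices can be
deleted one by one so that each has at most a neighbours among the vertices
that are left. The cliques through a deleted vertex form, without that vertex,
a Sperner family of sets of size at most r - 1 on at most a vertices; with the
LYM inequality ([lym]) the family has at most f n k r a members
([count_removable]). As f is convex in a ([f_le_ends]), it suffices to find
such a K for one a between 2 and t ([removable_set_exists]). For k <= 4 this
range is empty; there a = 2 works, as G has no cycle on four or more vertices.

Finding K. Call W solid if all degrees in G[W] exceed t, or if W extends a
solid set K by vertices with more than k - #|K| neighbours in W. Without
solid sets the vertices of degree at most t can be deleted until k - t
vertices remain. Otherwise take for K a largest solid set: if the vertices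
outside were not removable, K could be extended. So everything rests on the
bound #|W| <= k - 2 for solid sets W ([solid_card_lt]), in three steps.

- If #|W| < k, then joining non-adjacent vertices whose degrees add up to at
  least k, again and again, makes G[W] complete. By the theorem of Bondy and Chvatal
  G[W] has Hamiltonian paths between any two vertices, and also between edges
  ([solid_hamiltonian]).
- G[W] is 2-connected ([solid_two_connected]). Otherwise some part of it hangs
  at a cut vertex; the degree condition gives long paths between any two
  vertices of that part ([long_path]), and two disjoint paths of the incidence
  graph from that part to the rest of W close up to a Berge cycle of length
  at least k ([link_cycle]).
- If #|W| >= k, add edges to G[W] as long as no cycle of length k or more
  arises. Then non-adjacent vertices are joined by a path with k vertices, and
  a longest such path with suitable ends gives a cycle by Posa's argument
  ([posa]). So the graph becomes complete, and has a cycle through all of W,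
  a contradiction ([solid_cycle]).

It remains to exclude #|W| = k - 1. By 2-connectivity of the incidence graph
another vertex y reaches W by two disjoint paths. They may end at hyperedges
that represent edges of G[W] instead of at vertices, which is why Hamiltonian
paths between edges are needed above; such a path closes up to a Berge cycle
through W and y. *)

Set Implicit Arguments.
Unset Strict Implicit.
Unset Printing Implicit Defensive.

(** * Bounded Sperner families and convexity of the bound *)

Lemma bin_incr n i j : i <= j -> j <= n./2 -> 'C(n, i) <= 'C(n, j).
Proof.
move=> le_ij le_jn; rewrite -(subnK le_ij) addnC.
have: i + (j - i) <= n./2 by rewrite subnKC.
elim: (j - i) => [|d IH] le_d; first by rewrite addn0.
apply: leq_trans (IH _) _; first by lia.
rewrite addnS; set m := i + d.
have le_m : m.+1 <= n./2 by rewrite /m; lia.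
have E := mul_bin_left n m.
have : m.+1 * 'C(n, m) <= m.+1 * 'C(n, m.+1).
  by rewrite E leq_mul2r; apply/orP; right; lia.
by rewrite leq_mul2l.
Qed.

(** The largest of the binomials 'C(n, j) with j <= r, and hence the largest size
of a Sperner family of sets of size at most r on n points. *)
Definition capped_bin r n := 'C(n, minn r n./2).

Lemma leq_capped_bin r n j : j <= r -> 'C(n, j) <= capped_bin r n.
Proof.
move=> le_jr; rewrite /capped_bin.
have [le_jn|lt_nj] := leqP j n./2; first by apply: bin_incr; lia.
have [le_jn'|?] := leqP j n; last by rewrite bin_small.
by rewrite -bin_sub //; apply: bin_incr; lia.
Qed.

Lemma capped_bin_mono r d a : d <= a -> capped_bin r d <= capped_bin r a.
Proof.
move=> le_da; apply: leq_trans (leq_bin2l _ le_da) _; apply: leq_capped_bin; lia.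
Qed.

Lemma capped_bin_gt0 r n : 0 < capped_bin r n.
Proof. by rewrite bin_gt0; lia. Qed.

(** The increments are binomials again, which makes convexity a comparison of two
binomials below the middle. For odd m the step from m to m.+1 moves the
central index, and symmetry of the row m is used. *)
Lemma capped_binS r m : 0 < r -> 0 < m ->
  capped_bin r m.+1 = capped_bin r m + 'C(m, minn r.-1 m.-1./2).
Proof.
move=> r0 m0; rewrite /capped_bin.
have [j Ej] : exists j, minn r m.+1./2 = j.+1.
  by exists (minn r m.+1./2).-1; lia.
rewrite Ej binS.
have [E|E] := eqVneq (minn r m./2) j.+1.
  by rewrite E; congr (_ + 'C(_, _)); lia.
have E2 : minn r m./2 = j by lia.
have -> : minn r.-1 m.-1./2 = j by lia.
rewrite E2; congr (_ + _).
have em : m = j.*2.+1 by lia.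
by rewrite -(@bin_sub m j.+1); [congr 'C(_, _) |]; lia.
Qed.

Lemma capped_bin_convex r m : 0 < r -> 0 < m ->
  2 * capped_bin r m <= capped_bin r m.+1 + capped_bin r m.-1.
Proof.
move=> r0; case: m => // -[_|m _].
  rewrite succnK; have -> : capped_bin r 0 = 1 by rewrite /capped_bin bin0n; case: minn (geq_minr r 0./2).
  have -> : capped_bin r 1 = 1.
    by rewrite /capped_bin; have -> : minn r 1./2 = 0 by lia.
  by have := capped_bin_gt0 r 2; lia.
rewrite (@capped_binS r m.+2) // (@capped_binS r m.+1) // !succnK.
suff : 'C(m.+1, minn r.-1 m./2) <= 'C(m.+2, minn r.-1 m.+1./2) by lia.
apply: leq_trans (leq_bin2l _ (leqnSn m.+1)) _.
by apply: bin_incr; lia.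
Qed.

Lemma convex_max (h : nat -> nat) lo hi :
  (forall a, lo < a < hi -> 2 * h a <= h a.+1 + h a.-1) ->
  forall a, lo <= a <= hi -> h a <= maxn (h lo) (h hi).
Proof.
elim: hi => [|hi IH] cvx a /andP[le1 le2].
  have -> : a = 0 by lia.
  by rewrite leq_max leqnn orbT.
have [->|ne_a] := eqVneq a hi.+1; first by rewrite leq_max leqnn orbT.
have le_a : a <= hi by lia.
have /(_ a) := IH (fun b hb => cvx b ltac:(lia)).
rewrite le1 le_a => /(_ isT) H1.
have [E|ne] := eqVneq hi lo.
  have -> : a = lo by lia.
  by rewrite leq_max leqnn.
have H2 : h hi <= maxn (h lo) (h hi.+1).
  have {H1} := IH (fun b hb => cvx b ltac:(lia)) hi.-1 ltac:(lia).
  have := cvx hi ltac:(lia).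
  by rewrite !leq_max; lia.
by move: H1 H2; rewrite !leq_max; lia.
Qed.

Lemma fE n k r a : f n k r a = capped_bin r (k - a) + (n - k + a) * capped_bin (r - 1) a.
Proof. by []. Qed.

(** Convexity: the first summand of f is convex in a, and the second is a product
of two nonnegative, nondecreasing and convex functions of a. *)
Lemma f_le_ends n k r a t : 2 < r -> k <= n -> t <= k -> 2 <= a <= t ->
  f n k r a <= maxn (f n k r t) (f n k r 2).
Proof.
move=> r3 kn tk /andP[a2 at_]; rewrite maxnC.
apply: (@convex_max (fun a => f n k r a) 2 t); last by rewrite a2.
move=> {a2 at_}a /andP[a2 at_]; rewrite !fE.
have c1 := @capped_bin_convex r (k - a) ltac:(lia) ltac:(lia).
have c2 := @capped_bin_convex (r - 1) a ltac:(lia) ltac:(lia).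
have m1 := @capped_bin_mono (r - 1) a.-1 a ltac:(lia).
have m2 := @capped_bin_mono (r - 1) a a.+1 ltac:(lia).
have -> : k - a.+1 = (k - a).-1 by lia.
have -> : k - a.-1 = (k - a).+1 by lia.
have -> : n - k + a.+1 = (n - k + a).+1 by lia.
have -> : n - k + a.-1 = (n - k + a).-1 by lia.
have : 0 < n - k + a by lia.
move: (n - k + a) c2 m1 m2 c1 => c; move: (capped_bin _ a) (capped_bin _ a.+1) (capped_bin _ a.-1).
by move=> x y z ? ? ? ? ?; nia.
Qed.

Lemma spernerS (T : finType) (F F' : {set {set T}}) :
  F' \subset F -> sperner F -> sperner F'.
Proof. by move=> /subsetP s a A B /s FA /s FB; apply: a. Qed.

(** Induction on #|U|: unless U itself is in F, every A in F misses #|U| - #|A|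
points x of U, and the inequality for U :\ x, applied to the members of F
that miss x, is summed over x. *)
Lemma lym (T : finType) (U : {set T}) (F : {set {set T}}) :
  sperner F -> {in F, forall A : {set T}, A \subset U} ->
  \sum_(A in F) #|A|`! * (#|U| - #|A|)`! <= #|U|`!.
Proof.
move En: #|U| => n; elim: n U En F => [|n IH] U En F aF sF.
  have U0 : U = set0 by apply/eqP; rewrite -cards_eq0 En.
  have sF' : F \subset [set set0].
    by apply/subsetP=> A /sF; rewrite U0 subset0 inE.
  apply: leq_trans (_ : \sum_(A in [set (set0 : {set T})]) #|A|`! * (0 - #|A|)`! <= _).
    rewrite [X in _ <= X](big_setID F) /= (setIidPr sF'); exact: leq_addr.
  by rewrite big_set1 cards0.
have [UF|UnF] := boolP (U \in F).
  have -> : F = [set U].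
    apply/setP=> A; rewrite inE; apply/idP/eqP=> [FA|->//].
    exact: aF (sF _ FA).
  by rewrite big_set1 En subnn muln1.
have ltA A : A \in F -> #|A| <= n.
  move=> FA; rewrite -ltnS -En; apply: proper_card; rewrite properEneq sF // andbT.
  by apply: contraNneq UnF => <-.
(* A misses n.+1 - #|A| points of U, and each stands for one copy of the term for n. *)
have step A : A \in F -> #|A|`! * (n.+1 - #|A|)`! =
    \sum_(x in U | x \notin A) #|A|`! * (n - #|A|)`!.
  move=> FA; rewrite sum_nat_const.
  have -> : #|[pred x in U | x \notin A]| = n.+1 - #|A|.
    rewrite -En -(setIidPr (sF _ FA)) -cardsD; apply: eq_card => x.
    by rewrite !inE; have /subsetP/(_ x) := sF _ FA; case: (x \in A) => [->|_]; rewrite ?andbF //= andbC.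
  by rewrite subSn ?ltA // factS; lia.
rewrite (eq_bigr _ step) (exchange_big_dep (mem U)) /=; last by move=> A x _ /andP[].
rewrite factS -En -sum_nat_const; apply: leq_sum => x Ux.
apply: leq_trans (IH (U :\ x) _ [set A in F | x \notin A] _ _).
- by rewrite leq_eqVlt; apply/orP; left; apply/eqP; apply: eq_bigl => A; rewrite !inE Ux.
- by apply/eqP; rewrite -eqSS -En (cardsD1 x U) Ux.
- by apply: spernerS aF; apply/subsetP=> A; rewrite inE => /andP[].
- move=> A; rewrite inE => /andP[FA xA]; apply/subsetP=> y Ay; rewrite !inE.
  by rewrite (subsetP (sF _ FA)) // andbT; apply: contraNneq xA => <-.
Qed.

Lemma sperner_capped_bin (T : finType) (U : {set T}) (F : {set {set T}}) r :
  sperner F -> {in F, forall A : {set T}, A \subset U /\ #|A| <= r} ->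
  #|F| <= capped_bin r #|U|.
Proof.
move=> aF sF; rewrite -(leq_pmul2r (fact_gt0 #|U|)) -sum_nat_const.
apply: leq_trans (_ : \sum_(A in F) #|A|`! * (#|U| - #|A|)`! * capped_bin r #|U| <= _).
  apply: leq_sum => A /sF[sA leA].
  by rewrite -(bin_fact (subset_leq_card sA)) mulnC leq_mul2l leq_capped_bin // orbT.
rewrite -big_distrl /= mulnC leq_mul2l lym ?orbT // => A /sF[] //.
Qed.

(** * Sperner families of cliques in graphs with a degeneracy condition *)

Definition nbr (T : finType) (g : rel T) (B : {set T}) x := [set y in B | g x y].

(** Equivalently, the vertices outside K can be deleted one by one, each having at
most a neighbours left; the form with subsets X avoids choosing an order. *)
Definition removable (T : finType) (g : rel T) a (K : {set T}) :=
  forall X : {set T}, X != set0 -> X \subset ~: K ->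
    exists2 x, x \in X & #|nbr g (K :|: X) x| <= a.

Definition clique (T : finType) (g : rel T) (A : {set T}) :=
  {in A &, forall x y, x != y -> g x y}.

(** Delete the vertices outside K one by one. The members of F through the deleted
vertex x, without x, are a Sperner family inside the neighbourhood of x. *)
Lemma count_removable (T : finType) (g : rel T) a (K : {set T}) r
    (F : {set {set T}}) :
  removable g a K -> sperner F ->
  {in F, forall A : {set T}, clique g A /\ #|A| <= r} ->
  #|F| <= capped_bin r #|K| + #|~: K| * capped_bin (r - 1) a.
Proof.
move=> remK aF FP.
suff gen (X : {set T}) : X \subset ~: K ->
    {in F, forall A : {set T}, A \subset K :|: X} ->
    #|F| <= capped_bin r #|K| + #|X| * capped_bin (r - 1) a.
  by apply: gen => // A _; rewrite setUCr subsetT.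
move En: #|X| => n; elim: n X En F aF FP => [|n IH] X En F aF FP sX sF.
  have X0 : X = set0 by apply/eqP; rewrite -cards_eq0 En.
  rewrite addn0; apply: sperner_capped_bin => // A FA; split; last by case: (FP _ FA).
  by rewrite -[K]setU0 -X0 sF.
have nX : X != set0 by rewrite -card_gt0 En.
have [x xX dx] := remK _ nX sX.
set F0 := [set A in F | x \notin A]; set F1 := [set A in F | x \in A].
have -> : #|F| = #|F1| + #|F0|.
  rewrite -(cardsID [set A : {set T} | x \in A] F); congr (_ + _).
    by apply: eq_card => A; rewrite !inE.
  by apply: eq_card => A; rewrite !inE andbC.
have B0 : #|F0| <= capped_bin r #|K| + n * capped_bin (r - 1) a.
  apply: (IH (X :\ x)).
  - by apply/eqP; rewrite -eqSS -En (cardsD1 x X) xX.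
  - by apply: spernerS aF; apply/subsetP=> A; rewrite inE => /andP[].
  - by move=> A; rewrite inE => /andP[/FP].
  - by apply: subset_trans sX; rewrite subD1set.
  move=> A; rewrite inE => /andP[FA xA]; apply/subsetP=> y Ay.
  have := subsetP (sF _ FA) _ Ay; rewrite !inE => /orP[->//|->].
  by rewrite andbT; apply/orP; right; apply: contraNneq xA => <-.
have B1 : #|F1| <= capped_bin (r - 1) a.
  have inj : {in F1 &, injective (fun A => A :\ x)}.
    move=> A B; rewrite !inE => /andP[_ xA] /andP[_ xB] E.
    by rewrite -(setD1K xA) E setD1K.
  rewrite -(card_in_imset inj).
  apply: leq_trans (capped_bin_mono (r - 1) dx).
  apply: sperner_capped_bin.
    move=> A' B' /imsetP[A FA ->] /imsetP[B FB ->] sAB; congr (_ :\ x).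
    move: FA FB; rewrite !inE => /andP[FA xA] /andP[FB xB].
    by apply: aF => //; rewrite -(setD1K xA) -(setD1K xB) setUS.
  move=> B /imsetP[A]; rewrite inE => /andP[FA xA] ->.
  have [clA szA] := FP _ FA; split; last by move: szA; rewrite (cardsD1 x A) xA; lia.
  apply/subsetP=> y; rewrite !inE => /andP[yx yA].
  by have /subsetP/(_ y yA) := sF _ FA; rewrite !inE => ->; rewrite clA // eq_sym.
by rewrite mulSn; lia.
Qed.

(** * Representing hyperedges by pairs of vertices *)

Lemma path_subrel_in (T : eqType) (e e' : rel T) x p :
  (forall y z, z \in p -> e y z -> e' y z) -> path e x p -> path e' x p.
Proof.
elim: p x => //= y p IH x h /andP[xy pth]; rewrite h ?mem_head //=.
by apply: IH pth => u v pv; apply: h; rewrite inE pv orbT.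
Qed.

Section Matching.
Variables (V : finType) (H : {set {set V}}).

Definition valid_matching (m : {ffun {set V} -> option {set V}}) :=
  (forall P A, m P = Some A -> [/\ #|P| = 2, P \subset A & A \in H]) /\
  (forall P Q A, m P = Some A -> m Q = Some A -> P = Q).

Definition valid_matchingb (m : {ffun {set V} -> option {set V}}) :=
  [forall P, forall A, (m P == Some A) ==> [&& #|P| == 2, P \subset A & A \in H]] &&
  [forall P, forall Q, forall A, (m P == Some A) ==> (m Q == Some A) ==> (P == Q)].

Lemma valid_matchingP m : reflect (valid_matching m) (valid_matchingb m).
Proof.
apply: (iffP andP) => -[h1 h2]; split.
- move=> P A E; move/forallP/(_ P)/forallP/(_ A): h1; rewrite E eqxx /=.
  by case/and3P=> /eqP.
- move=> P Q A E1 E2; move/forallP/(_ P)/forallP/(_ Q)/forallP/(_ A): h2.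
  by rewrite E1 E2 eqxx => /eqP.
- apply/forallP=> P; apply/forallP=> A; apply/implyP=> /eqP /h1[-> -> ->].
  by rewrite eqxx.
- apply/forallP=> P; apply/forallP=> Q; apply/forallP=> A.
  by apply/implyP=> /eqP E1; apply/implyP=> /eqP E2; apply/eqP; apply: h2 E1 E2.
Qed.

Definition mdom (m : {ffun {set V} -> option {set V}}) := [set P | m P].

Definition maximum_matching m :=
  valid_matching m /\ forall m', valid_matching m' -> #|mdom m'| <= #|mdom m|.

Lemma maximum_matching_exists : exists m, maximum_matching m.
Proof.
have v0 : valid_matchingb [ffun=> None].
  by apply/valid_matchingP; split=> [P A|P Q A]; rewrite ffunE.
case: (@arg_maxnP _ [ffun=> None] valid_matchingb (fun m => #|mdom m|) v0) => m vm mx.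
exists m; split; first exact/valid_matchingP.
by move=> m' /valid_matchingP /mx.
Qed.

Definition unmatched (m : {ffun {set V} -> option {set V}}) A := A \in H /\ forall P, m P <> Some A.

Definition alt_step (m : {ffun {set V} -> option {set V}}) : rel {set V} :=
  fun A B => [exists P : {set V}, [&& #|P| == 2, P \subset A & m P == Some B]].

Definition rematch (m : {ffun {set V} -> option {set V}}) P A :=
  [ffun Q => if Q == P then Some A else m Q].

Lemma rematch_valid m (P A : {set V}) : valid_matching m -> unmatched m A ->
  #|P| = 2 -> P \subset A -> valid_matching (rematch m P A).
Proof.
move=> [v1 v2] [HA nA] cP sPA; split=> [Q B|Q Q' B]; rewrite !ffunE.
  by case: eqP => [-> [<-]//|_]; apply: v1.
case: eqP => [->|_]; case: eqP => [->|_] //.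
- by move=> [<-] /nA.
- by move=> + [E]; rewrite -E => /nA.
- exact: v2.
Qed.

(** Otherwise the alternating path would be augmenting. The first step A, B of the
path along P0 is undone by giving P0 to A: then B is unmatched instead of A,
the matching is still maximum, and the path is shorter. *)
Lemma augment m (A : {set V}) p : maximum_matching m -> unmatched m A ->
  path (alt_step m) A p -> uniq (A :: p) ->
  forall P : {set V}, #|P| = 2 -> P \subset last A p -> m P.
Proof.
elim: p m A => [|B p IH] m A [vm mx] uA /=.
  move=> _ _ P cP sP; apply/negPn/negP => nP.
  have := mx _ (rematch_valid vm uA cP sP); apply/negP; rewrite -ltnNge.
  apply: proper_card; apply/properP; split.
    by apply/subsetP=> Q; rewrite !inE ffunE; case: eqP.
  by exists P; rewrite !inE ?ffunE ?eqxx // (negPf nP).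
move=> /andP[/existsP[P0 /and3P[/eqP c0 s0 /eqP e0]] pth] /andP[nA /= /andP[nB un]] P cP sP.
(* Shift the matching along the first step of the path. *)
have vm' := rematch_valid vm uA c0 s0.
have dom' : mdom (rematch m P0 A) = mdom m.
  by apply/setP=> Q; rewrite !inE ffunE; case: eqP => // ->; rewrite e0.
have AB : B != A by move: nA; rewrite inE negb_or eq_sym => /andP[].
have uB : unmatched (rematch m P0 A) B.
  split; first by case: vm => /(_ _ _ e0)[].
  move=> Q; rewrite ffunE; case: eqP => [_ [E]|ne E]; first by rewrite E eqxx in AB.
  by case: vm => _ /(_ _ _ _ E e0).
have pth' : path (alt_step (rematch m P0 A)) B p.
  apply: path_subrel_in pth => X Y pY /existsP[P' /and3P[c' s' /eqP e']].
  apply/existsP; exists P'; rewrite c' s' ffunE; case: (eqVneq P' P0) => [E|_]; last by rewrite e' eqxx.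
  by move: e' nB; rewrite E e0 => -[->]; rewrite pY.
have := IH _ _ _ uB pth' _ P cP sP.
rewrite /= nB un => /(_ _ isT); rewrite ffunE.
have [->|_] := eqVneq P P0; first by rewrite e0.
by apply; split => // m'; rewrite dom'; apply: mx.
Qed.

(** The hyperedges outside the set R of those reachable from unmatched ones are
all matched, and are replaced by their pairs. Such a pair is not contained in
a member of R, whose pairs all represent members of R; so the new family is
again Sperner. *)
Lemma pair_representatives r : 1 < r -> sperner H ->
  {in H, forall A : {set V}, 1 < #|A| <= r} ->
  exists (g : rel V) (phi : {set V} -> {set V}) (F : {set {set V}}),
  [/\ symmetric g /\ irreflexive g,
      forall x y, g x y -> [set x; y] \subset phi [set x; y] /\ phi [set x; y] \in H,
      forall x y x' y', g x y -> g x' y' ->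
        phi [set x; y] = phi [set x'; y'] -> [set x; y] = [set x'; y'],
      sperner F /\ {in F, forall A : {set V}, clique g A /\ #|A| <= r}
    & #|F| = #|H|].
Proof.
move=> r2 aH szH; have [m mxm] := maximum_matching_exists.
have [[v1 v2] mx] := mxm.
pose R := [set A | [exists A0, [&& A0 \in H, [forall P, m P != Some A0] &
                       connect (alt_step m) A0 A]]].
pose phi P := odflt set0 (m P).
have HR : R \subset H.
  apply/subsetP=> A; rewrite inE => /existsP[A0 /and3P[HA0 _ /connectP[p pth ->]]].
  elim/last_ind: p pth => [//|p B _]; rewrite rcons_path last_rcons.
  by case/andP=> _ /existsP[P /and3P[_ _ /eqP /v1[]]].
have RP (A P : {set V}) : A \in R -> #|P| = 2 -> P \subset A -> m P /\ phi P \in R.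
  rewrite inE => /existsP[A0 /and3P[HA0 /forallP nA0 con]] cP sP.
  have mP : m P.
    have /connectP[p0 /shortenP[p pth un _] E] := con.
    have uA0 : unmatched m A0 by split=> // Q; apply/eqP.
    by apply: (augment mxm uA0 pth un cP); rewrite -E.
  split=> //; rewrite inE; apply/existsP; exists A0; rewrite HA0 /=.
  apply/andP; split; first exact/forallP.
  apply: connect_trans con (connect1 _).
  by apply/existsP; exists P; rewrite cP sP /phi; case: (m P) mP => //= B _; rewrite !eqxx.
pose E := [set P | m P && (phi P \notin R)].
have mE (P : {set V}) : P \in E -> exists2 A, m P = Some A & A \in H :\: R.
  rewrite inE /phi; case Em: (m P) => [A|//] /= nR; exists A => //.
  by rewrite in_setD nR; case: (v1 _ _ Em).
pose g : rel V := fun x y => (x != y) && m [set x; y].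
exists g, phi, (R :|: E); split.
- split=> [x y|x]; last by rewrite /g eqxx.
  by rewrite /g eq_sym setUC.
- move=> x y /andP[_]; rewrite /phi; case Em: (m _) => [A|//] _ /=.
  by case: (v1 _ _ Em).
- move=> x y x' y' /andP[_] + /andP[_]; rewrite /phi.
  case E1: (m _) => [A|//] _; case E2: (m _) => [B|//] _ /= AB.
  by apply: (v2 _ _ A) => //; rewrite E2 AB.
- have cE (P : {set V}) : P \in E -> #|P| = 2 by case/mE=> A /v1[].
  have nER (P : {set V}) : P \in E -> P \notin R.
    move=> PE; apply/negP => PR; have [_] := RP _ _ PR (cE _ PE) (subxx _).
    by move: PE; rewrite inE => /andP[_ /negP].
  have sub2 (A P : {set V}) : 1 < #|A| -> #|P| = 2 -> A \subset P -> A = P.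
    by move=> sA cP sAP; apply/eqP; rewrite eqEcard sAP cP.
  split.
    move=> A B /setUP[AR|AE] /setUP[BR|BE] sAB.
    - by apply: aH => //; apply: (subsetP HR).
    - by apply: sub2 (cE _ BE) sAB; have /szH/andP[] := subsetP HR _ AR.
    - have [_] := RP _ _ BR (cE _ AE) sAB.
      by move: AE; rewrite inE => /andP[_ /negPf->].
    - by apply: sub2 sAB; rewrite ?cE.
  move=> A /setUP[AR|AE]; last first.
    split; last by rewrite cE.
    have /cards2P[a [b [ab EA]]] : #|A| == 2 by rewrite cE.
    have mA : m [set a; b] by rewrite -EA; move: AE; rewrite inE => /andP[].
    have mA' : m [set b; a] by rewrite setUC.
    move=> x y; rewrite EA /g => /set2P[]-> /set2P[]->; rewrite ?eqxx //.
      by rewrite mA => ->.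
    by rewrite mA' => ->.
  split; last by have /szH/andP[] := subsetP HR _ AR.
  move=> x y Ax Ay xy; rewrite /g xy.
  apply: (RP A _ AR _ _).1; first by rewrite cards2 xy.
  by apply/subsetP=> z; rewrite !inE => /orP[]/eqP->.
have dis : [disjoint R & E].
  rewrite -setI_eq0; apply/eqP/setP=> P; rewrite in_set0; apply/negP=> /setIP[PR PE].
  have [A /v1[cP _ _] _] := mE _ PE; have [_] := RP _ _ PR cP (subxx _).
  by move: PE; rewrite inE => /andP[_ /negP].
rewrite cardsU (disjoint_setI0 dis) cards0 subn0.
rewrite -(cardsID R H) (setIidPr HR); congr (_ + _).
have inj : {in E &, injective phi}.
  move=> P Q /mE[A EA _] /mE[B EB _]; rewrite /phi EA EB /= => AB.
  by apply: (v2 _ _ A); rewrite ?EA // EB AB.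
rewrite -(card_in_imset inj).
apply: eq_card => A; apply/imsetP/idP.
  by case=> P /mE[B EB]; rewrite /phi EB => BH ->.
move=> /setDP[HA nA].
have /existsP[P /eqP EP] : [exists P, m P == Some A].
  apply: contraNT nA; rewrite negb_exists => nm; rewrite inE.
  by apply/existsP; exists A; rewrite HA nm connect0.
exists P; last by rewrite /phi EP.
by rewrite inE /phi EP /= nA.
Qed.

End Matching.

(** * Two disjoint paths in a 2-connected graph *)

Section Paths.
Variables (T : finType) (e : rel T).
Implicit Types (W D S Y Z : {set T}) (x y z : T) (p q : seq T).

(** Small sets W are admitted, unlike for 2-connected graphs. *)
Definition two_connected_in W :=
  induced_connected e W /\ forall w, induced_connected e (W :\ w).

Definition upath W x p := [&& path e x p, uniq (x :: p) & all (mem W) (x :: p)].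

Lemma upath_path W x p : upath W x p -> path e x p. Proof. by case/and3P. Qed.
Lemma upath_uniq W x p : upath W x p -> uniq (x :: p). Proof. by case/and3P. Qed.
Lemma upath_sub W x p : upath W x p -> {subset x :: p <= W}.
Proof. by case/and3P=> _ _ /allP. Qed.

Lemma upathW W W' x p : W \subset W' -> upath W x p -> upath W' x p.
Proof.
move=> /subsetP s /and3P[p1 p2 /allP p3]; apply/and3P; split=> //.
by apply/allP=> u /p3 /s.
Qed.

Lemma upath_nil W x : x \in W -> upath W x [::].
Proof. by rewrite /upath /= andbT. Qed.

Lemma upath_cat W x p q : upath W x p -> upath W (last x p) q ->
  (forall u, u \in x :: p -> u \in q -> False) -> upath W x (p ++ q).
Proof.
move=> /and3P[p1 p2 p3] /and3P[q1 /=/andP[_ q2] /andP[_ q3]] dis.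
rewrite /upath cat_path p1 q1 -cat_cons cat_uniq p2 q2 all_cat p3 q3 /= !andbT.
by apply/hasPn=> u uq; apply/negP=> up; apply: dis up uq.
Qed.

Lemma upath_catP W x p q : upath W x (p ++ q) ->
  [/\ upath W x p, upath W (last x p) q & forall u, u \in x :: p -> u \in q -> False].
Proof.
rewrite /upath cat_path -cat_cons cat_uniq all_cat.
move=> /and3P[/andP[p1 q1] /and3P[p2 /hasPn d q2] /andP[p3 q3]].
have lp : last x p \in x :: p := mem_last _ _.
split.
- by rewrite p1 p2 p3.
- have lW : last x p \in W := allP p3 _ lp.
  rewrite q1 /= q2 q3 lW !andbT.
  by apply/negP => /d; rewrite /= lp.
- by move=> u u1 /d; rewrite u1.
Qed.

Lemma upath_prefix x p z : z \in x :: p -> exists p1 p2, p = p1 ++ p2 /\ last x p1 = z.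
Proof.
rewrite inE => /orP[/eqP->|]; first by exists [::], p.
case/splitPr=> p1 p2; exists (rcons p1 z), p2.
by rewrite last_rcons cat_rcons.
Qed.

Lemma conn_upath D x y : induced_connected e D -> x \in D -> y \in D ->
  exists2 p, upath D x p & last x p = y.
Proof.
move=> con xD yD; have /connectP[p0 /shortenP[p pth un _] ->] := con _ _ xD yD.
exists p => //; apply/and3P; split=> //.
  by apply: sub_path pth => u v /andP[].
apply/allP=> u; rewrite inE => /orP[/eqP->//|].
elim: p x pth {un xD} => //= v p IH x /andP[/andP[/andP[_ vD] _] pth].
by rewrite inE => /orP[/eqP->//|]; apply: IH pth.
Qed.

Definition link W S Y x p :=
  [/\ x \in S, last x p \in Y, upath W x p,
      {in x :: p, forall u, u \in S -> u = x}
    & {in x :: p, forall u, u \in Y -> u = last x p}].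

(** Take a shortest subpath that still starts in S and ends in Y. *)
Lemma trim_link W S Y x p : upath W x p -> x \in S -> last x p \in Y ->
  exists y q, link W S Y y q /\ {subset y :: q <= x :: p}.
Proof.
move En: (size p) => n; elim: n {-2}n (leqnn n) x p En => [|n IH] m.
  rewrite leqn0 => /eqP-> x [] // _ up xS lY; exists x, [::]; split=> //.
  by split=> // u; rewrite inE => /eqP.
move=> le_mn x p Ep up xS lY.
have [/hasP[u up' uS]|/hasPn hS] := boolP (has (mem S) p).
  case/splitPr: up' Ep up lY => p1 p2; rewrite last_cat /= size_cat /= => Ep.
  rewrite -cat_rcons => /upath_catP[_]; rewrite last_rcons => u2 _ lY.
  have [|y [q [lq sq]]] := IH (size p2) _ u p2 erefl u2 uS lY; first by move: Ep le_mn; clear; move: (size p1) (size p2) => a b; lia.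
  by exists y, q; split=> // v /sq; rewrite !inE mem_cat mem_rcons inE => /orP[]->; rewrite ?orbT.
have [/hasP[u up' uY]|/hasPn hY] := boolP (has (mem Y) (belast x p)).
  case/splitPr E: _ / up' => [p1 p2]; case: p1 E => [|x' p1] /= E.
    case: p up lY E hS Ep => // a p up lY [xu _] hS Ep; rewrite -xu in uY.
    exists x, [::]; split; last by move=> z; rewrite !inE => ->.
    by split=> //; rewrite ?upath_nil ?(upath_sub up) ?mem_head // => z; rewrite inE => /eqP.
  have [v [r Er]] : exists v r, p = p1 ++ u :: v :: r.
    have : x :: p = x' :: p1 ++ u :: rcons p2 (last x p).
      by rewrite lastI E /= -cats1 -catA /= cats1.
    case=> _ ->; case: p2 {E} => [|v p2]; first by exists (last x p), [::].
    by exists v, (rcons p2 (last x p)).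
  move: up; rewrite Er -cat_rcons => /upath_catP[u1 _ _].
  have [||y [q [lq sq]]] := IH (size (rcons p1 u)) _ x (rcons p1 u) erefl u1 xS _.
  - by move: Ep le_mn; rewrite Er size_cat size_rcons /=; clear; move: (size p1) (size r) => a b; lia.
  - by rewrite last_rcons.
  exists y, q; split=> // w /sq; rewrite !inE mem_cat.
  by case/orP=> ->; rewrite ?orbT.
exists x, p; split=> //; split=> // u.
  by rewrite inE => /orP[/eqP//|/hS/= /negP h /h].
by rewrite lastI mem_rcons inE => /orP[/eqP//|/hY /= /negP h /h].
Qed.

Lemma conn_link D S Y x y : induced_connected e D -> x \in D -> y \in D ->
  x \in S -> y \in Y -> exists z p, link D S Y z p.
Proof.
move=> con xD yD xS yY; have [p up lp] := conn_upath con xD yD.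
have [|z [q [lk _]]] := trim_link up xS (Y := Y); first by rewrite lp.
by exists z, q.
Qed.

Definition two_links W S Y s0 t0 := exists q y q',
  [/\ link W S Y s0 q, link W S Y y q', forall u, u \in s0 :: q -> u \in y :: q' -> False
    & t0 \in [:: last s0 q; last y q']].

(** The given path from s0 to t0 is followed step by step; b is the part of it
behind the vertex w. Two disjoint paths start in S, one of them at s0: the
first, qa, has just reached w and avoids b; the second, qb, has jumped over w,
to a vertex w' of b or to a vertex of Y other than t0. In the second case the
first path is completed along b. In the first case, some path avoiding w'
leads from what has been visited before w' to the part behind w' or to Y. It
leaves from qb, from qa continued along the given path, or from a new vertex
of S; in each case one of the old paths is extended to w' and the other is
replaced by a path that jumps over w'. *)
Lemma two_paths_step W S Y s0 t0 : two_connected_in W -> S \subset W -> Y \subset W ->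
  t0 \in Y -> (exists2 t, t \in Y & t != t0) ->
  forall n b w x qa y qb, size b <= n ->
  [/\ upath W w b, last w b = t0, {in b, forall u, u \notin S}
    & {in b, forall u, u \in Y -> u = t0}] ->
  [/\ x \in S, last x qa = w, upath W x qa, {in x :: qa, forall u, u \in S -> u = x}
    & {in x :: qa, forall u, (u \in b -> False) /\ (u \in Y -> u = t0 /\ b = [::])}] ->
  [/\ y \in S, last y qb \in b \/ (last y qb \in Y /\ last y qb <> t0),
     upath W y qb, {in y :: qb, forall u, u \in S -> u = y}
    & {in y :: qb, forall u, u \in b \/ u \in Y -> u = last y qb}] ->
  (forall u, u \in x :: qa -> u \in y :: qb -> False) ->
  s0 \in [:: x; y] -> two_links W S Y s0 t0.
Proof.
move=> [_ cut] sS sY t0Y [t1 t1Y t10].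
elim=> [|n IH] b w x qa y qb le_b [ub lb bS bY] [xS la ua aS aY] [yS eb uB BS BbY] dis s0xy.
  case: b le_b ub lb bS bY aY eb BbY => //= _ ub lb _ _ aY [//|[eY ne]] BbY.
  have lA : link W S Y x qa.
    split=> //; first by rewrite la lb.
    by move=> u uA uY; have [_ /(_ uY)[->]] := aY u uA; rewrite la lb.
  have lB : link W S Y y qb by split=> // u uB' uY; apply: BbY => //; right.
  move: s0xy; rewrite !inE => /orP[]/eqP->.
    by exists qa, y, qb; split=> //; rewrite la lb !inE eqxx.
  exists qb, x, qa; split=> //; last by rewrite la lb !inE eqxx orbT.
  by move=> u u1 u2; apply: dis u2 u1.
case: eb => [eb|[eY ne]]; last first.
  have aE u : u \in x :: qa ++ b -> u \in x :: qa \/ u \in b.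
    by rewrite -cat_cons mem_cat => /orP.
  have lA : link W S Y x (qa ++ b).
    split=> //.
    - by rewrite last_cat la lb.
    - by apply: upath_cat; rewrite ?la // => u /aY[].
    - by move=> u /aE[/aS//|/bS/negP h /h].
    move=> u; rewrite last_cat la lb => /aE[/aY[_ h] /h[]//|]; exact: bY.
  have lB : link W S Y y qb by split=> // u uB' uY; apply: BbY => //; right.
  have dis' u : u \in x :: qa ++ b -> u \in y :: qb -> False.
    move=> /aE[|ub'] uB'; first by move/dis; apply.
    have E := BbY u uB' (or_introl ub'); apply: ne.
    by rewrite -E; apply: bY => //; rewrite E.
  move: s0xy; rewrite !inE => /orP[]/eqP->.
    by exists (qa ++ b), y, qb; split=> //; rewrite last_cat la lb !inE eqxx.
  exists qb, x, (qa ++ b); split=> //; last by rewrite last_cat la lb !inE eqxx orbT.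
  by move=> u u1 u2; apply: dis' u2 u1.
move Ew: (last y qb) => w'; rewrite Ew in eb BbY.
case/splitPr Eb: _ / eb => [b1 b2]; rewrite Eb in bS bY ub lb BbY aY le_b.
have [_ ub1 _] := upath_catP (ub : upath W w ([::] ++ _)).
move: ub; rewrite -cat_rcons => /upath_catP[ub1' ub2 db]; rewrite last_rcons in ub2.
have lb2 : last w' b2 = t0 by rewrite -lb last_cat.
have [uB1 uB2 db1] : [/\ upath W w b1, w' \notin w :: b1 & w' \notin b2].
  move: ub1'; rewrite -cats1 => /upath_catP[? _ d]; split=> //.
    by apply/negP => /d; apply; rewrite mem_head.
  by have := upath_uniq ub2; rewrite /= => /andP[].
have uA0 : upath W x (qa ++ b1).
  apply: upath_cat; rewrite ?la // => u /aY[h _] ub'; apply: h.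
  by rewrite mem_cat ub'.
have uA1 : upath W x (qa ++ rcons b1 w').
  apply: upath_cat; rewrite ?la // => u /aY[h _] ub'; apply: h.
  by rewrite -cat_rcons mem_cat ub'.
have w'S : w' \notin S by apply: bS; rewrite mem_cat mem_head orbT.
have A0E u : u \in x :: qa ++ b1 -> u \in x :: qa \/ u \in b1.
  by rewrite -cat_cons mem_cat => /orP.
have A1E u : u \in x :: qa ++ rcons b1 w' -> u \in x :: qa ++ b1 \/ u = w'.
  by rewrite -!cat_cons !mem_cat mem_rcons !inE => /or3P[->|/eqP->|->]; rewrite ?orbT; auto.
have A0w u : u \in x :: qa ++ b1 -> u != w'.
  move=> /A0E[/aY[h _]|ub1'']; apply/eqP => E; rewrite E in h || idtac.
  - by apply: h; rewrite mem_cat mem_head orbT.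
  - by move: uB2; rewrite inE negb_or -E ub1'' andbF.
have A0b2 u : u \in x :: qa ++ b1 -> u \in b2 -> False.
  move=> /A0E[/aY[h _] h2|h1 h2]; first by apply: h; rewrite mem_cat inE h2 !orbT.
  by apply: (db u) h2; rewrite inE mem_rcons inE h1 !orbT.
have A0Y u : u \in x :: qa ++ b1 -> u \in Y -> False.
  move=> uA uY; case: (A0E _ uA) => [/aY[_ /(_ uY)[_]]|ub']; first by case: (b1).
  have E : u = t0 by apply: bY => //; rewrite mem_cat ub'.
  have := mem_last w' b2; rewrite lb2 inE -E => /orP[/eqP E'|].
    by have := A0w _ uA; rewrite E' eqxx.
  exact: A0b2.
have A0S u : u \in x :: qa ++ b1 -> u \in S -> u = x.
  move=> /A0E[/aS//|ub'] uS.
  by have /negP[] : u \notin S by apply: bS; rewrite mem_cat ub'.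
have A0B u : u \in x :: qa ++ b1 -> u \in y :: qb -> False.
  move=> uA uB'; case: (A0E _ uA) => [/dis/(_ uB')//|ub'].
  have E := BbY u uB' (or_introl _); move: (A0w _ uA); rewrite E ?eqxx //.
  by rewrite mem_cat ub'.
pose Z := [set z in (x :: qa ++ b1) ++ (y :: qb) | z != w'] :|: S.
pose Y' := [set u in b2] :|: Y.
have [y1 y1Y y1w] : exists2 y1, y1 \in Y & y1 != w'.
  have [E|ne] := eqVneq t0 w'; first by exists t1; rewrite -?E.
  by exists t0.
have xw : x \in W :\ w'.
  by rewrite !inE (subsetP sS) // andbT; apply: contraNneq w'S => <-.
have y1W : y1 \in W :\ w' by rewrite !inE y1w (subsetP sY).
have [z [r [zZ lr ur rZ rY]]] : exists z r, link (W :\ w') Z Y' z r.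
  apply: (conn_link (cut w') xw y1W); first by rewrite inE xS orbT.
  by rewrite inE y1Y orbT.
have rw u : u \in z :: r -> u \in W /\ u != w'.
  by move/(upath_sub ur); rewrite !inE => /andP[].
have urW : upath W z r by apply: upathW ur; rewrite subD1set.
have zr : z \notin r by have := upath_uniq ur; rewrite /= => /andP[].
have rZ' u : u \in r -> u \in Z -> False.
  move=> ur' uZ; have := rZ u _ uZ; rewrite inE ur' orbT => /(_ isT) E.
  by rewrite -E ur' in zr.
have wEnd : last z r \in b2 \/ (last z r \in Y /\ last z r <> t0).
  move: lr; rewrite !inE => /orP[->|lY]; first by left.
  have [E|/eqP] := eqVneq (last z r) t0; last by right.
  left; have := mem_last w' b2; rewrite lb2 E inE => /orP[/eqP E'|//].
  by have [_] := rw _ (mem_last z r); rewrite E E' eqxx.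
(* The new jumping path: an initial piece p1 of what has been visited, followed by r. *)
have mkB c p1 : c \in S -> upath W c p1 -> last c p1 = z ->
   {in c :: p1, forall u, u \in Z} ->
   {in c :: p1, forall u, u \in S -> u = c} ->
   {in c :: p1, forall u, u \in Y' -> u = z} ->
   [/\ c \in S,
     last c (p1 ++ r) \in b2 \/ last c (p1 ++ r) \in Y /\ last c (p1 ++ r) <> t0,
     upath W c (p1 ++ r), {in c :: p1 ++ r, forall u, u \in S -> u = c}
   & {in c :: p1 ++ r, forall u, u \in b2 \/ u \in Y -> u = last c (p1 ++ r)}].
  move=> cS up lp pZ pS pY; rewrite last_cat lp; split=> //.
  - by apply: upath_cat; rewrite ?lp // => u /pZ uZ /rZ'; apply.
  - move=> u; rewrite -cat_cons mem_cat => /orP[/pS//|ur'] uS.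
    by case: (rZ' u ur'); rewrite inE uS orbT.
  move=> u uin ubY; have {ubY} uY' : u \in Y' by rewrite !inE; case: ubY => ->; rewrite ?orbT.
  move: uin; rewrite -cat_cons mem_cat => /orP[up'|ur']; last by apply: rY; rewrite // inE ur' orbT.
  by have E := pY u up' uY'; rewrite E in uY' *; apply: rY uY'; rewrite mem_head.
have tail : [/\ upath W w' b2, last w' b2 = t0, {in b2, forall u, u \notin S}
    & {in b2, forall u, u \in Y -> u = t0}].
  split=> // u ub2'; [apply: bS | apply: bY]; by rewrite mem_cat inE ub2' !orbT.
have w'Y : w' \in Y -> w' = t0 /\ b2 = [::].
  move=> wY; have E : w' = t0 by apply: bY; rewrite // mem_cat mem_head orbT.
  split=> //; case: (b2) lb2 db1 => // a b2' /= E'; rewrite E -E'.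
  by rewrite mem_last.
(* The first path, continued along the given path up to w'. *)
have mkA1 : [/\ x \in S, last x (qa ++ rcons b1 w') = w', upath W x (qa ++ rcons b1 w'),
   {in x :: qa ++ rcons b1 w', forall u, u \in S -> u = x}
  & {in x :: qa ++ rcons b1 w', forall u, (u \in b2 -> False) /\ (u \in Y -> u = t0 /\ b2 = [::])}].
  split=> //; first by rewrite last_cat last_rcons.
    by move=> u /A1E[/A0S//|->] uS; rewrite uS in w'S.
  move=> u /A1E[uA|->]; last by split=> //; apply/negP.
  by split=> [|/(A0Y _ uA)//]; apply: A0b2.
(* The second path already ends at w', and takes the role of the first one. *)
have mkB1 : [/\ y \in S, last y qb = w', upath W y qb, {in y :: qb, forall u, u \in S -> u = y}
  & {in y :: qb, forall u, (u \in b2 -> False) /\ (u \in Y -> u = t0 /\ b2 = [::])}].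
  split=> // u uB'; split=> [ub2'|uY].
    have E : u = w' by apply: BbY => //; left; rewrite mem_cat inE ub2' !orbT.
    by rewrite -E ub2' in db1.
  have E : u = w' by apply: BbY => //; right.
  by rewrite E; apply: w'Y; rewrite -E.
have le_b2 : size b2 <= n.
  by move: le_b; rewrite size_cat /=; clear; move: (size b1) (size b2) => i j; lia.
have AZ u : u \in x :: qa ++ b1 -> u \in Z.
  by move=> uA; rewrite in_setU in_set mem_cat uA (A0w _ uA).
have BZ u : u \in y :: qb -> u != w' -> u \in Z.
  by move=> uB' ne; rewrite in_setU in_set mem_cat uB' ne orbT.
have rA1 u : u \in x :: qa ++ rcons b1 w' -> u \in r -> False.
  move=> /A1E[uA|->] ur'.
    exact: rZ' (AZ _ uA).
  by have [_] := rw w' (mem_behead (s := z :: r) ur'); rewrite eqxx.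
have rB1 u : u \in y :: qb -> u \in r -> False.
  move=> uB' ur'; have [_ ne] := rw u (mem_behead (s := z :: r) ur').
  exact: rZ' (BZ _ uB' ne).
have BY' u : u \in y :: qb -> u != w' -> u \in Y' -> u = z.
  move=> uB' /eqP ne; rewrite !inE => uY'; case: ne; apply: BbY => //.
  by case/orP: uY' => ?; [left; rewrite mem_cat inE; apply/orP; right; apply/orP; right | right].
have zw : z != w' by case: (rw z (mem_head _ _)).
have [zB|zB] := boolP (z \in y :: qb).
  have [p1 [p2 [Eq lp]]] := upath_prefix zB.
  have [u1 u2 d12] := upath_catP (eq_ind _ (fun q => upath W y q) uB _ Eq).
  have sp1 u : u \in y :: p1 -> u \in y :: qb by rewrite Eq -cat_cons mem_cat => ->.
  have p1w u : u \in y :: p1 -> u != w'.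
    move=> up; apply/eqP=> E; move: Ew; rewrite Eq last_cat lp => Ew.
    case: p2 Ew {Eq u2} d12 => [|a p2] /= Ew d12; first by rewrite Ew eqxx in zw.
    by apply: (d12 u up); rewrite E -Ew; apply: mem_last.
  apply: (IH b2 w' x _ y (p1 ++ r) le_b2 tail mkA1 _ _ s0xy).
    apply: mkB => // u up; have uw := p1w _ up.
    - exact: BZ (sp1 _ up) uw.
    - exact: BS (sp1 _ up).
    - exact: BY' (sp1 _ up) uw.
  move=> u uA; rewrite -cat_cons mem_cat => /orP[up|ur']; last exact: rA1 ur'.
  case: (A1E _ uA) => [uin|E]; first exact: A0B uin (sp1 _ up).
  by have := p1w _ up; rewrite E eqxx.
have s0yx : s0 \in [:: y; x] by move: s0xy; rewrite !inE orbC.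
have [zA|zA] := boolP (z \in x :: qa ++ b1).
  have [p1 [p2 [Eq lp]]] := upath_prefix zA.
  have [u1 u2 d12] := upath_catP (eq_ind _ (fun q => upath W x q) uA0 _ Eq).
  have sp1 u : u \in x :: p1 -> u \in x :: qa ++ b1 by rewrite Eq -cat_cons mem_cat => ->.
  apply: (IH b2 w' y qb x (p1 ++ r) le_b2 tail mkB1 _ _ s0yx).
    apply: mkB => // u up; have uA := sp1 _ up.
    - exact: AZ.
    - exact: A0S.
    - by rewrite !inE => /orP[/(A0b2 _ uA)|/(A0Y _ uA)].
  move=> u uB'; rewrite -cat_cons mem_cat => /orP[up|ur']; last exact: rB1 ur'.
  exact: A0B (sp1 _ up) uB'.
have zS : z \in S by move: zZ; rewrite in_setU in_set mem_cat (negPf zA) (negPf zB).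
have mkB0 := @mkB z [::] zS (upath_nil (proj1 (rw z (mem_head _ _)))) erefl.
have {}mkB0 := mkB0 (fun u h => eq_ind_r (fun v => v \in Z) zZ (eqP (etrans (esym (mem_seq1 u z)) h)))
  (fun u h _ => eqP (etrans (esym (mem_seq1 u z)) h)) (fun u h _ => eqP (etrans (esym (mem_seq1 u z)) h)).
move: s0xy; rewrite !inE => /orP[]/eqP E.
  apply: (IH b2 w' x _ z r le_b2 tail mkA1 mkB0); last by rewrite E mem_head.
  move=> u uA; rewrite inE => /orP[/eqP uz|ur']; last exact: rA1 ur'.
  case: (A1E _ uA) => [uin|E']; first by rewrite -uz uin in zA.
  by rewrite -uz E' eqxx in zw.
apply: (IH b2 w' y qb z r le_b2 tail mkB1 mkB0); last by rewrite E mem_head.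
move=> u uB'; rewrite inE => /orP[/eqP uz|ur']; last exact: rB1 ur'.
by rewrite -uz uB' in zB.
Qed.

(** The case of two paths of Menger's theorem. As in the usual augmentation step,
the ends s0 and t0 of the given path are kept among the ends of the new ones;
the cycle built in Posa's argument depends on this. *)
Lemma two_paths W S Y s0 p0 : two_connected_in W -> S \subset W -> Y \subset W ->
  link W S Y s0 p0 -> (exists2 s, s \in S & s != s0) ->
  (exists2 t, t \in Y & t != last s0 p0) -> two_links W S Y s0 (last s0 p0).
Proof.
move=> nW sS sY [s0S t0Y u0 pS pY] [s1 s1S s10] [t1 t1Y t10].
have cut := nW.2.
have s0p : s0 \notin p0 by have := upath_uniq u0; rewrite /= => /andP[].
pose Y' := [set u in p0] :|: Y.
have [y1 y1Y y1w] : exists2 y1, y1 \in Y & y1 != s0.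
  have [E|ne] := eqVneq (last s0 p0) s0; first by exists t1; rewrite // -[X in _ != X]E.
  by exists (last s0 p0).
have s1W : s1 \in W :\ s0 by rewrite !inE s10 (subsetP sS).
have y1W : y1 \in W :\ s0 by rewrite !inE y1w (subsetP sY).
have [z [r [zS lr ur rS rY]]] : exists z r, link (W :\ s0) (S :\ s0) Y' z r.
  by apply: (conn_link (cut s0) s1W y1W); rewrite inE ?y1Y ?orbT // inE s10.
have rw u : u \in z :: r -> u \in W /\ u != s0.
  by move/(upath_sub ur); rewrite !inE => /andP[].
have urW : upath W z r by apply: upathW ur; rewrite subD1set.
apply: (@two_paths_step W S Y s0 (last s0 p0) nW sS sY t0Y _ (size p0) p0 s0 s0 [::] z r) => //.
- by exists t1.
- split=> // u up.
    by apply/negP=> /pS; rewrite inE up orbT => /(_ isT) E; rewrite -E up in s0p.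
  by apply: pY; rewrite inE up orbT.
- split=> //; first by rewrite upath_nil // (subsetP sS).
    by move=> u; rewrite inE => /eqP.
  move=> u; rewrite inE => /eqP->; split=> [|s0Y]; first exact/negP.
  have E := pY s0 (mem_head _ _) s0Y; split=> //.
  by case: (p0) E s0p => //= a p ->; rewrite mem_last.
- split=> //.
  + by move: zS; rewrite inE => /andP[].
  + move: lr; rewrite !inE => /orP[->|lY]; first by left.
    have [E|/eqP] := eqVneq (last z r) (last s0 p0); last by right.
    left; have := mem_last s0 p0; rewrite E inE => /orP[/eqP E'|//].
    by have [_] := rw _ (mem_last z r); rewrite E E' eqxx.
  + move=> u uz uS; apply: rS => //; rewrite !inE uS andbT.
    by case: (rw _ uz).
  by move=> u uz h; apply: rY => //; rewrite !inE; case: h => ->; rewrite ?orbT.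
- by move=> u; rewrite inE => /eqP-> /rw[_]; rewrite eqxx.
- by rewrite mem_head.
Qed.

End Paths.

(** * Long paths between two vertices under a degree condition *)

Section LongPath.
Variables (V : finType) (g : rel V).
Hypotheses (gsym : symmetric g) (girr : irreflexive g).
Implicit Types (B D E : {set V}).

Lemma conn_edge E D x y : induced_connected g E -> x \in E -> x \in D ->
  y \in E -> y \notin D -> exists x' y', [/\ x' \in D, x' \in E, y' \in E, y' \notin D & g x' y'].
Proof.
move=> con xE xD yE yD; have [p up lp] := conn_upath con xE yE.
have sp := upath_sub up; have pth := upath_path up; rewrite -lp in yD.
elim: p x xD {xE up lp} sp pth yD => [|z p IH] x xD sp /=; first by rewrite xD.
move=> /andP[xz pth] yD; have [zD|zD] := boolP (z \in D).
  by apply: (IH z) => // u up; apply: sp; rewrite inE up orbT.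
by exists x, z; split=> //; apply: sp; rewrite !inE eqxx ?orbT.
Qed.

Lemma conn_nbr E x y : induced_connected g E -> x \in E -> y \in E -> y != x ->
  exists2 z, z \in E & g x z.
Proof.
move=> con xE yE ne; have [||x' [y' [/set1P-> _ ? _ ?]]] := conn_edge (D := [set x]) con xE _ yE.
- by rewrite inE.
- by rewrite inE.
by exists y'.
Qed.

(** The vertices that are not reachable from rho form a closed set. *)
Lemma root_connected E rho : rho \in E ->
  (forall C : {set V}, C != set0 -> C \subset E :\ rho ->
     (forall x y, x \in C -> y \in E -> g x y -> y \in C) -> False) ->
  induced_connected g E.
Proof.
move=> rE noC; set r := [rel u v in E | g u v].
have rsym : symmetric r by move=> u v; rewrite /= gsym; case: (u \in E); rewrite ?andbF ?andbT.
suff con x : x \in E -> connect r rho x.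
  move=> x y xE yE; apply: connect_trans (con y yE).
  by rewrite (sym_connect_sym rsym) con.
move=> xE; apply/negPn/negP => nx.
apply: (noC [set z in E | ~~ connect r rho z]).
- by apply/set0Pn; exists x; rewrite inE xE.
- apply/subsetP=> z; rewrite !inE => /andP[-> h]; rewrite andbT.
  by apply: contraNneq h => ->; rewrite connect0.
move=> z y; rewrite !inE => /andP[zE h] yE zy; rewrite yE /=.
apply: contra h => cy; apply: connect_trans cy (connect1 _).
by rewrite /= yE zE gsym.
Qed.

(** For c = u this is the theorem of Erdos and Gallai; the exceptional vertex c is
needed for blocks, whose cut vertex may have small degree. Induction on d.
Among the sets D outside u, v that are attached to the rest of B - v by at
most one vertex b, and are not just {c}, choose a smallest one; then D with b
is 2-connected. As b does not separate D from v, the vertex v has a neighbour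
v' in D, and degrees inside drop by at most one without v: a path from b to v'
given by induction is continued by v, and preceded by a path from u to b
outside D. The choice of D can be spoiled only if c lies in D and has a single
neighbour b' besides v. Then c is dropped from D, the induction hypothesis
for d - 2 gives a path from b to b', and b', c, v continues it. *)
Lemma long_path d B u v c : two_connected_in g B -> u \in B -> v \in B -> u != v ->
  d < #|B| -> (forall w, w \in B -> w \notin [:: u; v; c] -> d <= #|nbr g B w|) ->
  exists p, [/\ upath g B u p, last u p = v & d <= size p].
Proof.
elim/ltn_ind: d B u v c => d IH B u v c nB uB vB uv dB degB.
have [conB cutB] := nB.
have [d1|d2] := leqP d 1.
  have [p up lp] := conn_upath conB uB vB; exists p; split=> //.
  by case: p lp {up} => [/= E|a p _]; [rewrite E eqxx in uv|apply: leq_trans d1 _].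
have uBv : u \in B :\ v by rewrite !inE uv.
have [E|ne] := eqVneq (B :\: [set u; v]) [set c].
  have : c \in B :\: [set u; v] by rewrite E inE.
  rewrite !inE negb_or -andbA => /and3P[cu cv cB].
  have inB x : x \in B -> [|| x == u, x == v | x == c].
    move=> xB; have := in_set1 x c; rewrite -E !inE xB andbT => <-.
    by case: eqP => //=; case: eqP.
  have guc : g u c.
    have [z zB zc] : exists2 z, z \in B :\ v & g u z.
      by apply: (conn_nbr (y := c) (cutB v)) => //; rewrite !inE cv.
    move: zB zc; rewrite !inE => /andP[zv /inB]; rewrite (negPf zv) /=.
    by case/orP=> /eqP-> //; rewrite girr.
  have gcv : g c v.
    have [z zB zc] : exists2 z, z \in B :\ u & g v z.
      apply: (conn_nbr (y := c) (cutB u)) => //; first by rewrite !inE eq_sym uv.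
      by rewrite !inE cu.
    move: zB zc; rewrite !inE => /andP[zv /inB]; rewrite (negPf zv) /=.
    by case/orP=> /eqP->; rewrite ?girr // gsym.
  exists [:: c; v]; split=> //.
    by rewrite /upath /= guc gcv uB cB vB !inE negb_or eq_sym cu uv cv.
  have : #|B| = #|[set u; v]| + 1.
    rewrite -(cards1 c) -E -(cardsID [set u; v] B); congr (_ + _).
    by apply: eq_card => x; rewrite !inE; case: eqP => [->|_]; case: eqP => [->|_]; rewrite ?andbF ?andbT.
  by rewrite cards2 uv /=; move: dB => + E'; rewrite E'; case: (d) => // -[|[|[]]].
pose fam (Db : {set V} * V) := [&& Db.1 != set0, Db.1 \subset B :\: [set u; v],
  Db.1 != [set c], Db.2 \in B, Db.2 != v, Db.2 \notin Db.1 &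
  [forall x in Db.1, nbr g (B :\ v) x \subset Db.2 |: Db.1]].
have famP (D : {set V}) b : D != set0 -> D \subset B :\: [set u; v] -> D != [set c] ->
    b \in B -> b != v -> b \notin D ->
    (forall x y, x \in D -> y \in B -> y != v -> g x y -> y = b \/ y \in D) -> fam (D, b).
  move=> h1 h2 h3 h4 h5 h6 h7; rewrite /fam h1 h2 h3 h4 h5 h6 /=.
  apply/forall_inP=> x xD; apply/subsetP=> y; rewrite !inE => /andP[/andP[yv yB] xy].
  by case: (h7 x y xD yB yv xy) => [->|->]; rewrite ?eqxx ?orbT.
have fam0 : fam (B :\: [set u; v], u).
  apply: famP => //; last by move=> x y _ yB yv _; rewrite !inE yB (negPf yv) orbF andbT; case: eqP => [->|_]; [left|right].
  - rewrite -card_gt0 cardsD; have := subset_leq_card (subsetIr B [set u; v]).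
    by rewrite cards2 uv /=; move: d2 dB; clear; move: #|_ :&: _| #|B| => i j; lia.
  - by rewrite !inE eqxx.
have [[D b] /= famDb minD] := @arg_minnP _ (B :\: [set u; v], u) fam (fun Db => #|Db.1|) fam0.
have {}minD D' b' : fam (D', b') -> #|D| <= #|D'| by move/minD.
case/and5P: (famDb) => /= nD0 sD nDc bB /and3P[bv bD /forall_inP nbD].
have nbrD x y : x \in D -> y \in B -> y != v -> g x y -> y = b \/ y \in D.
  move=> xD yB yv xy; have /subsetP/(_ y) := nbD x xD.
  by rewrite !inE yv yB xy => /(_ isT)/orP[/eqP->|->]; auto.
have DB x : x \in D -> [/\ x \in B, x != u & x != v].
  by move/(subsetP sD); rewrite !inE negb_or -andbA => /and3P[].
have [x0 x0D] := set0Pn _ nD0.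
have bBv : b \in B :\ v by rewrite !inE bv.
have DBv x : x \in D -> x \in B :\ v by move=> /DB[xB _ xv]; rewrite !inE xv.
(* B minus v is connected, so D has an edge to b. *)
have [xb xbD gxb] : exists2 x, x \in D & g x b.
  have [x [y [xD _ yB yD xy]]] := conn_edge (cutB v) (DBv _ x0D) x0D bBv bD.
  move: yB; rewrite !inE => /andP[yv yB].
  by case: (nbrD x y xD yB yv xy) => [E|yD']; [exists x; rewrite -?E|rewrite yD' in yD].
(* A path from u that enters D has to pass through b before. *)
have [q [uq lq qD]] : exists q, [/\ upath g (B :\ v) u q, last u q = b & forall x, x \in u :: q -> x \notin D].
  have [z [q [/set1P-> lq uq _ qY]]] : exists z q, link g (B :\ v) [set u] (b |: D) z q.
    by apply: (conn_link (cutB v) uBv bBv); rewrite !inE eqxx.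
  have lqb : last u q = b.
    move: lq; rewrite !inE => /orP[/eqP//|lD].
    case/lastP: q uq qY lD => [|q z'] /=; first by move=> _ _ /DB[_]; rewrite eqxx.
    rewrite last_rcons => uq qY zD; have pth := upath_path uq.
    move: pth; rewrite rcons_path => /andP[_ yz].
    have yin : last u q \in u :: rcons q z' by rewrite -rcons_cons mem_rcons inE mem_last orbT.
    have := upath_sub uq yin; rewrite !inE => /andP[yv yB].
    have yY : last u q \in b |: D.
      by have [->|yD] := nbrD z' (last u q) zD yB yv (etrans (gsym _ _) yz); rewrite !inE ?eqxx ?yD ?orbT.
    by have E := qY _ yin yY; move: yz; rewrite E girr.
  exists q; split=> // x xq; apply/negP=> xD.
  have E := qY x xq; rewrite lqb in E.
  by move: bD; rewrite -E ?xD // !inE xD orbT.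
have uqB : upath g B u q by apply: upathW uq; rewrite subD1set.
have uqv x : x \in u :: q -> x != v by move/(upath_sub uq); rewrite !inE => /andP[].
have final (L : {set V}) p s : L \subset b |: D -> upath g L b p -> upath g B (last b p) s ->
    (forall x, x \in s -> x = v \/ x \in D /\ x \notin L) ->
    exists p', [/\ upath g B u p', last u p' = last (last b p) s & size p + size s <= size p'].
  move=> sL up us sP.
  have LB : L \subset B.
    apply: subset_trans sL _; apply/subsetP=> x; rewrite !inE => /orP[/eqP->//|/DB[]//].
  have pD x : x \in p -> x \in D.
    move=> xp; have xbp : x \in b :: p by rewrite inE xp orbT.
    have := subsetP sL _ (upath_sub up xbp); rewrite !inE => /orP[/eqP E|//].
    by have := upath_uniq up; rewrite /= -E xp.
  have d1 x : x \in b :: p -> x \in s -> False.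
    move=> xp xs; have xL := upath_sub up xp.
    case: (sP x xs) => [E|[_]]; last by rewrite xL.
    have := subsetP sL _ xL; rewrite E !inE eq_sym (negPf bv) /= => /DB[_ _].
    by rewrite eqxx.
  have ups : upath g B b (p ++ s) by apply: upath_cat => //; apply: upathW up.
  exists (q ++ p ++ s); split; last 2 first.
  - by rewrite !last_cat lq.
  - by rewrite !size_cat leq_addl.
  apply: upath_cat; rewrite ?lq // => x xq; rewrite mem_cat => /orP[/pD|/sP[E|[]]].
  - by apply/negP; apply: qD.
  - by have := uqv x xq; rewrite E eqxx.
  - by move=> xD; have := qD x xq; rewrite xD.
(* In the special case, {c} itself is attached by one vertex but is not an admissible D. *)
have [spec|norm] := boolP ((c \in D) && (#|nbr g (B :\ v) c| <= 1)).
  have /andP[cD c1] := spec.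
  have [cB cu cv] := DB _ cD.
  have [b' b'B gcb'] : exists2 z, z \in B :\ v & g c z.
    by apply: (conn_nbr (y := u) (cutB v)) => //; [apply: DBv | rewrite eq_sym].
  have nbc y : y \in B -> y != v -> g c y -> y = b'.
    move=> yB yv cy; move/card_le1_eqP: c1; apply; rewrite inE ?cy ?gcb' ?andbT //.
    by rewrite !inE yv.
  have b'c : b' != c by apply/eqP=> E; rewrite E girr in gcb'.
  move: (b'B); rewrite !inE => /andP[b'v b'B'].
  pose Dc := D :\ c.
  have DcD x : x \in Dc -> x \in D /\ x != c by rewrite !inE => /andP[].
  have nbrDc x y : x \in Dc -> y \in B -> y != v -> g x y -> [\/ y = b, y \in Dc | y = c /\ x = b'].
    move=> /DcD[xD xc] yB yv xy; have [->|yD] := nbrD x y xD yB yv xy; first by constructor 1.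
    have [E|yc] := eqVneq y c; last by constructor 2; rewrite !inE yc.
    constructor 3; split=> //; apply: nbc; first by case: (DB _ xD).
      by case: (DB _ xD).
    by rewrite gsym -E.
  have ltDc : #|Dc| < #|D| by rewrite [X in _ < X](cardsD1 c D) cD.
  have sDc (C : {set V}) : C \subset Dc -> C \subset B :\: [set u; v].
    by move=> sC; apply: subset_trans sD; apply: subset_trans sC _; rewrite subD1set.
  have b'b : b' != b.
    apply/eqP=> E; suff : fam (Dc, b) by move/minD; rewrite leqNgt ltDc.
    apply: famP => //.
    - apply/set0Pn; have /set0Pn[x] : D :\ c != set0; last by exists x.
      apply: contraNneq nDc => E0; rewrite eqEsubset sub1set cD andbT.
      by apply/subsetP=> x xD; apply: contraTT isT => xc; have := in_set0 x; rewrite -E0 !inE xD andbT; move: xc; rewrite !inE => ->.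
    - exact: sDc.
    - by apply/eqP=> E0; have := in_set1 c c; rewrite -E0 !inE eqxx.
    - by apply/negP=> /DcD[bD' _]; rewrite bD' in bD.
    move=> x y xDc yB yv xy; have [->|->|[_ Ex]] := nbrDc x y xDc yB yv xy; auto.
    by move: bD; rewrite -E -Ex; case: (DcD _ xDc) => ->.
  have b'D : b' \in D by have [E|//] := nbrD c b' cD b'B' b'v gcb'; rewrite E eqxx in b'b.
  have b'Dc : b' \in Dc by rewrite !inE b'c.
  (* The vertex c has a second neighbour, since b' does not separate it. *)
  have gcv : g c v.
    have [z zB gcz] : exists2 z, z \in B :\ b' & g c z.
      by apply: (conn_nbr (y := v) (cutB b')); rewrite ?inE ?cB ?vB ?andbT 1?eq_sym.
    move: zB; rewrite !inE => /andP[zb' zB]; have [<-//|zv] := eqVneq z v.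
    by rewrite (nbc z zB zv gcz) eqxx in zb'.
  pose L := b |: Dc.
  have xbDc : xb \in Dc.
    rewrite !inE xbD andbT; apply/eqP=> E; have := nbc b bB bv; rewrite -E => /(_ gxb) E'.
    by rewrite E' eqxx in b'b.
  have closed_small (C : {set V}) w : C != set0 -> C \subset Dc -> w \in B -> w != v -> w \notin C ->
     w != c ->
     (forall x y, x \in C -> y \in b |: Dc -> y != w -> g x y -> y \in C) -> ~~ (Dc \subset C) -> False.
    move=> C0 sC wB wv wC wc clC nsub.
    have cC : c \notin C by apply/negP=> /(subsetP sC); rewrite !inE eqxx.
    have [b'C|b'C] := boolP (b' \in C); last first.
      suff /minD : fam (C, w).
        by rewrite leqNgt => /negP; apply; apply: leq_ltn_trans ltDc; apply: subset_leq_card.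
      apply: famP => //; first exact: sDc.
        by apply: contraNneq cC => ->; rewrite inE.
      move=> x y xC yB yv xy; have [->|yw] := eqVneq y w; auto; right.
      have := nbrDc x y (subsetP sC _ xC) yB yv xy.
      case=> [E|yDc|[_ E]]; last by rewrite -E xC in b'C.
      - by apply: clC xC _ yw xy; rewrite E !inE eqxx.
      - by apply: clC xC _ yw xy; rewrite !inE; move: yDc; rewrite !inE => ->; rewrite orbT.
    suff /minD : fam (c |: C, w).
      rewrite leqNgt => /negP; apply; rewrite [X in _ < X](cardsD1 c D) cD cardsU1 cC ltnS.
      by apply: proper_card; rewrite properE sC.
    apply: famP => //.
    - by apply/set0Pn; exists c; rewrite !inE eqxx.
    - by apply/subsetP=> x /setU1P[->|/(subsetP sC)/(subsetP (sDc _ (subxx _)))//]; apply: (subsetP sD).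
    - by apply/eqP=> /setP/(_ b'); rewrite !inE b'C (negPf b'c).
    - by rewrite !inE negb_or wc.
    move=> x y /setU1P[->|xC] yB yv xy.
      by right; rewrite (nbc y yB yv xy) !inE b'C orbT.
    have [->|yw] := eqVneq y w; auto; right; rewrite !inE.
    have := nbrDc x y (subsetP sC _ xC) yB yv xy.
    case=> [E|yDc|[-> _]]; last by rewrite eqxx.
    - by rewrite (clC x y xC _ yw xy) ?orbT // E !inE eqxx.
    - by rewrite (clC x y xC _ yw xy) ?orbT // in_setU1 yDc orbT.
  have bc : b != c by apply: contraNneq bD => ->.
  have sub_root (C : {set V}) w : C \subset (L :\ w) :\ b -> C \subset Dc.
    move=> sC; apply/subsetP=> x /(subsetP sC) /setD1P[/eqP nxb /setD1P[_ /setU1P[|//]]].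
    by move/nxb.
  have conL : induced_connected g L.
    apply: (root_connected (rho := b)); first by rewrite !inE eqxx.
    move=> C C0 sC clC.
    have bC : b \notin C by apply/negP=> /(subsetP sC); rewrite !inE eqxx.
    apply: (closed_small C b) => //.
    - by apply/subsetP=> x /(subsetP sC) /setD1P[/eqP nxb /setU1P[/nxb|]].
    - by move=> x y xC yL _; apply: clC.
    by apply/subsetPn; exists xb => //; apply: contraNN bC => h; apply: clC h _ gxb; rewrite !inE eqxx.
  have nL : two_connected_in g L.
    split=> // w; have [->|wb] := eqVneq w b.
      apply: (root_connected (rho := b')); first by rewrite in_setD1 b'b in_setU1 b'Dc orbT.
      move=> C C0 sC clC.
      have b'C : b' \notin C by apply/negP=> /(subsetP sC); rewrite !inE eqxx.
      have bC : b \notin C by apply/negP=> /(subsetP sC); rewrite !inE eqxx !andbF.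
      apply: (closed_small C b) => //.
      - by apply/subsetP=> x /(subsetP sC) /setD1P[_ /setD1P[/eqP nxb /setU1P[/nxb|]]].
      - by move=> x y xC yL yb; apply: clC xC _; rewrite in_setD1 yb.
      by apply/subsetPn; exists b'.
    have [wDc|wDc] := boolP (w \in Dc); last first.
      have -> : L :\ w = L; last by [].
      apply/setP=> x; rewrite in_setD1 in_setU1; case: eqP => //= ->.
      by rewrite (negPf wb) (negPf wDc).
    have [wD wc] := DcD _ wDc; have [wB wu wv] := DB _ wD.
    apply: (root_connected (rho := b)); first by rewrite in_setD1 eq_sym wb in_setU1 eqxx.
    move=> C C0 sC clC.
    have wC : w \notin C by apply/negP=> /(subsetP sC); rewrite !inE eqxx !andbF.
    apply: (closed_small C w) => //; first exact: sub_root sC.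
      by move=> x y xC yL yw; apply: clC xC _; rewrite in_setD1 yw.
    by apply/subsetPn; exists w.
  have degDc w : w \in Dc -> nbr g B w \subset nbr g (L :\ w) w :|: [set c; v].
    move=> wDc; apply/subsetP=> y; rewrite !inE => /andP[yB wy]; rewrite wy !andbT.
    have [->|yv] := eqVneq y v; first by rewrite !orbT.
    have yw : y != w by apply: contraTneq wy => ->; rewrite girr.
    have := nbrDc w y wDc yB yv wy; rewrite yw.
    case=> [->|yDc|[-> _]]; rewrite ?eqxx ?orbT //.
    by move: yDc; rewrite !inE => ->; rewrite orbT.
  have degL w : w \in Dc -> w != b' -> d - 2 <= #|nbr g L w|.
    move=> wDc wb'; have [wD wc] := DcD _ wDc; have [wB wu wv] := DB _ wD.
    have := degB w wB; rewrite !inE !negb_or wu wv wc => /(_ isT) dw.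
    have := subset_leq_card (degDc w wDc); have := leq_of_leqif (leq_card_setU (nbr g (L :\ w) w) [set c; v]).
    have : #|nbr g (L :\ w) w| <= #|nbr g L w|.
      by apply: subset_leq_card; apply/subsetP=> y; rewrite !inE => /andP[/andP[_ ->]].
    rewrite cards2; move: dw; clear; case: (c != v) => /=; lia.
  have ltL : d - 2 < #|L|.
    have := degB b' b'B'; rewrite !inE !negb_or b'v b'c /=; case: (DB _ b'D) => _ -> _ /(_ isT) dw.
    have := subset_leq_card (degDc _ b'Dc); have := leq_of_leqif (leq_card_setU (nbr g (L :\ b') b') [set c; v]).
    have : #|nbr g (L :\ b') b'| < #|L|.
      rewrite (cardsD1 b' L) in_setU1 b'Dc orbT ltnS.
      by apply: subset_leq_card; apply/subsetP=> y; rewrite inE => /andP[].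
    rewrite cards2; move: dw d2; clear; case: (c != v) => /=; lia.
  have [|||||p [up lp szp]] := IH (d - 2) _ L b b' b nL _ _ _ ltL.
  - by move: d2; clear; lia.
  - by rewrite !inE eqxx.
  - by rewrite in_setU1 b'Dc orbT.
  - by rewrite eq_sym.
  - move=> w /setU1P[->|wDc]; first by rewrite !inE eqxx.
    by rewrite !inE !negb_or => /and3P[_ wb' _]; apply: degL.
  have [|||p' [up' lp' szp']] := final L p [:: c; v] _ up.
  - by apply: setUS; apply: subD1set.
  - rewrite lp /upath /= gsym gcb' gcv cB vB b'B' !inE negb_or b'c b'v cv //.
  - move=> x; rewrite !inE => /orP[]/eqP->; last by left.
    by right; split=> //; rewrite !negb_or eqxx eq_sym bc.
  exists p'; split=> //.
  by move: szp szp'; clear => /=; move: (size p) (size p') => i j; lia.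
have normC x : c \in D -> (forall y, y \in B -> y != v -> g c y -> y = x) -> False.
  move=> cD h; move/negP: (norm); apply; rewrite cD /=; apply/card_le1_eqP => y z.
  rewrite !inE => /andP[/andP[yv yB] cy] /andP[/andP[zv zB] cz].
  by transitivity x; [|symmetry]; apply: h.
pose L := b |: D.
have closed_small (C : {set V}) w : C != set0 -> C \subset D -> w \in B -> w != v -> w \notin C ->
   (forall x y, x \in C -> y \in b |: D -> y != w -> g x y -> y \in C) -> ~~ (D \subset C) -> False.
  move=> C0 sC wB wv wC clC nsub.
  suff /minD : fam (C, w).
    by rewrite leqNgt => /negP; apply; apply: proper_card; rewrite properE sC.
  have cl x y : x \in C -> y \in B -> y != v -> g x y -> y = w \/ y \in C.
    move=> xC yB yv xy; have [->|yw] := eqVneq y w; auto; right.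
    apply: (clC x y xC _ yw xy).
    by case: (nbrD x y (subsetP sC _ xC) yB yv xy) => [->|yD]; rewrite !inE ?eqxx ?yD ?orbT.
  apply: famP => //; first exact: subset_trans sD.
  apply/eqP=> E; have cC : c \in C by rewrite E inE.
  apply: (normC w (subsetP sC _ cC)) => y yB yv cy; case: (cl c y cC yB yv cy) => //.
  by rewrite E inE => /eqP Ey; move: cy; rewrite Ey girr.
have conL : induced_connected g L.
  apply: (root_connected (rho := b)); first by rewrite !inE eqxx.
  move=> C C0 sC clC.
  have bC : b \notin C by apply/negP=> /(subsetP sC); rewrite !inE eqxx.
  apply: (closed_small C b) => //.
  - by apply/subsetP=> x /(subsetP sC) /setD1P[/eqP nxb /setU1P[/nxb|]].
  - by move=> x y xC yL _; apply: clC.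
  by apply/subsetPn; exists xb => //; apply: contraNN bC => h; apply: clC h _ gxb; rewrite !inE eqxx.
have nL : two_connected_in g L.
  split=> // w; have [->|wb] := eqVneq w b.
    apply: (root_connected (rho := xb)).
      by rewrite in_setD1 in_setU1 xbD orbT andbT; apply: contraNneq bD => <-.
    move=> C C0 sC clC.
    have xbC : xb \notin C by apply/negP=> /(subsetP sC); rewrite !inE eqxx.
    have bC : b \notin C by apply/negP=> /(subsetP sC); rewrite !inE eqxx !andbF.
    apply: (closed_small C b) => //.
    - by apply/subsetP=> x /(subsetP sC) /setD1P[_ /setD1P[/eqP nxb /setU1P[/nxb|]]].
    - by move=> x y xC yL yb; apply: clC xC _; rewrite in_setD1 yb.
    by apply/subsetPn; exists xb.
  have [wD|wD] := boolP (w \in D); last first.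
    have -> : L :\ w = L; last by [].
    apply/setP=> x; rewrite in_setD1 in_setU1; case: eqP => //= ->.
    by rewrite (negPf wb) (negPf wD).
  have [wB wu wv] := DB _ wD.
  apply: (root_connected (rho := b)); first by rewrite in_setD1 eq_sym wb in_setU1 eqxx.
  move=> C C0 sC clC.
  have wC : w \notin C by apply/negP=> /(subsetP sC); rewrite !inE eqxx !andbF.
  apply: (closed_small C w) => //.
    by apply/subsetP=> x /(subsetP sC) /setD1P[/eqP nxb /setD1P[_ /setU1P[/nxb|]]].
    by move=> x y xC yL yw; apply: clC xC _; rewrite in_setD1 yw.
  by apply/subsetPn; exists w.
have degD w : w \in D -> nbr g B w \subset nbr g (L :\ w) w :|: [set v].
  move=> wD; apply/subsetP=> y; rewrite !inE => /andP[yB wy]; rewrite wy !andbT.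
  have [->|yv] := eqVneq y v; first by rewrite !orbT.
  have yw : y != w by apply: contraTneq wy => ->; rewrite girr.
  have := nbrD w y wD yB yv wy; rewrite yw.
  by case=> [->|->]; rewrite ?eqxx ?orbT.
have degL w : w \in D -> w != c -> d <= (#|nbr g (L :\ w) w|).+1.
  move=> wD wc; have [wB wu wv] := DB _ wD.
  have := degB w wB; rewrite !inE !negb_or wu wv wc => /(_ isT) dw.
  apply: leq_trans dw _; apply: leq_trans (subset_leq_card (degD w wD)) _.
  by apply: leq_trans (leq_card_setU _ _) _; rewrite cards1 addn1.
(* A vertex of full degree in D, for the lower bound on #|L|. *)
have [w0 w0D w0c] : exists2 w, w \in D & w != c.
  have [E|/subsetPn[w wD]] := boolP (D \subset [set c]); last by rewrite inE; exists w.
  by move: nDc; rewrite eqEsubset E sub1set => cD; exists x0 => //; apply: contraNneq cD => <-.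
have ltL : d - 1 < #|L|.
  have : #|nbr g (L :\ w0) w0| < #|L|.
    rewrite (cardsD1 w0 L) in_setU1 w0D orbT ltnS.
    by apply: subset_leq_card; apply/subsetP=> y; rewrite inE => /andP[].
  by have := degL w0 w0D w0c; move: d2; clear; lia.
(* Otherwise b would separate D from v. *)
have [v' v'D gv'v] : exists2 v', v' \in D & g v' v.
  have [||||x [y [xD _ yB yD xy]]] := conn_edge (E := B :\ b) (D := D) (x := x0) (y := v) (cutB b).
  - by rewrite !inE; case: (DB _ x0D) => -> _ _; rewrite andbT; apply: contraNneq bD => <-.
  - by [].
  - by rewrite !inE eq_sym bv.
  - by apply/negP=> /DB[_ _]; rewrite eqxx.
  move: yB; rewrite !inE => /andP[yb yB]; have [E|yv] := eqVneq y v; first by exists x; rewrite -?E.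
  by case: (nbrD x y xD yB yv xy) => E; [rewrite E eqxx in yb | rewrite E in yD].
have [|||||p [up lp szp]] := IH (d - 1) _ L b v' c nL _ _ _ ltL.
- by move: d2; clear; lia.
- by rewrite !inE eqxx.
- by rewrite in_setU1 v'D orbT.
- by apply: contraNneq bD => ->.
- move=> w /setU1P[->|wD]; first by rewrite !inE eqxx.
  rewrite !inE !negb_or => /and3P[_ _ wc].
  have := degL w wD wc.
  have : #|nbr g (L :\ w) w| <= #|nbr g L w|.
    by apply: subset_leq_card; apply/subsetP=> y; rewrite !inE => /andP[/andP[_ ->]].
  by clear; lia.
have [v'B v'u v'v] := DB _ v'D.
have [|||p' [up' lp' szp']] := final L p [:: v] _ up.
- by [].
- by rewrite lp /upath /= gv'v v'B vB !inE v'v.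
- by move=> x; rewrite !inE => /eqP->; left.
exists p'; split=> //.
by move: szp szp'; clear => /=; move: (size p) (size p') => i j; lia.
Qed.

End LongPath.

(** * Solid sets and degree-sum closure *)

Section Solid.
Variable V : finType.
Implicit Types (g F : rel V) (A B K W P Q : {set V}).

Definition add_edge F u v : rel V :=
  fun x y => [|| F x y, (x == u) && (y == v) | (x == v) && (y == u)].

(** By induction on the number of non-edges. As Psi is an arbitrary
proposition, the case distinction is classical. *)
Lemma maximal_graph (Psi : rel V -> Prop) W g :
  symmetric g -> irreflexive g -> (forall x y, g x y -> x \in W) -> Psi g ->
  exists F, [/\ symmetric F /\ irreflexive F, (forall x y, F x y -> x \in W),
    (forall x y, g x y -> F x y), Psi F &
    forall u v, u \in W -> v \in W -> u != v -> ~~ F u v -> ~ Psi (add_edge F u v)].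
Proof.
move En : #|[set p : V * V | ~~ g p.1 p.2]| => n.
elim/ltn_ind: n g En => n IH g En gs gi gW Pg.
case: (Classical_Prop.classic (exists u v, [/\ u \in W, v \in W, u != v, ~~ g u v & Psi (add_edge g u v)])).
  move=> [u [v [uW vW uv nuv Padd]]].
  have [|||||F [h1 h2 h3 h4 h5]] := IH _ _ (add_edge g u v) erefl.
  - rewrite -En; apply: proper_card; apply/properP; split.
      by apply/subsetP=> p; rewrite !inE /add_edge negb_or => /andP[].
    by exists (u, v); rewrite !inE /add_edge /= ?eqxx ?orbT.
  - by move=> x y; rewrite /add_edge gs; congr (_ || _); rewrite orbC andbC [in X in _ || X]andbC.
  - by move=> x; rewrite /add_edge gi /=; case: eqP => [->|_] /=; rewrite ?(negPf uv) //= andbF.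
  - by move=> x y /or3P[/gW//|/andP[/eqP->]|/andP[/eqP->]].
  - by [].
  by exists F; split=> // x y xy; apply: h3; rewrite /add_edge xy.
move=> no; exists g; split=> // u v uW vW uv nuv Padd; apply: no.
by exists u, v.
Qed.

(** The sets that survive Kopylov's disintegration: the core of degrees above
(k - 1)./2, and the sets that arise when, with K complete in a suitable
closure, the disintegration is repeated with threshold k - #|K|. *)
Inductive solid g k : {set V} -> Prop :=
| solid_core W of W != set0 & (forall w, w \in W -> (k - 1)./2 < #|nbr g W w|) : solid g k W
| solid_grow K W of solid g k K & (k - 1)./2 + 2 <= #|K| <= k - 2 & K \subset W &
    (forall w, w \in W -> w \notin K -> k - #|K| < #|nbr g W w|) : solid g k W.

Lemma nbr_lt g W w : irreflexive g -> w \in W -> #|nbr g W w| < #|W|.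
Proof.
move=> gi wW; rewrite (cardsD1 w W) wW ltnS; apply: subset_leq_card.
apply/subsetP=> y; rewrite !inE => /andP[-> h]; rewrite andbT.
by apply: contraTneq h => ->; rewrite gi.
Qed.

Lemma solid_card g k W : irreflexive g -> solid g k W -> (k - 1)./2 + 2 <= #|W|.
Proof.
move=> gi; case=> [{}W /set0Pn[w wW] h|K {}W _ /andP[h _] sKW _].
  by have := h w wW; have := nbr_lt gi wW; lia.
exact: leq_trans h (subset_leq_card sKW).
Qed.

(** What a closure of a graph provides: vertices are adjacent as soon as their
degrees add up to at least k, where each degree may be taken inside a smaller set. *)
Definition degree_closed F k W := forall A B a b, A \subset W -> B \subset W -> k <= a + b ->
  (forall x, x \in A -> a <= #|nbr F A x|) -> (forall y, y \in B -> b <= #|nbr F B y|) ->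
  forall x y, x \in A -> y \in B -> x != y -> F x y.

Lemma sub_nbr g F A B x : A \subset B -> (forall y, g x y -> F x y) -> #|nbr g A x| <= #|nbr F B x|.
Proof.
move=> sAB h; apply: subset_leq_card; apply/subsetP=> y.
by rewrite !inE => /andP[/(subsetP sAB)-> /h->].
Qed.

Lemma clique_nbr F K x : clique F K -> x \in K -> #|K|.-1 <= #|nbr F K x|.
Proof.
move=> cK xK; rewrite (cardsD1 x K) xK /=; apply: subset_leq_card.
by apply/subsetP=> y; rewrite !inE => /andP[yx yK]; rewrite yK cK // eq_sym.
Qed.

(** The degrees in the core are at least k / 2, so the core is complete. A complete
K gives its vertices degree #|K| - 1, which complements the degree of the new
vertices to k; so K is joined to all of W, and then all degrees in W are large. *)
Lemma solid_clique g F k W : solid g k W -> symmetric F ->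
  (forall x y, x \in W -> y \in W -> g x y -> F x y) -> degree_closed F k W -> clique F W.
Proof.
move=> sol Fs; elim: sol => [{}W _ dW|K {}W _ IH /andP[K1 K2] sKW dW] gF cl.
  apply: (cl W W (k - 1)./2.+1 (k - 1)./2.+1); rewrite ?subxx //; first by lia.
    move=> x xW; apply: leq_trans (dW x xW) _; apply: subset_leq_card.
    by apply/subsetP=> y; rewrite !inE => /andP[yW /gF->]; rewrite ?yW.
  move=> x xW; apply: leq_trans (dW x xW) _; apply: subset_leq_card.
  by apply/subsetP=> y; rewrite !inE => /andP[yW /gF->]; rewrite ?yW.
have sub := subsetP sKW.
have cK : clique F K.
  apply: IH => [x y xK yK|A B a b sA sB].
    by apply: gF; apply: sub.
  by apply: cl; [apply: subset_trans sA sKW | apply: subset_trans sB sKW].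
have KW x y : x \in K -> y \in W -> x != y -> F x y.
  apply: (cl K W #|K|.-1 (k - #|K|).+1); rewrite ?subxx //; first by lia.
    by move=> z; apply: clique_nbr.
  move=> z zW; have [zK|zK] := boolP (z \in K).
    apply: leq_trans (_ : #|K|.-1 <= _); first by lia.
    by apply: leq_trans (clique_nbr cK zK) (sub_nbr sKW _).
  apply: leq_trans (dW z zW zK) _; apply: subset_leq_card.
  by apply/subsetP=> y0; rewrite !inE => /andP[yW /gF->]; rewrite ?yW.
have dF z : z \in W -> (k - 1)./2.+1 <= #|nbr F W z|.
  move=> zW; apply: leq_trans (_ : #|K :\ z| <= _).
    by have := cardsD1 z K; case: (z \in K) => /=; lia.
  apply: subset_leq_card; apply/subsetP=> y; rewrite !inE => /andP[yz yK].
  by rewrite sub // Fs KW.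
by apply: (cl W W (k - 1)./2.+1 (k - 1)./2.+1); rewrite ?subxx //; lia.
Qed.

(** A vertex or an edge of the graph, as a set of one or two vertices. A path of
the incidence graph may reach the graph at a vertex or at the hyperedge that
represents an edge. *)
Definition point F W P := P \subset W /\ (#|P| = 1 \/ exists x y, F x y /\ P = [set x; y]).

(** If P or Q is an edge, then its hyperedge is the start or the end of the path
in the incidence graph, and is not available inside the path. *)
Definition avoid F P Q : rel V :=
  fun x y => [&& F x y, [set x; y] != P & [set x; y] != Q].

Definition point_path F W P Q m := exists x t,
  [/\ upath (avoid F P Q) W x t, x \in P, last x t \in Q & m <= size (x :: t)].

(** Hamiltonian-connectedness, also with edges in the role of ends. *)
Definition hamiltonian F W := forall P Q, point F W P -> point F W Q -> P <> Q ->
  point_path F W P Q #|W|.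

Lemma set2_inj (u a b : V) : a != u -> [set u; a] = [set u; b] -> a = b.
Proof.
by move=> au /setP/(_ a); rewrite !inE eqxx orbT (negPf au) => /esym/eqP.
Qed.

Lemma clique_path (e : rel V) X x p : clique e X -> uniq (x :: p) ->
  {subset x :: p <= X} -> path e x p.
Proof.
move=> cX; elim: p x => //= y p IH x /and3P[xn yn un] sub.
rewrite cX ?sub ?inE ?eqxx ?orbT //=; last by apply: contraNneq xn => ->; rewrite mem_head.
by apply: IH; rewrite /= ?yn // => z zp; apply: sub; rewrite inE zp orbT.
Qed.

Lemma point_neq0 F W P : point F W P -> P != set0.
Proof.
case=> _ [c1|[x [y [_ ->]]]]; first by rewrite -card_gt0 c1.
by apply/set0Pn; exists x; rewrite !inE eqxx.
Qed.

(** Choose ends u in P and v in Q, and let the path start with u, a and end with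
b, v, where a and b avoid the edges P and Q. With at least two vertices left
besides u and v this is possible unless P and Q are edges that join u and v
to the same vertex; the ends are chosen so that this does not happen. *)
Lemma clique_hamiltonian F W : clique F W -> 3 < #|W| -> hamiltonian F W.
Proof.
move=> cW W4 P Q pP pQ nPQ; have [sP _] := pP; have [sQ _] := pQ.
have [u [v [uP vQ uv bad]]] : exists u v, [/\ u \in P, v \in Q, u != v &
    forall w, w != u -> w != v -> P = [set u; w] -> Q = [set v; w] -> False].
  have [E0|/set0Pn[w0 /setIP[wP wQ]]] := eqVneq (P :&: Q) set0.
    have [/set0Pn[u uP] /set0Pn[v vQ]] := (point_neq0 pP, point_neq0 pQ).
    exists u, v; split=> //.
      by apply: contraTneq isT => E; have := in_set0 u; rewrite -E0 inE uP E vQ.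
    move=> w _ _ EP EQ; have := in_set0 w; rewrite -E0 EP EQ !inE eqxx !orbT //.
  have [EQ|/set0Pn[v]] := eqVneq (Q :\ w0) set0; last first.
    rewrite !inE => /andP[vw vQ]; exists w0, v; split=> //; first by rewrite eq_sym.
    move=> w w1 w2 _ EQ; move: wQ; rewrite EQ !inE eq_sym (negPf vw) /=.
    by rewrite eq_sym (negPf w1).
  have Q1 : Q = [set w0].
    by apply/eqP; rewrite eqEsubset sub1set wQ andbT -setD_eq0 EQ.
  have /set0Pn[u] : P :\ w0 != set0.
    apply/negP=> /eqP EP; apply: nPQ; rewrite Q1; apply/eqP.
    by rewrite eqEsubset sub1set wP andbT -setD_eq0 EP.
  rewrite !inE => /andP[uw uP]; exists u, w0; split=> //.
  move=> w _ w2 _ E; have := in_set1 w w0; rewrite -Q1 E !inE eqxx orbT.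
  by rewrite (negPf w2).
have uW := subsetP sP _ uP; have vW := subsetP sQ _ vQ.
set R := W :\: [set u; v].
have R2 : 1 < #|R|.
  have := cardsID [set u; v] W; have := subset_leq_card (subsetIr W [set u; v]).
  by rewrite cards2 uv; move: W4; rewrite -/R; clear; lia.
have /card_gt1P[r1 [r2 [r1R r2R r12]]] := R2.
have RP r : r \in R -> [/\ r \in W, r != u & r != v].
  by rewrite !inE negb_or -andbA => /and3P[].
have [r1W r1u r1v] := RP _ r1R; have [r2W r2u r2v] := RP _ r2R.
have [a [b [aR bR ab aP bQ]]] : exists a b, [/\ a \in R, b \in R, a != b,
    [set u; a] != P & [set b; v] != Q].
  have [E1|n1] := eqVneq [set u; r1] P.
    exists r2, r1; split=> //; first by rewrite eq_sym.
      by rewrite -E1; apply: contraNneq r12 => /(set2_inj r2u)->.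
    apply/eqP=> E2; apply: (bad r1) => //.
    by rewrite setUC E2.
  have [E2|n2] := eqVneq [set r2; v] Q; last by exists r1, r2.
  exists r2, r1; split=> //; first by rewrite eq_sym.
    apply/eqP=> E3; apply: (bad r2) => //.
    by rewrite setUC E2.
  by rewrite -E2 !(setUC _ [set v]); apply: contraNneq r12 => /(set2_inj r1v)->.
have [[aW au av] [bW bu bv]] := (RP _ aR, RP _ bR).
set s := enum (R :\: [set a; b]).
have sE x : x \in s = [&& x != a, x != b & x \in R] by rewrite mem_enum !inE negb_or -andbA.
have cR : clique (avoid F P Q) R.
  move=> x y xR yR xy; have [xW xu xv] := RP _ xR; have [yW yu yv] := RP _ yR.
  rewrite /avoid cW //=; apply/andP; split; apply/eqP => E.
    by move: uP; rewrite -E !inE !(eq_sym u) (negPf xu) (negPf yu).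
  by move: vQ; rewrite -E !inE !(eq_sym v) (negPf xv) (negPf yv).
have un : uniq (u :: a :: rcons (rcons s b) v).
  have uR : (u \in R) = false by rewrite !inE eqxx.
  have vR : (v \in R) = false by rewrite !inE eqxx orbT.
  rewrite /= !rcons_uniq !(mem_rcons, in_cons) !sE uR vR !eqxx !andbF enum_uniq /=.
  by rewrite !(eq_sym u) (eq_sym v b) (negPf au) (eq_sym v u) (negPf uv) (negPf bu) (negPf av) (negPf ab) (negPf bv).
exists u, (a :: rcons (rcons s b) v); split=> //; last 2 first.
- by rewrite /= last_rcons.
- have -> : #|W| = size (u :: a :: rcons (rcons s b) v).
    rewrite -(card_uniqP un); apply: eq_card => x.
    rewrite !(in_cons, mem_rcons) sE in_setD in_set2.
    have [->|_] := eqVneq x u; first by rewrite uW.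
    have [->|_] := eqVneq x v; first by rewrite vW !orbT.
    have [->|_] := eqVneq x a; first by rewrite aW !orbT.
    by have [->|_] := eqVneq x b; first by rewrite bW !orbT.
  by [].
apply/and3P; split=> //; last first.
  apply/allP=> x; rewrite !(in_cons, mem_rcons) sE.
  by move=> /or4P[/eqP->|/eqP->|/eqP->|/orP[/eqP->|/and3P[_ _ /RP[]]]].
rewrite /= -cats1 cat_path last_rcons /= andbT; apply/and3P; split.
- rewrite /avoid aP cW //= 1?eq_sym //; apply/eqP=> E.
  by move: vQ; rewrite E !inE !(eq_sym v) (negPf uv) (negPf av).
- apply: (clique_path cR).
    by move: un; rewrite /= rcons_uniq mem_rcons inE negb_or => /and3P[_ /andP[_ ->] /andP[_ ->]].
  by move=> x; rewrite inE mem_rcons inE sE => /or3P[/eqP->|/eqP->|/and3P[]].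
rewrite /avoid cW // bQ andbT /=; apply/eqP=> E.
by move: uP; rewrite -E !inE (eq_sym u) (negPf bu) (negPf uv).
Qed.

End Solid.

(** * Hamiltonian paths by the Bondy-Chvatal closure *)

Section SeqFacts.
Variable T : eqType.
Implicit Types (e : rel T) (s A B : seq T) (a b x : T).

Lemma sorted_cat e x0 A B : sorted e A -> sorted e B ->
  (A != [::] -> B != [::] -> e (last x0 A) (head x0 B)) -> sorted e (A ++ B).
Proof.
case: A => [//|a A]; case: B => [|b B] /=; first by rewrite cats0.
by move=> pA pB /(_ isT isT) eab; rewrite cat_path pA /= eab.
Qed.

Lemma sorted_rev_sym e s : symmetric e -> sorted e s -> sorted e (rev s).
Proof.
move=> es; rewrite rev_sorted; case: s => //= a s.
by rewrite (eq_path (e' := e)) // => x y; rewrite es.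
Qed.

Lemma head_rev x0 s : head x0 (rev s) = last x0 s.
Proof. by case/lastP: s => // s a; rewrite rev_rcons last_rcons. Qed.

Lemma last_rev x0 s : last x0 (rev s) = head x0 s.
Proof. by rewrite -[s in RHS]revK head_rev. Qed.

(** Each consecutive pair would otherwise contribute at most one to the two counts. *)
Lemma crossing (fu fv : pred T) z r :
  (exists r1 a b r2, [/\ z :: r = r1 ++ [:: a, b & r2], fu a & fv b]) \/
  count fu (belast z r) + count fv r <= size r.
Proof.
elim: r z => [|b r IH] z; first by right.
have [h|h] := boolP (fu z && fv b).
  by left; exists [::], z, b, r; case/andP: h.
case: (IH b) => [[r1 [a [b' [r2 [E h1 h2]]]]]|le].
  by left; exists (z :: r1), a, b', r2; rewrite E.
by right; move: h le => /=; case: (fu z); case: (fv b) => //= _; lia.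
Qed.

Lemma path_break e e' u v x t : u != v ->
  (forall a b, e' a b -> e a b || ((a == u) && (b == v) || (a == v) && (b == u))) ->
  uniq (x :: t) -> path e' x t -> path e x t \/
  exists t1 b t2, [/\ t = t1 ++ b :: t2, path e x t1, path e b t2 &
     (last x t1 = u /\ b = v) \/ (last x t1 = v /\ b = u)].
Proof.
move=> uv sub.
have clean y s : uniq (y :: s) -> path e' y s -> (u \notin y :: s) || (v \notin y :: s) -> path e y s.
  elim: s y => //= a s IH y /andP[yn un] /andP[ya pth] no; apply/andP; split.
    case/orP: (sub _ _ ya) => // h; move: no; rewrite !inE.
    by case/orP: h => /andP[/eqP-> /eqP->]; rewrite !eqxx ?orbT.
  apply: IH => //; move: no; rewrite ![_ \in y :: _]inE !negb_or.
  by case/orP=> /andP[_ ->]; rewrite ?orbT.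
elim: t x => [|b t IH] x; first by left.
move=> un /andP[xb pth].
have /andP[xn un'] : (x \notin b :: t) && uniq (b :: t) := un.
have [exb|nexb] := boolP (e x b).
  case: (IH b un' pth) => [p1|[t1 [c [t2 [-> p1 p2 h]]]]]; first by left; rewrite /= exb.
  by right; exists (b :: t1), c, t2; rewrite /= exb.
right; exists [::], b, t; split=> //.
  apply: clean => //; case/orP: (sub _ _ xb) => [|h]; first by rewrite (negPf nexb).
  by case/orP: h => /andP[/eqP E1 /eqP E2]; rewrite -E1 xn ?orbT.
case/orP: (sub _ _ xb) => [|h]; first by rewrite (negPf nexb).
by case/orP: h => /andP[/eqP -> /eqP ->]; [left|right].
Qed.

End SeqFacts.

Section BondyChvatal.
Variable V : finType.
Implicit Types (g F : rel V) (A B K W P Q : {set V}).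

Lemma avoid_sym F P Q : symmetric F -> symmetric (avoid F P Q).
Proof. by move=> Fs x y; rewrite /avoid Fs setUC. Qed.

Lemma point_path_sorted F W P Q m x0 s : s != [::] -> sorted (avoid F P Q) s -> uniq s ->
  {subset s <= W} -> head x0 s \in P -> last x0 s \in Q -> m <= size s -> point_path F W P Q m.
Proof.
case: s => // x t _ so un sub hP lQ sz; exists x, t; split=> //.
by apply/and3P; split=> //; apply/allP.
Qed.

Lemma count_nbr F W s x : uniq s -> s =i W -> count (F x) s = #|nbr F W x|.
Proof.
move=> un sW; rewrite -size_filter -(card_uniqP (filter_uniq _ un)).
by apply: eq_card => y; rewrite mem_filter sW inE andbC.
Qed.

Lemma count_special F u P s : irreflexive F -> uniq s ->
  count (F u) s <= count (fun a => F u a && ([set u; a] != P)) s +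
                   has (fun a => F u a && ([set u; a] == P)) s.
Proof.
move=> Fi; elim: s => //= a s IH /andP[an un]; have {IH} := IH un.
case Fua: (F u a) => //=; case: eqP => /= E; last by rewrite add1n => le; rewrite addSn ltnS.
have -> : has (fun a => F u a && ([set u; a] == P)) s = false.
  apply/hasPn => b bs; apply/negP=> /andP[Fub /eqP E'].
  suff Eab : a = b by rewrite Eab bs in an.
  by apply: (set2_inj (u := u)); [apply: contraTneq Fua => ->; rewrite Fi | rewrite E E'].
by rewrite addn0 add0n addn1 add1n ltnS.
Qed.

(** Let a Hamiltonian path use the new edge, so that it consists of s1 ending at u
and of s2 starting at v. Four kinds of crossing allow its removal: consecutive
a, b in s1 or in s2 with ua and vb edges (reverse the segment in between); v
adjacent to the first vertex x while P is an edge at u (reverse s1, so that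
the path starts at u in P); and symmetrically u adjacent to the last vertex
while Q is an edge at v. If none occurs, each of the #|W| places counts at
most one edge at u or v, against the assumption on the degrees. The edges P
and Q themselves are among the edges counted in the two special places. *)
Lemma bondy_chvatal_step F W u v : symmetric F -> irreflexive F -> u != v ->
  u \in W -> v \in W -> ~~ F u v -> #|W| < #|nbr F W u| + #|nbr F W v| ->
  hamiltonian (add_edge F u v) W -> hamiltonian F W.
Proof.
move=> Fs Fi uv uW vW nuv deg ham P Q pP pQ nPQ.
have point_add R : point F W R -> point (add_edge F u v) W R.
  case=> sR [c1|[x [y [xy E]]]]; split=> //; first by left.
  by right; exists x, y; rewrite /add_edge xy.
have [x [t [/and3P[pth un /allP sub] xP lQ sz]]] := ham P Q (point_add _ pP) (point_add _ pQ) nPQ.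
have sW : x :: t =i W.
  by apply/(subset_cardP _ _)/subsetP => //; rewrite (card_uniqP un); apply/eqP;
     rewrite eqn_leq sz -(card_uniqP un) subset_leq_card //; apply/subsetP.
set e := avoid F P Q.
have es : symmetric e := avoid_sym P Q Fs.
have sub_e a b : avoid (add_edge F u v) P Q a b -> e a b || ((a == u) && (b == v) || (a == v) && (b == u)).
  by rewrite /e /avoid /add_edge => /and3P[+ -> ->]; rewrite !andbT.
case: (path_break uv sub_e un pth) => [pe|]; first by exists x, t; split=> //; apply/and3P; split=> //; apply/allP.
move=> [t1 [b [t2 [Et p1 p2 hub]]]].
wlog [Eu Eb] : u v uv uW vW nuv deg {ham point_add pth sub_e hub} / last x t1 = u /\ b = v.
  move=> wl; case: hub => h; first exact: (wl u v).
  by apply: (wl v u) => //; rewrite 1?eq_sym 1?Fs // addnC.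
subst b t.
set s1 := x :: t1; set s2 := v :: t2.
have un12 : uniq (s1 ++ s2) := un.
have sub12 : {subset s1 ++ s2 <= W} := sub.
have u1 : u \in s1 by rewrite -Eu mem_last.
have dis a : a \in s1 -> a \in s2 -> False.
  by move: un12; rewrite cat_uniq => /and3P[_ /hasPn d _] h1 /d; rewrite /= h1.
have v2 : v \in s2 by rewrite mem_head.
have x1 : x \in s1 by rewrite mem_head.
have [un1 un2] : uniq s1 /\ uniq s2 by move: un12; rewrite cat_uniq => /and3P[].
set z := last v t2; have z2 : z \in s2 by apply: mem_last.
have zQ : z \in Q by move: lQ; rewrite last_cat.
have ns1 a : a \in s1 -> a != v by move=> h; apply/eqP=> E; apply: (dis a) => //; rewrite E.
have ns2 a : a \in s2 -> a != u by move=> h; apply/eqP=> E; apply: (dis a) => //; rewrite E.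
pose fu a := F u a && ([set u; a] != P); pose fv a := F v a && ([set v; a] != Q).
pose bP := has (fun a => F u a && ([set u; a] == P)) (s1 ++ s2).
pose bQ := has (fun a => F v a && ([set v; a] == Q)) (s1 ++ s2).
have done_with s : perm_eq s (s1 ++ s2) -> sorted e s -> head x s \in P -> last x s \in Q ->
    point_path F W P Q #|W|.
  move=> pm so hP hQ; apply: (point_path_sorted (x0 := x) _ so) => //.
  - by apply/eqP=> E; have := perm_size pm; rewrite E size_cat /= addSn.
  - by rewrite (perm_uniq pm).
  - by move=> a; rewrite (perm_mem pm); apply: sub12.
  - by rewrite (perm_size pm).
have [so1 so2] : sorted e s1 /\ sorted e s2 by [].
have bPu : bP -> exists2 a, F u a & P = [set u; a].
  by case/hasP=> a _ /andP[h /eqP <-]; exists a.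
have bQv : bQ -> exists2 a, F v a & Q = [set v; a].
  by case/hasP=> a _ /andP[h /eqP <-]; exists a.
have nFset a b' : F a b' -> [set a; b'] = [set u; v] -> False.
  move=> Fab E; move: (nuv).
  have /set2P := etrans (esym (congr1 (fun X : {set V} => a \in X) E)) (set21 a b').
  have /set2P := etrans (esym (congr1 (fun X : {set V} => b' \in X) E)) (set22 a b').
  move=> [Eb|Eb] [Ea|Ea]; move: Fab; rewrite Ea Eb ?Fi // => Fab; first by rewrite Fs Fab.
  by rewrite Fab.
have [cr1|le1] := crossing fu fv x t1.
  have [r1 [a [b' [r2 [E fua fvb]]]]] := cr1.
  have E1 : s1 = rcons r1 a ++ b' :: r2 by rewrite cat_rcons -E.
  have b'1 : b' \in s1 by rewrite E1 mem_cat mem_head orbT.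
  have a1 : a \in s1 by rewrite E1 mem_cat mem_rcons mem_head.
  have b'x : b' != x.
    have xin : x \in rcons r1 a by case: (r1) E => [|? ?] [-> _]; rewrite mem_head.
    move: un1; rewrite E1 cat_uniq => /and3P[_ /hasPn h _]; apply/eqP=> E2.
    by have := h b' (mem_head _ _); rewrite /= E2 xin.
  have eua : e u a.
    have /andP[Fua nP] := fua; rewrite /e /avoid Fua nP /=; apply/eqP=> EQ.
    by move: zQ; rewrite -EQ => /set2P[] E2; apply: (dis z) => //; rewrite E2.
  have evb : e v b'.
    have /andP[Fvb nQ] := fvb; rewrite /e /avoid Fvb nQ /= andbT; apply/eqP=> EP.
    move: xP; rewrite -EP => /set2P[] E2; last by rewrite E2 eqxx in b'x.
    by have := ns1 x x1; rewrite E2 eqxx.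
  have [so1a so1b] : sorted e (rcons r1 a) /\ sorted e (b' :: r2).
    by move: so1; rewrite E1 => /cat_sorted2[].
  have lu : last x (b' :: r2) = u.
    by rewrite -Eu; have : last x s1 = last x t1 by []; rewrite E1 last_cat => <-.
  apply: (done_with (rcons r1 a ++ rev (b' :: r2) ++ s2)).
  - by rewrite E1 -catA perm_cat2l perm_cat2r perm_rev perm_refl.
  - apply: (sorted_cat (x0 := x)) => //; last first.
      move=> _ _; rewrite last_rcons; case Er: (rev (b' :: r2)) => [|c r'].
        by move/(congr1 size): Er; rewrite size_rev.
      by rewrite /= -[c]/(head x (c :: r')) -Er head_rev lu es.
    apply: (sorted_cat (x0 := x)) => //; first exact: sorted_rev_sym.
    by move=> _ _; rewrite last_rev /= es.
  - by case: (r1) E => [|? ?] [<- _].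
  - by rewrite !last_cat.
have [cr2|le2] := crossing fu fv v t2.
  have [r1 [a [b' [r2 [E fua fvb]]]]] := cr2.
  have E2 : s2 = rcons r1 a ++ b' :: r2 by rewrite cat_rcons -E.
  have b'2 : b' \in s2 by rewrite E2 mem_cat mem_head orbT.
  have a2 : a \in s2 by rewrite E2 mem_cat mem_rcons mem_head.
  have zE : z = last b' r2 by have : last x s2 = z by []; rewrite E2 last_cat.
  have az : a != z.
    apply: contraTneq un2 => Ea; rewrite E2 cat_uniq; apply/negP=> /and3P[_ /hasPn h _].
    by have := h z; rewrite zE mem_last -zE -Ea /= mem_rcons mem_head => /(_ isT).
  have eua : e u a.
    have /andP[Fua nP] := fua; rewrite /e /avoid Fua nP /=; apply/eqP=> EQ.
    move: zQ; rewrite -EQ => /set2P[] E3; last by rewrite E3 eqxx in az.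
    by have := ns2 z z2; rewrite E3 eqxx.
  have evb : e v b'.
    have /andP[Fvb nQ] := fvb; rewrite /e /avoid Fvb nQ /= andbT; apply/eqP=> EP.
    by move: xP; rewrite -EP => /set2P[] E3; apply: (dis x) => //; rewrite E3.
  have [so2a so2b] : sorted e (rcons r1 a) /\ sorted e (b' :: r2).
    by move: so2; rewrite E2 => /cat_sorted2[].
  have hv : head x (rcons r1 a) = v.
    by case: (r1) E => [|? ?] [<- _].
  apply: (done_with (s1 ++ rev (rcons r1 a) ++ b' :: r2)) => //.
  - by rewrite E2 perm_cat2l perm_cat2r perm_rev perm_refl.
  - apply: (sorted_cat (x0 := x)) => //; last first.
      move=> _ _; case Er: (rev (rcons r1 a)) => [|c r'].
        by move/(congr1 size): Er; rewrite size_rev size_rcons.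
      by rewrite /= -[c]/(head x (c :: r')) -Er head_rev last_rcons Eu.
    apply: (sorted_cat (x0 := x)) => //; first exact: sorted_rev_sym.
    by move=> _ _; rewrite last_rev /= hv.
  - by rewrite !last_cat /= -zE.
have [/andP[fvx hP]|no3] := boolP (fv x && bP).
  have [a Fua EP] := bPu hP.
  have evx : e v x.
    have /andP[Fvx nQ] := fvx; rewrite /e /avoid Fvx nQ /= andbT; apply/eqP=> EP'.
    have : u \in [set v; x] by rewrite EP' EP set21.
    case/set2P=> E; first by rewrite E eqxx in uv.
    by apply: (nFset _ _ Fvx); rewrite setUC -E.
  apply: (done_with (rev s1 ++ s2)).
  - by rewrite perm_cat2r perm_rev perm_refl.
  - apply: (sorted_cat (x0 := x)) => //; first exact: sorted_rev_sym.
    by move=> _ _; rewrite last_rev /= es.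
  - case Er: (rev s1) => [|c r'].
      by move/(congr1 size): Er; rewrite size_rev.
    by rewrite /= -[c]/(head x (c :: r')) -Er head_rev /= Eu EP set21.
  - by rewrite last_cat.
have [/andP[fuz hQ]|no4] := boolP (fu z && bQ).
  have [a Fva EQ] := bQv hQ.
  have euz : e u z.
    have /andP[Fuz nP] := fuz; rewrite /e /avoid Fuz nP /=; apply/eqP=> EQ'.
    have : v \in [set u; z] by rewrite EQ' EQ set21.
    case/set2P=> E; first by rewrite E eqxx in uv.
    by apply: (nFset _ _ Fuz); rewrite -E.
  apply: (done_with (s1 ++ rev s2)) => //.
  - by rewrite perm_cat2l perm_rev perm_refl.
  - apply: (sorted_cat (x0 := x)) => //; first exact: sorted_rev_sym.
    by move=> _ _; rewrite head_rev /= Eu.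
  by rewrite last_cat last_rev /= EQ set21.
have fu0 : fu u = false by rewrite /fu Fi.
have fv0 : fv v = false by rewrite /fv Fi.
have := count_special u P Fi un12; have := count_special v Q Fi un12.
rewrite (count_nbr _ _ un12 sW) (count_nbr _ _ un12 sW) -/fu -/fv -/bP -/bQ.
rewrite !count_cat.
have c1 : count fu s1 = count fu (belast x t1).
  by rewrite /s1 lastI -cats1 count_cat /= Eu fu0 !addn0.
have c2 : count fu s2 = count fu (belast v t2) + fu z.
  by rewrite /s2 lastI -cats1 count_cat /= addn0.
have c3 : count fv s2 = count fv t2 by rewrite /s2 /= fv0.
have c4 : count fv s1 = fv x + count fv t1 by [].
have sz12 : #|W| = (size t1 + size t2).+2.
  by rewrite -(eq_card sW) (card_uniqP un12) size_cat /= addnS.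
rewrite c1 c2 c3 c4; move: deg le1 le2 no3 no4; rewrite sz12; clear.
move: #|_| #|_| (count _ _) (count _ _) (count _ _) (count _ _) (size _) (size _).
by case: (fv x); case: bP; case: (fu z); case: bQ => //=; lia.
Qed.

Lemma solid_hamiltonian g k W : symmetric g -> irreflexive g -> 4 < k ->
  solid g k W -> #|W| < k -> hamiltonian g W.
Proof.
move=> gs gi k5 sol ltW.
pose gW : rel V := fun x y => [&& x \in W, y \in W & g x y].
have mono : hamiltonian gW W -> hamiltonian g W.
  move=> ham P Q [sP pP] [sQ pQ] nPQ.
  have lift (R : {set V}) : R \subset W -> (#|R| = 1 \/ exists x y, g x y /\ R = [set x; y]) -> point gW W R.
    move=> sR [c1|[x [y [xy E]]]]; split=> //; first by left.
    right; exists x, y; split=> //.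
    by rewrite /gW xy !(subsetP sR) // E !inE eqxx ?orbT.
  have [x [t [/and3P[pth un al] h1 h2 h3]]] := ham P Q (lift _ sP pP) (lift _ sQ pQ) nPQ.
  exists x, t; split=> //; apply/and3P; split=> //.
  by apply: sub_path pth => a b /and3P[/and3P[_ _ ab] h h']; apply/and3P.
apply: mono; pose Psi F := hamiltonian F W -> hamiltonian gW W.
have [|||//|F [[Fs Fi] FW gF PF mx]] := @maximal_graph V Psi W gW.
- by move=> x y; rewrite /gW gs andbCA.
- by move=> x; rewrite /gW gi !andbF.
- by move=> x y /and3P[].
apply: (PF); apply: clique_hamiltonian; last first.
  by apply: leq_trans (solid_card gi sol); move: k5; clear; lia.
apply: (solid_clique sol Fs) => [x y xW yW xy|A B a b sA sB ab dA dB x y xA yB xy].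
  by apply: gF; rewrite /gW xW yW.
apply/negPn/negP => nxy; have xW := subsetP sA _ xA; have yW := subsetP sB _ yB.
apply: (mx x y xW yW xy nxy) => ham; apply: PF.
apply: bondy_chvatal_step ham => //; apply: leq_trans ltW _; apply: leq_trans ab _.
apply: leq_add.
  by apply: leq_trans (dA x xA) (sub_nbr sA _).
by apply: leq_trans (dB y yB) (sub_nbr sB _).
Qed.

End BondyChvatal.

(** * Cycles through the neighbours of both ends of a path *)

Section Assemble.
Variables (T : finType) (e : rel T).
Hypothesis es : symmetric e.
Implicit Types (W S Y : {set T}) (x y z : T) (p q a b : seq T).

Lemma upath_rev W x p : upath e W x p ->
  upath e W (last x p) (rev (belast x p)) /\ last (last x p) (rev (belast x p)) = x.
Proof.
move=> /and3P[h1 h2 /allP h3].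
have E : last x p :: rev (belast x p) = rev (x :: p) by rewrite [in RHS]lastI rev_rcons.
split; last by case: p {h1 h2 h3 E} => //= a p; rewrite rev_cons last_rcons.
apply/and3P; split.
- by rewrite rev_path; move: h1; rewrite (eq_path (e' := fun z : T => e^~ z)) // => u v; rewrite es.
- by rewrite E rev_uniq.
by apply/allP=> u; rewrite E mem_rev => /h3.
Qed.

Lemma cycle_of_paths W x p1 p2 : upath e W x p1 -> upath e W x p2 -> p2 != [::] ->
  last x p1 = last x p2 -> {in x :: p1, forall u, u \in p2 -> u = last x p2} ->
  exists c, [/\ cycle e c, uniq c, {subset c <= W} & size c = size p1 + size p2].
Proof.
move=> u1 u2 + + dis; case/lastP: p2 u2 dis => // p2 z u2 dis _; rewrite last_rcons => l1.
rewrite last_rcons in dis.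
have z2 : z \notin x :: p2.
  by have := upath_uniq u2; rewrite -rcons_cons rcons_uniq => /andP[].
have x2 : x \notin p2.
  by have := upath_uniq u2; rewrite /= mem_rcons inE negb_or => /andP[/andP[_ ->]].
exists ((x :: p1) ++ rev p2); split.
- have pz : path e z (rev (x :: p2)).
    have := upath_path (proj1 (upath_rev u2)).
    by rewrite last_rcons belast_rcons.
  rewrite /= rcons_cat cat_path (upath_path u1) l1 -rev_cons //.
- rewrite cat_uniq (upath_uniq u1) rev_uniq; have := upath_uniq u2.
  rewrite /= rcons_uniq => /and3P[_ _ ->]; rewrite andbT.
  apply/hasPn => u; rewrite mem_rev => up2; apply/negP=> up1.
  have E := dis u up1; rewrite mem_rcons inE up2 orbT in E.
  by move: z2; rewrite -E // inE up2 orbT.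
- move=> u; rewrite mem_cat mem_rev => /orP[/(upath_sub u1)//|up2].
  by apply: (upath_sub u2); rewrite inE mem_rcons inE up2 !orbT.
by rewrite size_cat size_rev size_rcons /= addnS.
Qed.

(** Two disjoint links between S and Y, closed by a path inside S and one inside Y. *)
Lemma cycle_of_links W S Y x q y q' a b : S \subset W -> Y \subset W ->
  link e W S Y x q -> link e W S Y y q' ->
  (forall u, u \in x :: q -> u \in y :: q' -> False) ->
  (forall u, u \in S -> u \in Y -> u = x) ->
  upath e S x a -> last x a = y -> upath e Y (last x q) b -> last (last x q) b = last y q' ->
  exists c, [/\ cycle e c, uniq c, {subset c <= W} & size c = size a + size b + (size q + size q')].
Proof.
move=> sS sY [xS lY uq qS qY] [yS lY' uq' qS' qY'] dis SY ua la ub lb.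
have xa : x \notin a by have := upath_uniq ua; rewrite /= => /andP[].
have lb' : last x q \notin b by have := upath_uniq ub; rewrite /= => /andP[].
have yq : y \notin q' by have := upath_uniq uq'; rewrite /= => /andP[].
have u1 : upath e W x (q ++ b).
  apply: upath_cat => //; first exact: upathW ub.
  move=> u h1 h2; have uY : u \in Y by apply: (upath_sub ub); rewrite inE h2 orbT.
  by rewrite -(qY u h1 uY) h2 in lb'.
have u2 : upath e W x (a ++ q').
  apply: upath_cat; rewrite ?la //; first exact: upathW ua.
  move=> u h1 h2; have uS : u \in S by apply: (upath_sub ua).
  by rewrite -(qS' u _ uS) ?h2 // inE h2 orbT in yq.
have [|||c [c1 c2 c3 c4]] := cycle_of_paths u1 u2.
- apply/eqP=> E; have E' : a = [::] by case: (a) E.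
  by rewrite E' /= in la; case: (dis x); rewrite ?la mem_head.
- by rewrite !last_cat lb la.
- rewrite last_cat la => u; rewrite -cat_cons !mem_cat => /orP[h1|h1] /orP[h2|h2].
  + have uS : u \in S by apply: (upath_sub ua); rewrite inE h2 orbT.
    by rewrite -(qS u h1 uS) h2 in xa.
  + by case: (dis u h1); rewrite inE h2 orbT.
  + have uS : u \in S by apply: (upath_sub ua); rewrite inE h2 orbT.
    have uY : u \in Y by apply: (upath_sub ub); rewrite inE h1 orbT.
    by rewrite -(SY u uS uY) h2 in xa.
  have uY : u \in Y by apply: (upath_sub ub); rewrite inE h1 orbT.
  by apply: qY' => //; rewrite inE h2 orbT.
exists c; split=> //; rewrite c4 !size_cat; clear.
by move: (size a) (size b) (size q) (size q') => i j k l; lia.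
Qed.

End Assemble.

Section Posa.
Variables (V : finType) (F : rel V).
Hypotheses (Fs : symmetric F) (Fi : irreflexive F).
Implicit Types (W : {set V}).

(** Choose a before b as close as possible with a adjacent to the last vertex y
and b to the first vertex x. The cycle x..a, y..b omits only the part between
a and b, which then contains no neighbour of x or y; and outside this part no
consecutive pair crosses, which bounds the two degrees by its length. *)
Lemma posa_crossing x p r1 a m b r2 : path F x p -> uniq (x :: p) ->
  x :: p = r1 ++ a :: m ++ b :: r2 -> F (last x p) a -> F x b ->
  ~~ F x (last x p) ->
  exists c, [/\ cycle F c, uniq c &
    minn (size (x :: p)) (count (F x) (x :: p) + count (F (last x p)) (x :: p)) <= size c].
Proof.
set y := last x p => pth un.
move Em: (size m) => n; elim/ltn_ind: n r1 a m b r2 Em => n IH r1 a m b r2 Em E Fya Fxb nxy.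
have [E1 E2] : rcons r1 a ++ m ++ b :: r2 = x :: p /\ last b r2 = y.
  split; first by rewrite cat_rcons -E.
  by rewrite /y (_ : last x p = last x (x :: p)) // E last_cat /= last_cat.
have so : sorted F (rcons r1 a ++ m ++ b :: r2) by rewrite E1.
have [so1 /cat_sorted2[_ so2]] := cat_sorted2 so.
have hx : head x (rcons r1 a) = x by case: (r1) E => [|? ?] [].
have mkc : exists c, [/\ cycle F c, uniq c & size c = (size r1 + size r2).+2].
  exists (rcons r1 a ++ rev (b :: r2)); split; last 1 first.
  - by rewrite size_cat size_rcons size_rev /= addnS.
  - have s0 : sorted F (rcons r1 a ++ rev (b :: r2)).
      apply: (sorted_cat (x0 := x)) => //; first exact: sorted_rev_sym.
      by move=> _ _; rewrite last_rcons head_rev /= E2 Fs.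
    case Ec : (rcons r1 a) hx s0 => [|x' c1] /=; first by case: (r1) Ec.
    by move=> -> s0; rewrite rcons_path s0 /= last_cat last_rev /= Fs.
  - move: un; rewrite -E1 !cat_uniq rev_uniq => /and3P[-> h /and3P[_ _ ->]]; rewrite andbT /=.
    apply: contra h => /hasP[z]; rewrite mem_rev => h1 h2; apply/hasP; exists z => //.
    by rewrite mem_cat h1 orbT.
have [c [c1 c2 c3]] := mkc.
case: m Em E E1 so so1 IH => [|m0 m] Em E E1 so so1 IH.
  exists c; split=> //; rewrite c3 E size_cat /=; clear.
  by rewrite geq_min; apply/orP; left; rewrite !addnS.
have [/hasP[z zm hyperedge_end]|/hasPn nom] := boolP (has (fun z => F x z || F y z) (m0 :: m)).
  case/splitPr Es: _ / zm => [m1 m2].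
  have sm : size m1 + (size m2).+1 = n by rewrite -Em Es size_cat.
  case/orP: hyperedge_end => hyperedge_end.
    apply: (IH (size m1) _ r1 a m1 z (m2 ++ b :: r2)) => //; first by rewrite -sm; lia.
    by rewrite E Es -catA.
  apply: (IH (size m2) _ (r1 ++ a :: m1) z m2 b r2) => //; first by rewrite -sm; lia.
  by rewrite E Es -!catA.
have cnt0 : count (F x) (m0 :: m) = 0 /\ count (F y) (m0 :: m) = 0.
  split; apply/eqP; rewrite -leqn0 leqNgt -has_count; apply/hasPn => z /nom;
  by rewrite negb_or => /andP[].
case Er : (rcons r1 a) hx => [|x' t1] hx; first by case: (r1) Er.
have {}hx : x' = x := hx; rewrite {x'}hx in Er.
have lt1 : last x t1 = a by rewrite -[last x t1]/(last x (x :: t1)) -Er last_rcons.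
have [[q1 [a' [b' [q2 [Eq h1 h2]]]]]|le1] := crossing (F y) (F x) x t1.
  apply: (IH 0 _ q1 a' [::] b' (q2 ++ (m0 :: m) ++ b :: r2)) => //; first by rewrite -Em.
  by rewrite -E1 Er Eq -!catA.
have [[q1 [a' [b' [q2 [Eq h1 h2]]]]]|le2] := crossing (F y) (F x) b r2.
  apply: (IH 0 _ (rcons r1 a ++ (m0 :: m) ++ q1) a' [::] b' q2) => //; first by rewrite -Em.
  by rewrite -E1 Eq -!catA.
exists c; split=> //; rewrite c3 geq_min; apply/orP; right.
have d1 : count (F y) (x :: t1) = count (F y) (belast x t1) + F y a.
  by rewrite lastI -cats1 count_cat /= addn0 lt1.
have d2 : count (F y) (b :: r2) = count (F y) (belast b r2) + F y y.
  by rewrite [in LHS]lastI -cats1 count_cat /= addn0 E2.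
have d3 : count (F x) (x :: t1) = F x x + count (F x) t1 by [].
have d4 : count (F x) (b :: r2) = F x b + count (F x) r2 by [].
have sz1 : size t1 = size r1.
  by have := congr1 size Er; rewrite size_rcons => -[].
rewrite -E1 Er !count_cat d1 d2 d3 d4 cnt0.1 cnt0.2 !Fi.
move: le1 le2; rewrite sz1; clear.
move: (count _ _) (count _ _) (count _ _) (count _ _) (size r1) (size r2).
by case: (F y a); case: (F x b) => /= i j k l u v; lia.
Qed.

(** From the last vertex go back to the first neighbour l of x behind v, jump to x
and go forward to v. Only vertices between v and l are left out. *)
Lemma posa_arc x p v : path F x p -> uniq (x :: p) -> F x (last x p) ->
  v \in x :: p -> v != last x p ->
  exists a, [/\ upath F [set z in x :: p] (last x p) a, last (last x p) a = v
     & count (F x) (x :: p) <= size a].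
Proof.
set c := last x p => pth un Fxc vin vc.
have [r1 [m2 E]] : exists r1 m2, x :: p = rcons r1 v ++ m2.
  by case/splitPr: vin => r1 r2; exists r1, r2; rewrite cat_rcons.
have m2n : m2 != [::].
  apply: contraNneq vc => E'; move: E; rewrite E' cats0 /c => E.
  by rewrite (_ : last x p = last x (x :: p)) // E last_rcons.
have lm2 : last v m2 = c.
  by rewrite /c (_ : last x p = last x (x :: p)) // E last_cat last_rcons.
have /hasP[l0 l02 Fl0] : has (F x) m2.
  apply/hasP; exists c => //; rewrite -lm2.
  by case: (m2) m2n => // d m _; rewrite /= mem_last.
have [n1 [l [n2 [E2 Fl non]]]] : exists n1 l n2, [/\ m2 = n1 ++ l :: n2, F x l & ~~ has (F x) n1].
  have h : has (F x) m2 by apply/hasP; exists l0.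
  have [l n1 n2] := split_find h.
  by exists n1, l, n2; rewrite cat_rcons.
have so : sorted F (rcons r1 v ++ m2) by rewrite -E.
have [so1 so2] := cat_sorted2 so.
have hx : head x (rcons r1 v) = x by case: (r1) E => [|? ?] [].
have soN : sorted F (l :: n2) by move: so2; rewrite E2 => /cat_sorted2[].
have lN : last l n2 = c by rewrite -lm2 E2 last_cat.
pose s := rev (l :: n2) ++ rcons r1 v.
have sos : sorted F s.
  apply: (sorted_cat (x0 := x)) => //; first exact: sorted_rev_sym.
  by move=> _ _; rewrite last_rev hx /= Fs.
have hs : head x s = c.
  rewrite /s; case Er: (rev (l :: n2)) => [|d r3]; first by move/(congr1 size): Er; rewrite size_rev.
  by rewrite /= -[d]/(head x (d :: r3)) -Er head_rev.
have uns : uniq s.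
  move: un; rewrite E E2 !cat_uniq rev_uniq => /and3P[-> h /and3P[_ _ ->]]; rewrite andbT /=.
  apply: contra h => /hasP[z z1]; rewrite mem_rev => z2; apply/hasP; exists z => //.
  by rewrite mem_cat z2 orbT.
have subs : {subset s <= x :: p}.
  by move=> z; rewrite E E2 !mem_cat mem_rev => /orP[->|->]; rewrite ?orbT.
have lsv : last x s = v by rewrite last_cat last_rcons.
have szs : count (F x) (x :: p) < size s.
  rewrite E E2 !count_cat; have -> : count (F x) n1 = 0.
    by apply/eqP; rewrite -leqn0 leqNgt -has_count.
  have := count_size (F x) (l :: n2); have : count (F x) (rcons r1 v) < size (rcons r1 v).
    case Er : (rcons r1 v) hx => [|x' t1] /= hx; first by case: (r1) Er.
    by rewrite hx Fi ltnS count_size.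
  rewrite size_cat size_rev; clear.
  by move: (count _ _) (count _ _) (size _) (size _) => i j k0 l1; lia.
case: s sos hs uns subs lsv szs => // c' a /= sos c'c uns subs lsv szs.
rewrite {c'}c'c in sos uns subs lsv *.
exists a; split=> //; apply/and3P; split=> //.
by apply/allP=> z /subs; rewrite /= inE.
Qed.

(** If the neighbours of the ends x and y cross, use the previous construction.
Otherwise all neighbours of x lie up to a vertex c, and all those of y from a
vertex d on, where d is c or comes later. Two disjoint paths between the two
parts, with c and d among their ends, are closed inside each part by a path
through all neighbours of x or of y. *)
Lemma posa W x p : two_connected_in F W -> upath F W x p -> ~~ F x (last x p) ->
  p != [::] ->
  exists c, [/\ cycle F c, uniq c &
    minn (size (x :: p)) (count (F x) (x :: p) + count (F (last x p)) (x :: p)) <= size c].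
Proof.
set y := last x p => nW up nxy pn.
have pth := upath_path up; have un := upath_uniq up.
have Fxh : F x (head x p) by case: (p) pn pth => //= h p' _ /andP[].
have hF : has (F x) (rev (x :: p)).
  by rewrite has_rev; case: (p) pn Fxh => //= h p' _ ->; rewrite orbT.
have [s1 [c [s2 [E Fxc no2]]]] : exists s1 c s2, [/\ x :: p = s1 ++ c :: s2, F x c & ~~ has (F x) s2].
  move Er: (rev (x :: p)) hF => s hF; case: (split_find hF) Er => c r1 r2 Fxc no1 E.
  exists (rev r2), c, (rev r1); rewrite has_rev; split=> //.
  by rewrite -[LHS]revK E rev_cat rev_rcons.
have yE : last c s2 = y by rewrite /y (_ : last x p = last x (x :: p)) // E last_cat.
have cx : c != x by apply: contraTneq Fxc => ->; rewrite Fi.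
have cy : c != y by apply: contraTneq Fxc => ->.
have xs1 : x \in s1 by case: (s1) E cx => [[->]|? ? [-> _]]; rewrite ?eqxx ?mem_head.
have [hasy|nohasy] := boolP (has (F y) s1).
  case/hasP: hasy => a as1 Fya; case/splitPr: as1 E {xs1} => r1 m E.
  by apply: (@posa_crossing x p r1 a m c s2) => //; rewrite E -catA.
have hFy : has (F y) (c :: s2).
  have s2n : s2 != [::] by apply: contraNneq cy => Es; rewrite -yE Es.
  apply/hasP; case/lastP: s2 E yE s2n {no2} => // s2 y' E; rewrite last_rcons => yE _.
  exists (last c s2); first by rewrite -rcons_cons mem_rcons inE mem_last orbT.
  have : path F x p := pth; have : sorted F (x :: p) by [].
  rewrite E yE => /cat_sorted2[_] /=; rewrite rcons_path => /andP[_].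
  by rewrite Fs.
move Ecs: (c :: s2) hFy => s0 hFy; case: (split_find hFy) Ecs => d m s3 Fyd nom Ed.
rewrite cat_rcons in Ed.
have Ep : x :: p = s1 ++ m ++ d :: s3 by rewrite E Ed.
have yE3 : last d s3 = y by rewrite -yE -[last c s2]/(last c (c :: s2)) Ed last_cat.
have dy : d != y by apply: contraTneq Fyd => ->; rewrite Fi.
have so : sorted F (s1 ++ m ++ d :: s3) by rewrite -Ep.
have [so1 /cat_sorted2[_ so3]] := cat_sorted2 so.
pose S := [set z in rcons s1 c]; pose Y := [set z in d :: s3].
have xS : x \in rcons s1 c by rewrite mem_rcons inE xs1 orbT.
have Es1 : exists t1, rcons s1 c = x :: t1.
  by case: (s1) E xs1 => // x' t1 [-> _] _; exists (rcons t1 c).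
have [t1 Et1] := Es1.
have lt1 : last x t1 = c by rewrite -[last x t1]/(last x (x :: t1)) -Et1 last_rcons.
have [p1 un1] : path F x t1 /\ uniq (x :: t1).
  have : sorted F (x :: p) by []; move: un.
  by rewrite E -cat_rcons cat_uniq Et1 => /andP[-> _] /cat_sorted2[].
have W_in z : z \in x :: p -> z \in W by move=> /(upath_sub up).
have SW : S \subset W.
  by apply/subsetP=> z; rewrite inE => zS; apply: W_in; rewrite E -cat_rcons mem_cat zS.
have YW : Y \subset W.
  by apply/subsetP=> z; rewrite inE => zY; apply: W_in; rewrite Ep !mem_cat zY !orbT.
have [un_s1 un_cs2] : uniq (rcons s1 c) /\ uniq (c :: s2).
  move: un; rewrite E cat_uniq => /and3P[h1 /hasPn h2 h3]; split=> //.
  by rewrite rcons_uniq h1 andbT; have := h2 c (mem_head _ _).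
have dis12 z : z \in rcons s1 c -> z \in c :: s2 -> z = c.
  rewrite mem_rcons !inE => /orP[/eqP//|z1] /orP[/eqP//|z2].
  by move: un; rewrite E cat_uniq => /and3P[_ /hasPn/(_ z) + _]; rewrite inE z2 orbT /= z1 => /(_ isT).
have SY z : z \in S -> z \in Y -> z = c.
  rewrite !inE => zS zY; apply: dis12 => //.
  by rewrite Ed mem_cat inE zY orbT.
have [q [Eq lq uq]] : exists q, [/\ m ++ [:: d] = c :: q, last c q = d & upath F W c q].
  have Eq : m ++ [:: d] ++ s3 = c :: s2 by rewrite Ed.
  case Em : (m ++ [:: d]) => [|c' q]; first by move/(congr1 size): Em; rewrite size_cat addn1.
  move: Eq; rewrite catA Em => -[Ecc Es2]; rewrite Ecc; exists q.
  rewrite -Ecc; split=> //; first by rewrite -[last c' q]/(last c' (c' :: q)) -Em last_cat.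
  have ucs : upath F W c s2.
    apply/and3P; split=> //; last by apply/allP=> z zs; apply: W_in; rewrite E mem_cat zs orbT.
    have : sorted F (x :: p) by []; by rewrite E => /cat_sorted2[].
  by move: ucs; rewrite -Es2 Ecc => /upath_catP[].
have qin z : z \in c :: q -> z \in m \/ z = d.
  by rewrite -Eq mem_cat inE => /orP[|/eqP]; auto.
have q_cs z : z \in c :: q -> z \in c :: s2.
  by rewrite Ed -Eq mem_cat inE => /orP[|/eqP] h; rewrite mem_cat inE h ?eqxx ?orbT.
have lk : link F W S Y c q.
  split=> //.
  - by rewrite inE mem_rcons mem_head.
  - by rewrite lq inE mem_head.
  - by move=> z /q_cs z1 zS; apply: dis12 => //; move: zS; rewrite inE.
  move=> z /qin[zm|->]; last by rewrite lq.
  rewrite inE => zY; move: un_cs2; rewrite Ed cat_uniq => /and3P[_ /hasPn/(_ z zY)].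
  by rewrite /= zm.
have yY : y \in Y by rewrite inE -yE3 mem_last.
have [] := two_paths nW SW YW lk.
- by exists x; rewrite 1?eq_sym // inE.
- by exists y; rewrite // lq eq_sym.
move=> q1 [z [q2 [lk1 lk2 dis]]]; rewrite lq => dends.
have [zS lY2 uq2 _ _] := lk2; have [_ lY1 uq1 qS1 qY1] := lk1.
have zc : z != c by apply/eqP=> Ez; apply: (dis z); rewrite ?mem_head // Ez mem_head.
have [a [ua la sza]] : exists a, [/\ upath F S c a, last c a = z & count (F x) (x :: t1) <= size a].
  have [|||a [h1 h2 h3]] := @posa_arc x t1 z p1 un1 _ _ _.
  - by rewrite lt1.
  - by move: zS; rewrite inE Et1.
  - by rewrite lt1.
  exists a; rewrite -lt1; split=> //; apply: upathW h1.
  by apply/subsetP=> u; rewrite !inE -in_cons -Et1.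
pose s3r := rev (belast d s3).
have us3 : upath F Y d s3.
  apply/and3P; split; last by apply/allP=> u us; suff : u \in Y by []; rewrite inE.
    exact: so3.
  by move: un_cs2; rewrite Ed cat_uniq => /and3P[].
have [u3 l3] := upath_rev Fs us3; rewrite yE3 in u3 l3.
have mem3 : y :: rev (belast d s3) =i d :: s3.
  by move=> u; rewrite -yE3 -rev_rcons -lastI mem_rev.
have arcY v : v \in Y -> v != d -> exists b, [/\ upath F Y d b, last d b = v & count (F y) (d :: s3) <= size b].
  move=> vY vd; have [|||b [h1 h2 h3]] := @posa_arc y s3r v (upath_path u3) (upath_uniq u3) _ _ _.
  - by rewrite l3.
  - by rewrite mem3; move: vY; rewrite inE.
  - by rewrite l3.
  rewrite l3 in h1 h2; exists b; split=> //.
    by apply: upathW h1; apply/subsetP=> u; rewrite !in_set mem3.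
  apply: leq_trans h3; rewrite leq_eqVlt; apply/orP; left; apply/eqP; apply/permP.
  by rewrite -yE3 -rev_rcons -lastI perm_sym perm_rev perm_refl.
have [b [ub lb szb]] : exists b, [/\ upath F Y (last c q1) b, last (last c q1) b = last z q2 &
     count (F y) (d :: s3) <= size b].
  have nend : last c q1 != last z q2.
    by apply/eqP=> El; apply: (dis (last c q1)); rewrite ?mem_last // El mem_last.
  move: dends; rewrite !inE => /orP[]/eqP Ed'.
    have [|b [h1 h2 h3]] := arcY _ lY2; first by rewrite Ed' eq_sym.
    by exists b; rewrite -Ed'.
  have [|b [h1 h2 h3]] := arcY _ lY1; first by rewrite Ed'.
  have [h4 h5] := upath_rev Fs h1; rewrite h2 in h4 h5.
  by exists (rev (belast d b)); rewrite -Ed' size_rev size_belast.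
have [cyc [h1 h2 _ h4]] := cycle_of_links Fs SW YW lk1 lk2 dis SY ua la ub lb.
exists cyc; split=> //; rewrite h4 geq_min; apply/orP; right.
have -> : count (F x) (x :: p) = count (F x) (x :: t1).
  rewrite E -cat_rcons Et1 count_cat -[RHS]addn0; congr (_ + _).
  by apply/eqP; rewrite -leqn0 leqNgt -has_count.
have -> : count (F y) (x :: p) = count (F y) (d :: s3).
  rewrite Ep catA count_cat -[RHS]add0n; congr (_ + _).
  apply/eqP; rewrite -leqn0 leqNgt -has_count has_cat negb_or nom.
  by rewrite (negbTE nohasy).
apply: leq_trans (leq_add sza szb) _; exact: leq_addr.
Qed.

End Posa.

(** * Saturated graphs *)

Section Saturated.
Variable V : finType.
Implicit Types (g F : rel V) (A B K W : {set V}).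

Lemma nbr_count F A x s : {subset nbr F A x <= s} -> #|nbr F A x| <= count (F x) s.
Proof.
move=> sub; rewrite cardE -size_filter; apply: uniq_leq_size (enum_uniq _) _.
move=> y; rewrite mem_enum => yN; rewrite mem_filter sub // andbT.
by move: yN; rewrite inE => /andP[].
Qed.

(** Among the paths with at least k vertices from a vertex of A to a non-adjacent
vertex of B take a longest one. The neighbours in A of its first vertex and
those in B of its last vertex lie on it, as otherwise there is a longer path
or a cycle; so Posa's lemma gives a cycle of length at least k. *)
Lemma saturated_closed F k W : symmetric F -> irreflexive F -> two_connected_in F W -> 1 < k ->
  (forall c, cycle F c -> uniq c -> size c < k) ->
  (forall u v, u \in W -> v \in W -> u != v -> ~~ F u v ->
     exists p, [/\ upath F W u p, last u p = v & k <= size (u :: p)]) ->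
  degree_closed F k W.
Proof.
move=> Fs Fi nW k1 noc sat A B a b sA sB kab dA dB.
suff no_good x p : x \in A -> last x p \in B -> x != last x p -> ~~ F x (last x p) ->
    upath F W x p -> k <= size (x :: p) -> False.
  move=> x y xA yB xy; apply/negPn/negP => nxy.
  have [p [up lp szp]] := sat x y (subsetP sA _ xA) (subsetP sB _ yB) xy nxy.
  by apply: (no_good x p) => //; rewrite lp.
move En: (#|W| - size p) => n; elim/ltn_ind: n x p En => n IH x p En xA yB xy nxy up szp.
set y := last x p in yB xy nxy.
have un := upath_uniq up.
have le_W : size p < #|W|.
  have := uniq_leq_size un (s2 := enum W); rewrite -cardE; apply.
  by move=> u /(upath_sub up); rewrite mem_enum.
have long z : z \notin x :: p -> F x z -> F z y -> False.
  move=> zp xz zy; have := noc (z :: x :: p) _ _.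
  rewrite ltnNge (leq_trans szp (leqnSn _)) => h; apply: notF; apply: h; last by rewrite cons_uniq zp.
  by rewrite /= rcons_path (upath_path up) Fs xz /= Fs.
have sub1 z : z \in A -> F x z -> z \in x :: p.
  move=> zA xz; apply/negPn/negP => zp.
  have [zy|nzy] := boolP (F z y); first exact: long xz zy.
  apply: (IH (#|W| - size (x :: p)) _ z (x :: p)) => //.
  - by rewrite -En /=; move: le_W; clear; lia.
  - by apply: contraNneq zp => /= ->; rewrite mem_last.
  - rewrite /upath; move: up zp => /and3P[h1 h2 h3] zp.
    by rewrite [path _ _ _]/= Fs xz h1 cons_uniq zp h2 /= (subsetP sA) //.
  by apply: leq_trans szp _ => /=.
have sub2 z : z \in B -> F y z -> z \in x :: p.
  move=> zB yz; apply/negPn/negP => zp.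
  have [xz|nxz] := boolP (F x z); first by apply: (long z) => //; rewrite Fs.
  apply: (IH (#|W| - size (rcons p z)) _ x (rcons p z)) => //.
  - by rewrite -En size_rcons; move: le_W; clear; lia.
  - by rewrite last_rcons.
  - by rewrite last_rcons; apply: contraNneq zp => <-; rewrite mem_head.
  - by rewrite last_rcons.
  - rewrite -cats1; apply: upath_cat up _ _.
      rewrite -/y /upath /= yz (subsetP sB _ zB) (subsetP sB _ yB) inE.
      by rewrite !andbT; apply: contraNneq zp => <-; rewrite mem_last.
    by move=> u up'; rewrite inE => /eqP E; rewrite -E up' in zp.
  by apply: leq_trans szp _; rewrite /= size_rcons.
have pn : p != [::] by apply: contraNneq xy => E; rewrite /y E.
have [c [c1 c2 c3]] := posa Fs Fi nW up nxy pn.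
have := noc c c1 c2; rewrite ltnNge (leq_trans _ c3) // leq_min szp andTb.
apply: leq_trans kab _; apply: leq_add.
  apply: leq_trans (dA x xA) (nbr_count _) => z; rewrite inE => /andP[]; exact: sub1.
by apply: leq_trans (dB y yB) (nbr_count _) => z; rewrite inE => /andP[]; exact: sub2.
Qed.

Lemma cycle_break F u v c : symmetric F -> u != v -> uniq c -> 2 < size c ->
  cycle (add_edge F u v) c -> cycle F c \/
  exists p, [/\ path F u p, uniq (u :: p), last u p = v & size (u :: p) = size c].
Proof.
move=> Fs uv; case: c => // x p un sz.
rewrite [cycle _ _]/= rcons_path => /andP[pth clo].
have sub a b : add_edge F u v a b -> F a b || ((a == u) && (b == v) || (a == v) && (b == u)) by [].
(* A path through all vertices of the cycle with ends u and v, in either direction. *)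
have fin a q : path F a q -> uniq (a :: q) -> size (a :: q) = size (x :: p) ->
    (a == u) && (last a q == v) || (a == v) && (last a q == u) ->
    exists p', [/\ path F u p', uniq (u :: p'), last u p' = v & size (u :: p') = size (x :: p)].
  move=> h1 h2 h3 /orP[]/andP[/eqP Ea /eqP El]; first by exists q; rewrite -Ea.
  have up : upath F setT a q by apply/and3P; split=> //; apply/allP=> z _; rewrite inE.
  have [h4 h5] := upath_rev Fs up; rewrite El Ea in h4 h5.
  exists (rev (belast v q)); split=> //; first exact: upath_path h4.
    exact: upath_uniq h4.
  by rewrite -h3 /= size_rev size_belast.
case: (path_break uv sub un pth) => [pF|[t1 [b [t2 [Ep p1 p2 h]]]]].
  case/orP: (sub _ _ clo) => h; first by left; rewrite /= rcons_path pF.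
  by right; apply: (fin x p) => //; move: h; rewrite orbC ![(last x p == _) && _]andbC.
have E : x :: p = (x :: t1) ++ b :: t2 by rewrite Ep.
have Fclo : F (last b t2) x.
  have := sub _ _ clo; rewrite Ep last_cat /= => /orP[//|h'].
  have bx : b != x.
    by move: un; rewrite E cat_uniq => /and3P[_ /hasPn/(_ b) + _]; rewrite mem_head inE negb_or => /(_ isT)/andP[].
  have lx : last b t2 != last x t1.
    apply/eqP=> El; move: un; rewrite E cat_uniq => /and3P[_ /hasPn/(_ (last b t2)) + _].
    by rewrite mem_last => /(_ isT); rewrite /= El mem_last.
  have xl : x = last x t1 /\ last b t2 = b.
    move: h' bx lx; case: h => -[-> ->] /orP[]/andP[/eqP-> /eqP->]; rewrite ?eqxx //; by [].
  case: xl => xl1 xl2; move: sz; rewrite E size_cat /=.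
  have -> : t1 = [::].
    move: un; rewrite E cat_uniq => /and3P[h1 _ _].
    by case: (t1) xl1 h1 => // c t1' /= -> /andP[]; rewrite mem_last.
  have -> : t2 = [::].
    move: un; rewrite E cat_uniq => /and3P[_ _ h1].
    by case: (t2) xl2 h1 => // c t2' /= <- /andP[]; rewrite mem_last.
  by [].
right; apply: (fin b (t2 ++ x :: t1)).
- by rewrite cat_path p2 /= Fclo p1.
- by move: un; rewrite E uniq_catC.
- by rewrite E !size_cat /= size_cat /=; clear; move: (size t1) (size t2) => i j; lia.
by rewrite last_cat /=; case: h => -[-> ->]; rewrite !eqxx ?orbT.
Qed.

Lemma sub_induced_connected g F W : (forall x y, x \in W -> y \in W -> g x y -> F x y) ->
  induced_connected g W -> induced_connected F W.
Proof.
move=> h con x y xW yW; apply: connect_sub (con x y xW yW) => a b.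
by move=> /= /andP[/andP[aW bW] gab]; apply: connect1; rewrite /= aW bW h.
Qed.

Lemma sub_two_connected g F W : (forall x y, x \in W -> y \in W -> g x y -> F x y) ->
  two_connected_in g W -> two_connected_in F W.
Proof.
move=> h [n1 n2]; split; first exact: sub_induced_connected n1.
move=> w; apply: sub_induced_connected (n2 w) => x y.
by rewrite !inE => /andP[_ xW] /andP[_ yW]; apply: h.
Qed.

(** In a graph that is maximal without cycles of length k or more, W is complete by
[solid_clique]; but then W has a Hamiltonian cycle. *)
Lemma solid_cycle g k W : symmetric g -> irreflexive g -> 4 < k -> solid g k W ->
  two_connected_in g W -> k <= #|W| -> exists c, [/\ cycle g c, uniq c & k <= size c].
Proof.
move=> gs gi k5 sol nW leW; apply: Classical_Prop.NNPP => noc.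
pose gW : rel V := fun x y => [&& x \in W, y \in W & g x y].
pose Psi F := forall c, cycle F c -> uniq c -> size c < k.
have [|||c c1 c2|F [[Fs Fi] FW gF PF mx]] := @maximal_graph V Psi W gW.
- by move=> x y; rewrite /gW gs andbCA.
- by move=> x; rewrite /gW gi !andbF.
- by move=> x y /and3P[].
- rewrite ltnNge; apply/negP => le; apply: noc; exists c; split=> //.
  by apply: sub_cycle c1 => x y /and3P[].
have gF' x y : x \in W -> y \in W -> g x y -> F x y.
  by move=> xW yW xy; apply: gF; rewrite /gW xW yW.
have cl : clique F W.
  apply: (solid_clique sol Fs gF'); apply: saturated_closed => //.
  - exact: sub_two_connected nW.
  - by move: k5; clear; lia.
  move=> u v uW vW uv nuv; apply: Classical_Prop.NNPP => no.
  apply: (mx u v uW vW uv nuv) => c c1 c2; rewrite ltnNge; apply/negP => le.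
  have [|/PF/(_ c2)|[p [p1 p2 p3 p4]]] := cycle_break Fs uv c2 _ c1.
  - by apply: leq_trans le; move: k5; clear; lia.
  - by rewrite ltnNge le.
  apply: no; exists p; rewrite p4; split=> //; apply/and3P; split=> //.
  apply/allP=> z; rewrite inE => /orP[/eqP->//|].
  elim: p u p1 {p2 p3 p4 uW uv nuv c1} => //= a p IH u /andP[ua pth].
  have aW : a \in W by apply: (FW a u); rewrite Fs.
  by rewrite inE => /orP[/eqP->//|]; apply: IH pth.
have := enum_uniq (mem W); have : size (enum W) = #|W| by rewrite -cardE.
case E : (enum W) => [|x s] sz un.
  by move: leW; rewrite -sz leqNgt /= => /negP; apply; apply: leq_trans k5.
have inW z : z \in x :: s -> z \in W by rewrite -E mem_enum.
have := PF (x :: s) _ un; rewrite sz ltnNge leW => h; apply: notF; apply: h.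
rewrite /= rcons_path; apply/andP; split.
  by apply: (clique_path cl).
apply: cl; rewrite ?inW ?mem_head ?mem_last //.
case: s {E} sz un inW => [sz|a s _ /= /andP[h _] _]; last first.
  by apply: contraNneq h => E; rewrite -E mem_last.
by move: leW; rewrite -sz /= leqNgt => /negP[]; apply: leq_trans k5.
Qed.

End Saturated.

(** * Lifting paths of the representing graph to the incidence graph *)

Section Incidence.
Variables (V : finType) (H : {set {set V}}).
Notation pt := ({set V} + V)%type.

(** The incidence graph on all sets and vertices, the sets outside H being isolated;
compared with [incidence] this avoids proofs of membership in H. *)
Definition inc : rel pt := fun x y => match x, y with
  | inl A, inr v | inr v, inl A => (A \in H) && (v \in A)
  | _, _ => false end.

Definition incidence_set : {set pt} := [set z : pt | if z is inl A then A \in H else true].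

Lemma inc_sym : symmetric inc. Proof. by case=> [A|v] [B|w]. Qed.

Definition incidence_point (z : incidence_vertex H) : pt :=
  match z with inl A => inl (val A) | inr v => inr v end.

Lemma incidence_point_onto z : z \in incidence_set -> exists z', incidence_point z' = z.
Proof.
case: z => [A|v]; rewrite inE => h; last by exists (inr v).
by exists (inl (exist _ A h)).
Qed.

Lemma incidence_point_inj : injective incidence_point.
Proof. by move=> [A|v] [B|w] //= [] => [/val_inj->|->]. Qed.

Lemma incidence_connected (X : {set incidence_vertex H}) :
  induced_connected (@incidence V H) (~: X) -> induced_connected inc (incidence_set :\: incidence_point @: X).
Proof.
move=> con x y; rewrite !in_setD => /andP[xX xA] /andP[yX yA].
have [x' Ex] := incidence_point_onto xA; have [y' Ey] := incidence_point_onto yA; subst x y.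
have nX z : incidence_point z \notin incidence_point @: X -> z \in ~: X.
  by rewrite inE; apply: contraNN => zX; apply: imset_f.
have /connectP[p pth ->] := con x' y' (nX _ xX) (nX _ yX).
elim: p x' {xX xA nX} pth => [|z p IH] x' /= ; first by rewrite connect0.
move=> /andP[/andP[/andP[xX zX] xz] pth]; apply: connect_trans (connect1 _) (IH _ pth).
have mem u : u \in ~: X -> incidence_point u \in incidence_set :\: incidence_point @: X.
  rewrite in_setC => uX; rewrite in_setD mem_imset ?uX; last exact: incidence_point_inj.
  by case: u {uX} => [A|v]; rewrite inE //=; apply: valP.
rewrite /= !mem //; case: x' z {IH pth xX zX} xz => [A|v] [B|w] //= ->; rewrite andbT; exact: valP.
Qed.

Lemma incidence_two_connected : hypergraph_two_connected H -> two_connected_in inc incidence_set.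
Proof.
move=> [_ con].
have con0 : induced_connected inc incidence_set.
  by have := incidence_connected (con set0 _); rewrite cards0 imset0 setD0; apply.
split=> // w; have [wI|wI] := boolP (w \in incidence_set); last first.
  have -> : incidence_set :\ w = incidence_set by apply/setP=> x; rewrite in_setD1; case: eqP => // ->; rewrite (negPf wI).
  exact: con0.
have [w' <-] := incidence_point_onto wI.
by have := incidence_connected (con [set w'] _); rewrite cards1 imset_set1; apply.
Qed.

Lemma cycle_nth (T : eqType) (e : rel T) x0 (c : seq T) j : cycle e c -> j < size c ->
  e (nth x0 c j) (nth x0 c (j.+1 %% size c)).
Proof.
case: c => // x p cyc jlt; have /(pathP x0) := (cyc : path e x (rcons p x)).
rewrite size_rcons => /(_ j jlt).
have -> : nth x0 (x :: rcons p x) j = nth x0 (x :: p) j.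
  by rewrite -rcons_cons nth_rcons jlt.
have [lt|ge] := ltnP j.+1 (size (x :: p)).
  by rewrite modn_small // nth_rcons; move: (lt) => /= lt'; rewrite -ltnS lt'.
have -> : j.+1 = size (x :: p) by apply/eqP; rewrite eqn_leq ge jlt.
rewrite modnn /=; have -> : j = size p by apply/eqP; rewrite -eqSS eqn_leq ge jlt.
by rewrite nth_rcons ltnn eqxx.
Qed.

(** A cycle of the bipartite incidence graph alternates, so after a rotation the
vertices have even and the hyperedges odd positions. *)
Lemma berge_of_cycle c : cycle inc c -> uniq c -> 0 < size c ->
  has_berge_cycle H (size c)./2.
Proof.
wlog [v0 [c' E]] : c / exists v0 c', c = inr v0 :: c'.
  move=> wl cyc un sz; case: c cyc un sz => // -[A|v] p cyc un sz; last first.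
    by apply: wl => //; exists v, p.
  rewrite -(size_rot 1); apply: wl; rewrite ?rot_cycle ?rot_uniq ?size_rot //.
  case: p cyc {un sz} => [|[B|v] p] //=; rewrite ?andbF // rot1_cons.
  by exists v, (rcons p (inl A)).
move=> cyc un sz; set x0 : pt := inr v0.
pose isv (z : pt) := if z is inr _ then true else false.
have adj j : j < size c -> inc (nth x0 c j) (nth x0 c (j.+1 %% size c)).
  exact: cycle_nth.
have flip (a b : pt) : inc a b -> isv b = ~~ isv a by case: a b => [?|?] [?|?].
have par j : j < size c -> isv (nth x0 c j) = ~~ odd j.
  elim: j => [|j IH] lt; first by rewrite E.
  have lt' : j < size c by apply: ltnW.
  by have := flip _ _ (adj j lt'); rewrite modn_small // => ->; rewrite IH.
have ev : ~~ odd (size c).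
  have lt : (size c).-1 < size c by rewrite prednK.
  have := flip _ _ (adj _ lt); rewrite prednK // modnn par // par //= negbK => h.
  by move: h sz; clear; case: (size c) => // n /= <-.
set l := (size c)./2.
have szE : size c = l.*2 by rewrite -[LHS]odd_double_half (negPf ev).
pose vv j := if nth x0 c j.*2 is inr v then v else v0.
pose ee j := if nth x0 c j.*2.+1 is inl A then A else set0.
have vvE j : j < l -> nth x0 c j.*2 = inr (vv j).
  move=> jl; have := par j.*2; rewrite /vv szE ltn_double jl odd_double => /(_ isT).
  by case: (nth _ _ _).
have eeE j : j < l -> nth x0 c j.*2.+1 = inl (ee j).
  move=> jl; have := par j.*2.+1; rewrite /ee szE ltn_Sdouble jl /= odd_double => /(_ isT).
  by case: (nth _ _ _).
have inj i j : i < size c -> j < size c -> nth x0 c i = nth x0 c j -> i = j.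
  by move=> il jl /eqP; rewrite nth_uniq // => /eqP.
exists (fun i : 'I_l => vv i), (fun i : 'I_l => ee i).
have dl (i : 'I_l) : i.*2 < size c /\ i.*2.+1 < size c.
  by rewrite szE ltn_double ltn_Sdouble ltn_ord.
have a1 (i : 'I_l) : inc (inr (vv i)) (inl (ee i)).
  have [d1 d2] := dl i; have := adj i.*2 d1.
  by rewrite modn_small // vvE ?eeE.
split.
- move=> i j /= Eij; apply/val_inj/double_inj; have [d1 d2] := dl i; have [d3 d4] := dl j.
  by apply: inj => //; rewrite !vvE; [exact: (congr1 inr Eij) | exact: (ltn_ord j) | exact: (ltn_ord i)].
- move=> i j /= Eij; apply/val_inj/double_inj; have [d1 d2] := dl i; have [d3 d4] := dl j.
  by apply: succn_inj; apply: inj => //; rewrite !eeE; [exact: (congr1 inl Eij) | exact: (ltn_ord j) | exact: (ltn_ord i)].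
- by move=> i; have /andP[] := a1 i.
move=> i; have /andP[_ h1] := a1 i.
apply/subsetP=> z /set2P[->//|->].
have [d1 d2] := dl i; have := adj i.*2.+1 d2.
have -> : i.*2.+2 %% size c = (ordS i).*2.
  by rewrite szE -doubleS -!muln2 -muln_modl /=.
by rewrite eeE // vvE // => /andP[].
Qed.

Variables (g : rel V) (phi : {set V} -> {set V}).
Hypotheses (gs : symmetric g) (gi : irreflexive g).
Hypothesis gphi : forall x y, g x y -> [set x; y] \subset phi [set x; y] /\ phi [set x; y] \in H.
Hypothesis phi_inj : forall x y x' y', g x y -> g x' y' ->
  phi [set x; y] = phi [set x'; y'] -> [set x; y] = [set x'; y'].

Fixpoint lift_walk x (t : seq V) : seq pt :=
  if t is y :: t' then inl (phi [set x; y]) :: inr y :: lift_walk y t' else [::].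

(** The subdivision of G[B] inside the incidence graph: the vertices of B, and the
hyperedges that represent edges of G[B]. *)
Definition subdivision (B : {set V}) : {set pt} := [set z : pt | match z with
  | inr v => v \in B
  | inl A => [exists a, exists b, [&& a \in B, b \in B, g a b & A == phi [set a; b]]] end].

Lemma subdivision_inr (B : {set V}) v : (inr v \in subdivision B) = (v \in B).
Proof. by rewrite inE. Qed.

Lemma subdivision_inlP (B : {set V}) A : reflect (exists a b, [/\ a \in B, b \in B, g a b & A = phi [set a; b]])
  (inl A \in subdivision B).
Proof.
rewrite inE; apply: (iffP existsP) => [[a /existsP[b /and4P[h1 h2 h3 /eqP h4]]]|[a [b [h1 h2 h3 h4]]]].
  by exists a, b.
by exists a; apply/existsP; exists b; rewrite h1 h2 h3 h4 eqxx.
Qed.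

Lemma subdivision_incidence_set B : subdivision B \subset incidence_set.
Proof.
apply/subsetP=> -[A|v]; last by rewrite !inE.
by move=> /subdivision_inlP[a [b [_ _ ab ->]]]; rewrite inE; case: (gphi ab).
Qed.

Lemma inc_edge x y : g x y -> inc (inr x) (inl (phi [set x; y])) && inc (inl (phi [set x; y])) (inr y).
Proof.
by move=> xy; have [/subsetP s h] := gphi xy; rewrite /= h !s // !inE eqxx ?orbT.
Qed.

Lemma lift_walk_path x t : path g x t -> path inc (inr x) (lift_walk x t).
Proof.
elim: t x => // y t IH x /andP[xy pth].
by have /andP[h1 h2] := inc_edge xy; apply/and3P; split; [exact: h1 | exact: h2 | exact: IH].
Qed.

Lemma lift_walk_last x t : last (inr x) (lift_walk x t) = inr (last x t).
Proof. by elim: t x => //= y t IH x; rewrite IH. Qed.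

Lemma lift_walk_size x t : size (lift_walk x t) = (size t).*2.
Proof. by elim: t x => //= y t IH x; rewrite IH. Qed.

Lemma lift_walk_inr x t v : (inr v \in lift_walk x t) = (v \in t).
Proof. by elim: t x => //= y t IH x; rewrite !inE IH. Qed.

Lemma lift_walk_inl (e : rel V) x t A : path e x t -> inl A \in lift_walk x t ->
  exists a b, [/\ A = phi [set a; b], e a b, a \in x :: t & b \in x :: t].
Proof.
elim: t x => //= y t IH x /andP[xy pth]; rewrite !inE /= => /orP[/eqP[->]|h].
  by exists x, y; rewrite !inE !eqxx ?orbT.
have [a [b [h1 h2 h3 h4]]] := IH y pth h.
by exists a, b; split=> //; rewrite inE ?h3 ?h4 orbT.
Qed.

Lemma lift_walk_uniq x t : path g x t -> uniq (x :: t) -> uniq (inr x :: lift_walk x t : seq pt).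
Proof.
move=> pth un; rewrite cons_uniq lift_walk_inr; have /andP[-> un'] := un.
elim: t x pth un {un'} => //= y t IH x /andP[xy pth] /andP[xn un].
rewrite inE /= lift_walk_inr; have /andP[-> un'] := un; rewrite IH // !andbT.
apply/negP=> /(lift_walk_inl pth)[a [b [E ab h1 h2]]].
have := phi_inj xy ab E => /setP/(_ x); rewrite !inE eqxx /= => /esym/orP[]/eqP Ex.
  by rewrite Ex h1 in xn.
by rewrite Ex h2 in xn.
Qed.

Lemma lift_walk_upath B x t : upath g B x t -> upath inc (subdivision B) (inr x) (lift_walk x t).
Proof.
move=> /and3P[pth un /allP al]; apply/and3P; split; first exact: lift_walk_path.
  exact: lift_walk_uniq.
apply/allP=> -[A|v].
  rewrite inE /= => /(lift_walk_inl pth)[a [b [E ab h1 h2]]].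
  by apply/subdivision_inlP; exists a, b; split=> //; apply: al.
rewrite inE lift_walk_inr => h; suff : inr v \in subdivision B by [].
by rewrite subdivision_inr; apply: al; rewrite inE.
Qed.

Lemma berge_of_gcycle c : cycle g c -> uniq c -> 2 < size c -> has_berge_cycle H (size c).
Proof.
case: c => // x t; rewrite /= rcons_path => /andP[pth clo] un sz.
set c' := inr x :: rcons (lift_walk x t) (inl (phi [set last x t; x])).
have szc : size c' = (size t).+1.*2 by rewrite /= size_rcons lift_walk_size.
have -> : (size t).+1 = (size c')./2 by rewrite szc doubleK.
have /andP[h1 h2] := inc_edge clo.
apply: berge_of_cycle; last by rewrite szc.
  by rewrite /c' [cycle _ _]/= !rcons_path lift_walk_path // lift_walk_last h1 last_rcons h2.
have := lift_walk_uniq pth un; rewrite /c' -rcons_cons rcons_uniq => ->; rewrite andbT inE /=.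
apply/negP=> /(lift_walk_inl (e := fun a b => g a b && ([set a; b] != [set last x t; x]))) [].
  case: t un pth clo sz {c' szc h1 h2} => // y [//|z t] un pth clo _.
  have clean a s : path g a s -> x \notin a :: s ->
      path (fun a b => g a b && ([set a; b] != [set last x [:: y, z & t]; x])) a s.
    elim: s a => //= b s IH a /andP[ab p]; rewrite !inE !negb_or => /and3P[xa xb xs].
    rewrite ab IH ?inE ?negb_or ?xb // andbT /=.
    apply/eqP=> /setP/(_ x); rewrite !inE eqxx orbT (negPf xa) (negPf xb) //.
  have /andP[xn un'] : (x \notin [:: y, z & t]) && uniq [:: y, z & t] := un.
  have /andP[xy p'] : g x y && path g y (z :: t) := pth.
  rewrite [path _ _ _]/= -/(path _ y (z :: t)) xy /=; apply/andP; split; last first.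
    by have := clean y (z :: t) p' xn.
  apply/eqP=> /setP/(_ (last x [:: y, z & t])); rewrite !inE eqxx /=.
  have h0 : last z t \in z :: t := mem_last _ _.
  move=> /orP[]/eqP El.
    by move: xn; rewrite -El inE h0 orbT.
  by move: un' => /andP[]; rewrite -El h0.
move=> a [b [E /andP[ab nE] _ _]].
by have := phi_inj clo ab E => E'; rewrite E' eqxx in nE.
Qed.

Definition is_point (z : pt) (P : {set V}) := match z with
  | inr v => P = [set v]
  | inl A => exists a b, [/\ g a b, P = [set a; b] & A = phi P] end.

Definition hyperedge_end (z : pt) : nat := if z is inl _ then 1 else 0.

Lemma subdivision_point B z : z \in subdivision B -> exists P, [/\ point g B P, is_point z P & #|P| = (hyperedge_end z).+1].
Proof.
case: z => [A /subdivision_inlP[a [b [aB bB ab ->]]]|v].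
  exists [set a; b]; split; last 1 first.
  - by rewrite cards2; case: eqP ab => // ->; rewrite gi.
  - by split; [apply/subsetP=> x /set2P[]-> | right; exists a, b].
  by exists a, b.
rewrite subdivision_inr => vB; exists [set v]; split=> //; last by rewrite cards1.
by split; [rewrite sub1set | left; rewrite cards1].
Qed.

Lemma is_point_inj z z' P : is_point z P -> is_point z' P -> z = z'.
Proof.
have two a b : g a b -> #|[set a; b]| = 2 by move=> ab; rewrite cards2; case: eqP ab => // ->; rewrite gi.
case: z z' => [A|v] [A'|v'] /=.
- by move=> [a [b [_ _ ->]]] [a' [b' [_ _ ->]]].
- by move=> [a [b [ab -> _]]] E; have := two _ _ ab; rewrite E cards1.
- by move=> -> [a [b [ab E _]]]; have := two _ _ ab; rewrite -E cards1.
by move=> -> /set1_inj->.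
Qed.

(** Insert between consecutive vertices the hyperedges that represent the edges, and
add the hyperedges at the ends. The edges P and Q do not occur on the path, so
these hyperedges are new. *)
Lemma lift_point_path B z1 z2 P Q m : z1 \in subdivision B -> z2 \in subdivision B -> is_point z1 P -> is_point z2 Q ->
  z1 != z2 -> point_path g B P Q m -> exists a, [/\ upath inc (subdivision B) z1 a, last z1 a = z2 &
    m.*2 + hyperedge_end z1 + hyperedge_end z2 <= (size a).+2].
Proof.
move=> z1B z2B p1 p2 z12 [x [t [up xP lQ sz]]].
have upg : upath g B x t.
  by move/and3P: up => [h1 h2 h3]; apply/and3P; split=> //; apply: sub_path h1 => a b /and3P[].
have U := lift_walk_upath upg.
have notP A : (exists a b, [/\ g a b, P = [set a; b] & A = phi P]) -> inl A \notin lift_walk x t.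
  move=> [a [b [ab E ->]]]; apply/negP=> /(lift_walk_inl (upath_path up))[a' [b' [E' /and3P[ab' nP _] _ _]]].
  by move/eqP: nP; apply; rewrite E; symmetry; apply: phi_inj => //; rewrite -E.
have notQ A : (exists a b, [/\ g a b, Q = [set a; b] & A = phi Q]) -> inl A \notin lift_walk x t.
  move=> [a [b [ab E ->]]]; apply/negP=> /(lift_walk_inl (upath_path up))[a' [b' [E' /and3P[ab' _ nQ] _ _]]].
  by move/eqP: nQ; apply; rewrite E; symmetry; apply: phi_inj => //; rewrite -E.
have incP A (R : {set V}) y : (exists a b, [/\ g a b, R = [set a; b] & A = phi R]) -> y \in R ->
    inc (inr y) (inl A).
  move=> [a [b [ab -> ->]]] yR; have [/subsetP s h] := gphi ab.
  by rewrite /= h s.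
have [s [Us ls szs sin]] : exists s, [/\ upath inc (subdivision B) (inr x) s, last (inr x) s = z2,
   (size t).*2 + hyperedge_end z2 <= size s & forall u, u \in s -> u \in lift_walk x t \/ u = z2].
  case: z2 p2 z12 z2B => [A|v] /= p2 z12 z2B.
    exists (rcons (lift_walk x t) (inl A)); split.
    - rewrite -cats1; apply: upath_cat => //.
        rewrite lift_walk_last; have lB : (inr (last x t) : pt) \in subdivision B.
          by rewrite subdivision_inr; apply: (upath_sub upg); apply: mem_last.
        apply/and3P; split; [|by []|].
          by apply/andP; split; [apply: incP p2 lQ|].
        by apply/andP; split; [|apply/andP].
      move=> u h; rewrite inE => /eqP Eu; move: h; rewrite Eu inE /=.
      exact/negP/notQ.
    - by rewrite last_rcons.
    - by rewrite size_rcons lift_walk_size addn1.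
    by move=> u; rewrite mem_rcons inE => /orP[/eqP|]; auto.
  exists (lift_walk x t); split=> //.
  - by rewrite lift_walk_last; move: lQ; rewrite p2 inE => /eqP->.
  - by rewrite lift_walk_size addn0.
  by auto.
case: z1 p1 z12 z1B => [A|v] /= p1 z12 z1B; last first.
  move: xP; rewrite p1 inE => /eqP Ex; rewrite -Ex; exists s; split=> //.
  by move: sz szs => /=; rewrite -!muln2; clear; move: (size t) (size s) (hyperedge_end z2) => i j k; lia.
exists (inr x :: s); split=> //; last first.
  by move: sz szs => /=; rewrite -!muln2; clear; move: (size t) (size s) (hyperedge_end z2) => i j k; lia.
move/and3P: Us => [h1 h2 h3]; apply/and3P; split.
- by apply/andP; split; [rewrite inc_sym; apply: incP p1 xP|].
- rewrite cons_uniq h2 andbT inE /=; apply/negP=> /sin[].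
    exact/negP/notP.
  by move=> E; rewrite E eqxx in z12.
by apply/andP; split.
Qed.

(** An end at an edge may cost one vertex, namely if the path starts with that edge. *)
Definition linked (B : {set V}) d := forall P Q, point g B P -> point g B Q -> P <> Q ->
  point_path g B P Q (d.+1 - #|P|.-1 - #|Q|.-1).

Lemma linked_lift B d z1 z2 : linked B d -> 0 < d -> z1 \in subdivision B -> z2 \in subdivision B -> z1 != z2 ->
  exists a, [/\ upath inc (subdivision B) z1 a, last z1 a = z2 & d.*2 <= size a + hyperedge_end z1 + hyperedge_end z2].
Proof.
move=> lk d0 z1B z2B z12; have [P [pP p1 c1]] := subdivision_point z1B; have [Q [pQ p2 c2]] := subdivision_point z2B.
have nPQ : P <> Q by move=> E; move/eqP: z12; apply; apply: is_point_inj p1 _; rewrite E.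
have [a [ua la sza]] := lift_point_path z1B z2B p1 p2 z12 (lk P Q pP pQ nPQ).
exists a; split=> //; move: sza d0; rewrite c1 c2 -!muln2; clear.
case: z1 => ?; case: z2 => ?; rewrite /hyperedge_end /=; move: (size a) => i; lia.
Qed.

Lemma linked_hamiltonian K : hamiltonian g K -> linked K #|K|.-1.
Proof.
move=> ham P Q pP pQ nPQ; have [x [t [h1 h2 h3 h4]]] := ham P Q pP pQ nPQ.
have K0 : 0 < #|K| by apply/card_gt0P; exists x; apply: (upath_sub h1); apply: mem_head.
by exists x, t; split=> //; apply: leq_trans h4; move: K0; clear; lia.
Qed.

(** If the path from u starts with the edge P, drop u and start at the other end. *)
Lemma trim_edge (e : rel V) B P u p : (forall x y, e x y -> g x y) -> point g B P ->
  upath e B u p -> u \in P ->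
  exists x t, [/\ upath (fun a b => e a b && ([set a; b] != P)) B x t, x \in P, last x t = last u p
    & size p <= size t + #|P|.-1].
Proof.
move=> eg [sP pP] /and3P[pth un al] uP.
have clean a s : path e a s -> u \notin a :: s -> path (fun a b => e a b && ([set a; b] != P)) a s.
  elim: s a => //= b s IH a /andP[ab p']; rewrite !inE !negb_or => /and3P[ua ub us].
  rewrite ab IH ?inE ?negb_or ?ub // andbT /=; apply: contraTneq uP => <-.
  by rewrite !inE negb_or ua.
case: p pth un al => [|h p] pth un al.
  by exists u, [::].
have /andP[uh p'] : e u h && path e h p := pth.
have /andP[un1 un2] : (u \notin h :: p) && uniq (h :: p) := un.
have [E|nE] := eqVneq [set u; h] P.
  exists h, p; split=> //; last 1 first.
  - rewrite -E cards2; case: eqP (eg _ _ uh) => [->|_ _]; first by rewrite gi.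
    by rewrite /= addn1.
  - by apply/and3P; split=> //; [apply: clean | case/andP: al].
  by rewrite -E set22.
exists u, (h :: p); split=> //; last by rewrite leq_addr.
by apply/and3P; split=> //; rewrite /= uh nE /=; apply: clean.
Qed.

Lemma linked_of_paths (B : {set V}) d : (forall u v, u \in B -> v \in B -> u != v ->
    exists p, [/\ upath g B u p, last u p = v & d <= size p]) -> linked B d.
Proof.
move=> paths P Q pP pQ nPQ.
have [u [v [uP vQ uv]]] : exists u v, [/\ u \in P, v \in Q & u != v].
  have [/set0Pn[u uP] /set0Pn[v vQ]] := (point_neq0 pP, point_neq0 pQ).
  have [Euv|] := eqVneq u v; last by exists u, v.
  have [/eqP sP|] := boolP (P == [set u]).
    have [/eqP sQ|] := boolP (Q == [set u]); first by case: nPQ; rewrite sP sQ.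
    rewrite eqEsubset sub1set {2}Euv vQ andbT => /subsetPn[w wQ].
    by rewrite inE => wu; exists u, w; rewrite eq_sym.
  rewrite eqEsubset sub1set uP andbT => /subsetPn[w wP].
  by rewrite inE => wu; exists w, v; split=> //; rewrite -Euv.
have uB := subsetP pP.1 _ uP; have vB := subsetP pQ.1 _ vQ.
have [p [up lp szp]] := paths u v uB vB uv.
have [x [t [ut xP lt szt]]] := trim_edge (fun _ _ h => h) pP up uP.
set e1 := (fun a b => g a b && ([set a; b] != P)) in ut.
have e1s : symmetric e1 by move=> a b; rewrite /e1 gs setUC.
have [ur lr] := upath_rev e1s ut; rewrite lt lp in ur lr.
have [|x2 [t2 [ut2 xQ lt2 szt2]]] := trim_edge (e := e1) _ pQ ur vQ; first by move=> a b /andP[].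
set e2 := (fun a b => e1 a b && ([set a; b] != Q)) in ut2.
have e2s : symmetric e2 by move=> a b; rewrite /e2 e1s setUC.
have [ur2 lr2] := upath_rev e2s ut2; rewrite lt2 lr in ur2 lr2.
exists x, (rev (belast x2 t2)); split=> //.
- move/and3P: ur2 => [h1 h2 h3]; apply/and3P; split=> //.
  by apply: sub_path h1 => a b /andP[/andP[h4 h5] h6]; apply/and3P.
- by rewrite lr2.
move: szp szt szt2; rewrite /= !size_rev !size_belast; clear.
by move: (size p) (size t) (size t2) #|P|.-1 #|Q|.-1 => i j k l n; lia.
Qed.

(** Two hyperedges are never adjacent, so a link between them has an inner vertex;
this compensates what hyperedge ends cost in [link_cycle]. *)
Lemma link_size W S Y z q : link inc W S Y z q -> (forall u, u \in S -> u \in Y -> hyperedge_end u = 0) ->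
  hyperedge_end z + hyperedge_end (last z q) <= size q.
Proof.
move=> [zS lY /and3P[pth _ _] _ _] h0; case: q pth lY => [|a [|b q]] /=.
- by move=> _ zY; rewrite (h0 z).
- by rewrite andbT; case: z {zS} => [A|v]; case: a => [A'|v'].
by move=> _ _; case: z {zS} => ?; case: (last _ _) => ?.
Qed.

(** Two disjoint paths of the incidence graph between the two subdivisions, closed
by long paths inside them. A common vertex of B1 and B2 serves as a path of
length 0. Each subdivision contributes a path with about d1 or d2 vertices,
and the losses at hyperedge ends are compensated by the links. *)
Lemma link_cycle B1 B2 d1 d2 : two_connected_in inc incidence_set -> linked B1 d1 -> linked B2 d2 ->
  0 < d1 -> 0 < d2 -> 1 < #|B1| -> 1 < #|B2| ->
  {in B1 :&: B2 &, forall x y, x = y} ->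
  exists c, [/\ cycle inc c, uniq c & (d1 + d2).*2 <= size c].
Proof.
move=> nI lk1 lk2 d10 d20 c1 c2 one.
set S := subdivision B1; set Y := subdivision B2.
have SY0 u : u \in S -> u \in Y -> exists2 v, u = inr v & v \in B1 :&: B2.
  case: u => [A|v]; last by rewrite !subdivision_inr => v1 v2; exists v; rewrite ?inE ?v1.
  move=> /subdivision_inlP[a [b [a1 b1 ab ->]]] /subdivision_inlP[a' [b' [a2 b2 ab' /(phi_inj ab ab') E]]].
  have a2' : a \in B2 by have := set21 a b; rewrite E => /set2P[]->.
  have b2' : b \in B2 by have := set22 a b; rewrite E => /set2P[]->.
  have Eab : a = b by apply: one; rewrite inE ?a1 ?b1.
  by move: ab; rewrite Eab gi.
have SYh u : u \in S -> u \in Y -> hyperedge_end u = 0 by move=> uS uY; have [v ->] := SY0 u uS uY.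
have other (B : {set V}) z : 1 < #|B| -> exists2 s, s \in subdivision B & s != z.
  move=> /card_gt1P[x [y [xB yB xy]]].
  have [E|ne] := eqVneq (inr x) z; last by exists (inr x); rewrite ?subdivision_inr.
  exists (inr y); rewrite ?subdivision_inr // -E; apply: contraNneq xy => -[->] //.
have [s0 [p0 [lk0 SYs]]] : exists s0 p0, link inc incidence_set S Y s0 p0 /\
    (forall u, u \in S -> u \in Y -> u = s0).
  have [E0|/set0Pn[c cB]] := eqVneq (B1 :&: B2) set0.
    have /card_gt0P[x xB] : 0 < #|B1| by apply: ltnW.
    have /card_gt0P[y yB] : 0 < #|B2| by apply: ltnW.
    have xS : inr x \in S by rewrite subdivision_inr.
    have yY : inr y \in Y by rewrite subdivision_inr.
    have [z [p lk]] := conn_link nI.1 (subsetP (subdivision_incidence_set _) _ xS) (subsetP (subdivision_incidence_set _) _ yY) xS yY.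
    exists z, p; split=> // u uS uY; have [v _] := SY0 u uS uY.
    by rewrite E0 inE.
  have /setIP[cB1 cB2] := cB.
  exists (inr c), [::]; split; last first.
    by move=> u uS uY; have [v -> vB] := SY0 u uS uY; rewrite (one v c).
  split; rewrite ?subdivision_inr //; last 2 first.
  - by move=> u; rewrite inE => /eqP.
  - by move=> u; rewrite inE => /eqP.
  by apply: upath_nil; rewrite inE.
have [q [y [q' [lkq lkq' dis _]]]] := two_paths nI (subdivision_incidence_set _) (subdivision_incidence_set _) lk0
   (other B1 s0 c1) (other B2 (last s0 p0) c2).
have [sS lY _ _ _] := lkq; have [yS lY' _ _ _] := lkq'.
have sy : s0 != y by apply/eqP=> E; apply: (dis s0); rewrite ?mem_head // E mem_head.
have ll : last s0 q != last y q'.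
  by apply/eqP=> E; apply: (dis (last s0 q)); rewrite ?mem_last // E mem_last.
have [a [ua la sza]] := linked_lift lk1 d10 sS yS sy.
have [b [ub lb szb]] := linked_lift lk2 d20 lY lY' ll.
have [c [h1 h2 _ h4]] := cycle_of_links inc_sym (subdivision_incidence_set _) (subdivision_incidence_set _) lkq lkq' dis SYs ua la ub lb.
exists c; split=> //; rewrite h4; move: sza szb (link_size lkq SYh) (link_size lkq' SYh).
rewrite -!muln2; clear; move: (size a) (size b) (size q) (size q') (hyperedge_end _) (hyperedge_end _) (hyperedge_end _) (hyperedge_end _).
by move=> *; lia.
Qed.

End Incidence.

(** * Blocks hanging at a cut vertex *)

Section Blocks.
Variables (V : finType) (g : rel V).
Hypotheses (gs : symmetric g) (gi : irreflexive g).
Implicit Types (B C D E K W X : {set V}).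

(** A smallest set D inside C attached to the rest of W by at most one vertex c;
B is D with that vertex, if there is one. A component of B minus a vertex that
does not contain c would be a smaller choice for D. *)
Lemma end_block W C w : C != set0 -> C \subset W ->
  (forall x y, x \in C -> y \in W -> g x y -> y \in C \/ y = w) ->
  exists D B c, [/\ D != set0 /\ D \subset C, D \subset B /\ B \subset W, B \subset c |: D,
    (forall x y, x \in D -> y \in W -> g x y -> y \in B) /\
    (forall y, y \in B -> y \notin D -> exists2 x, x \in D & g x y) & two_connected_in g B].
Proof.
move=> C0 sCW clC.
pose fam (Dc : {set V} * V) := [&& Dc.1 != set0, Dc.1 \subset C &
  [forall x in Dc.1, forall y in W, g x y ==> (y \in Dc.1) || (y == Dc.2)]].
have famP D c : D != set0 -> D \subset C ->
    (forall x y, x \in D -> y \in W -> g x y -> y \in D \/ y = c) -> fam (D, c).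
  move=> h1 h2 h3; rewrite /fam h1 h2; apply/forall_inP=> x xD; apply/forall_inP=> y yW.
  by apply/implyP=> xy; case: (h3 x y xD yW xy) => [->|->]; rewrite ?eqxx ?orbT.
have fam0 : fam (C, w) by apply: famP.
have [[D c] /= famD minD] := @arg_minnP _ (C, w) fam (fun Dc => #|Dc.1|) fam0.
have {}minD D' c' : fam (D', c') -> #|D| <= #|D'| by move/minD.
case/and3P: famD => /= D0 sDC /forall_inP nbD.
have clD x y : x \in D -> y \in W -> g x y -> y \in D \/ y = c.
  move=> xD yW xy; have /forall_inP/(_ y yW) := nbD x xD; rewrite xy.
  by case/orP=> [|/eqP]; auto.
pose N := [set y in W :\: D | [exists x in D, g x y]].
have NP y : reflect [/\ y \in W, y \notin D & exists2 x, x \in D & g x y] (y \in N).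
  rewrite !inE; apply: (iffP andP) => [[/andP[h1 h2] /exists_inP h3]|[h1 h2 h3]]; first by [].
  by rewrite h1 h2; split=> //; apply/exists_inP.
have Nc y : y \in N -> y = c.
  move=> /NP[yW yD [x xD xy]]; case: (clD x y xD yW xy) => // yD'; by rewrite yD' in yD.
pose B := D :|: N.
have sDW : D \subset W := subset_trans sDC sCW.
have nbB x y : x \in D -> y \in W -> g x y -> y \in B.
  move=> xD yW xy; rewrite in_setU; have [//|yD] := boolP (y \in D).
  by apply/NP; split=> //; exists x.
exists D, B, c; split=> //.
- split; first exact: subsetUl.
  by rewrite subUset sDW; apply/subsetP=> y /NP[].
- by apply/subsetP=> y /setUP[yD|/Nc->]; rewrite !inE ?eqxx ?yD ?orbT.
- split=> // y /setUP[->//|/NP[_ _ h] _]; exact: h.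
have conE E' z : E' \subset B -> (forall y, y \in B -> y \in E' \/ y = z) -> induced_connected g E'.
  move=> sE hE.
  have full (C' : {set V}) : C' != set0 -> C' \subset D ->
      (forall x y, x \in C' -> y \in E' -> g x y -> y \in C') -> C' = D.
    move=> h1 h2 h3; apply/eqP; rewrite eqEcard h2; apply: (minD C' z).
    apply: famP => //; first exact: subset_trans sDC.
    move=> x y xC yW xy; have yB := nbB x y (subsetP h2 _ xC) yW xy.
    by case: (hE y yB) => [yE|->]; [left; apply: h3 xy | right].
  have [nN|] := boolP (N :&: E' == set0); last first.
    case/set0Pn=> n /setIP[nN nE]; apply: (root_connected gs nE) => C' C'0 sC' clC'.
    have nC' : n \notin C' by apply/negP=> /(subsetP sC'); rewrite !inE eqxx.
    have sC'D : C' \subset D.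
      apply/subsetP=> y /(subsetP sC') /setD1P[yn /(subsetP sE)/setUP[//|yN]].
      by move/eqP: yn; rewrite (Nc y yN) (Nc n nN).
    have /NP[_ _ [x xD xn]] := nN.
    by case/negP: nC'; apply: (clC' x) => //; rewrite (full C').
  have sED : E' \subset D.
    apply/subsetP=> y yE; have /setUP[//|yN] := subsetP sE _ yE.
    by have := in_set0 y; rewrite -(eqP nN) in_setI yN yE.
  move=> x0 y0 x0E; apply: (root_connected gs x0E) (x0E) => C' C'0 sC' clC'.
  have xC' : x0 \notin C' by apply/negP=> /(subsetP sC'); rewrite !inE eqxx.
  have sC'D : C' \subset D.
    by apply: subset_trans sED; apply: subset_trans sC' _; apply: subD1set.
  by rewrite (full C') // (subsetP sED) in xC'.
split; first by apply: (conE _ w); rewrite ?subxx //; auto.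
move=> z; apply: (conE _ z); first by rewrite subD1set.
by move=> y yB; have [->|yz] := eqVneq y z; [right | left; rewrite in_setD1 yz].
Qed.

(** Remove the first vertex of a Hamiltonian path that starts at it. *)
Lemma hamiltonian_two_connected K : hamiltonian g K -> two_connected_in g K.
Proof.
move=> ham.
have pt1 v : v \in K -> point g K [set v].
  by move=> vK; split; [rewrite sub1set | left; rewrite cards1].
have path_conn E a p : path g a p -> {subset a :: p <= E} -> connect [rel u v in E | g u v] a (last a p).
  elim: p a => [|b p IH] a /=; first by rewrite connect0.
  move=> /andP[ab pth] sub; apply: connect_trans (connect1 _) (IH b pth _).
    by rewrite /= ab !sub // !inE eqxx ?orbT.
  by move=> u up; apply: sub; rewrite inE up orbT.
have hp a b : a \in K -> b \in K -> a != b -> exists t, [/\ path g a t, uniq (a :: t),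
    {subset a :: t <= K}, last a t = b & forall u, u \in K -> u \in a :: t].
  move=> aK bK ab; have [|x [t [/and3P[h1 h2 /allP h3] /set1P h4 /set1P h5 h6]]] := ham _ _ (pt1 a aK) (pt1 b bK).
    by move/set1_inj=> E; rewrite E eqxx in ab.
  subst x; exists t; split=> //; first by apply: sub_path h1 => u v /and3P[].
  move=> u uK; suff -> : (a :: t) =i K by [].
  apply/subset_cardP; last by apply/subsetP.
  apply/eqP; rewrite eqn_leq (card_uniqP h2) h6 andbT -(card_uniqP h2).
  by apply: subset_leq_card; apply/subsetP.
have con : induced_connected g K.
  move=> a b aK bK; have [->|ab] := eqVneq a b; first exact: connect0.
  by have [t [h1 _ h3 <- _]] := hp a b aK bK ab; apply: path_conn.
split=> // w; have [wK|wK] := boolP (w \in K); last first.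
  have -> : K :\ w = K; last by [].
  by apply/setP=> x; rewrite in_setD1; case: eqP => // ->; rewrite (negPf wK).
move=> a b /setD1P[aw aK] /setD1P[bw bK].
have [|t [h1 h2 h3 h4 h5]] := hp w b wK bK; first by rewrite eq_sym.
have : a \in w :: t by apply: h5.
rewrite inE (negPf aw) /= => /splitPr E; case: E h1 h2 h3 h4 {h5} => t1 t2.
rewrite cat_path last_cat /= => /and3P[_ _ pth] /andP[wn _] sub <-.
apply: path_conn => // u ut; have ut' : u \in t1 ++ a :: t2 by rewrite mem_cat ut orbT.
rewrite in_setD1 sub ?andbT; first by apply: contraNneq wn => <-.
by rewrite inE ut' orbT.
Qed.

Lemma end_block_linked W D B c d : D != set0 -> D \subset B -> B \subset W -> B \subset c |: D ->
  (forall x y, x \in D -> y \in W -> g x y -> y \in B) -> two_connected_in g B ->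
  (forall w, w \in D -> d <= #|nbr g W w|) -> linked g B d /\ d < #|B|.
Proof.
move=> /set0Pn[x0 x0D] sDB sBW sBc nbB nB deg.
have degB w : w \in D -> d <= #|nbr g B w|.
  move=> wD; apply: leq_trans (deg w wD) _; apply: subset_leq_card; apply/subsetP=> y.
  by rewrite !inE => /andP[yW wy]; rewrite wy (nbB w).
have dB : d < #|B| by apply: leq_ltn_trans (degB _ x0D) (nbr_lt gi (subsetP sDB _ x0D)).
split=> //; apply: (linked_of_paths gs gi) => u v uB vB uv.
apply: (long_path gs gi (c := c)) => // w wB; rewrite !inE !negb_or => /and3P[_ _ wc].
by apply: degB; have := subsetP sBc _ wB; rewrite !inE (negPf wc).
Qed.

(** Keep deleting vertices of degree at most a until j vertices remain. *)
Lemma degenerate_removable_set a j : (forall X, X != set0 -> exists2 x, x \in X & #|nbr g X x| <= a) ->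
  j <= #|V| -> exists2 K : {set V}, #|K| = j & removable g a K.
Proof.
move=> deg jV; rewrite -(subKn jV); elim: (#|V| - j) => [|i [K cK rK]].
  exists [set: V]; first by rewrite cardsT subn0.
  by move=> X X0; rewrite setCT subset0 (negPf X0).
have [E|K0] := eqVneq K set0.
  exists K => //; move: cK; rewrite E cards0 => /esym/eqP; rewrite subn_eq0 => le.
  by apply/esym/eqP; rewrite subn_eq0 ltnW.
have [x xK dx] := deg K K0; exists (K :\ x).
  by move: cK; rewrite (cardsD1 x K) xK; clear; lia.
move=> X X0 sX.
have sub_le (A B : {set V}) z : A \subset B -> #|nbr g B z| <= a -> #|nbr g A z| <= a.
  move=> sAB; apply: leq_trans; apply: subset_leq_card; apply/subsetP=> y.
  by rewrite !inE => /andP[/(subsetP sAB)-> ->].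
have [EX|X1] := eqVneq (X :\ x) set0.
  have /set0Pn[z zX] := X0; have zx : z = x.
    by apply/eqP; apply: contraFT (in_set0 z) => zx; rewrite -EX !inE zx.
  exists z => //; rewrite zx; apply: sub_le dx; apply/subsetP=> y; rewrite !inE => /orP[/andP[]//|yX].
  suff -> : y = x by [].
  by apply/eqP; apply: contraFT (in_set0 y) => yx; rewrite -EX !inE yx.
have [|z zX dz] := rK _ X1.
  apply/subsetP=> y; rewrite !inE => /andP[yx yX].
  by have := subsetP sX _ yX; rewrite !inE yx.
exists z; first by move: zX; rewrite inE => /andP[].
apply: sub_le dz; apply/subsetP=> y; rewrite !inE.
by have [->|] := eqVneq y x; rewrite ?xK.
Qed.

(** The neighbours of an end of a longest path all lie on the path. *)
Lemma min_degree_cycle X : X != set0 -> (forall x, x \in X -> 2 < #|nbr g X x|) ->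
  exists c, [/\ cycle g c, uniq c & 3 < size c].
Proof.
move=> /set0Pn[x xX] deg; have : upath g X x [::] by apply: upath_nil.
move: [::] => p; move En: (#|X| - size p) => n; elim/ltn_ind: n x xX p En => n IH x xX p En up.
have un := upath_uniq up.
have [sub|/subsetPn[z]] := boolP (nbr g X x \subset p); last first.
  rewrite inE => /andP[zX xz] zp.
  have le_X : size p < #|X|.
    have := uniq_leq_size un (s2 := enum X); rewrite -cardE; apply.
    by move=> u /(upath_sub up); rewrite mem_enum.
  apply: (IH (#|X| - size (x :: p)) _ z zX (x :: p)) => //.
    by rewrite -En /=; move: le_X; clear; lia.
  move: up => /and3P[h1 h2 h3]; apply/and3P; split; last by apply/andP; split.
    by apply/andP; split; rewrite // gs.
  by rewrite cons_uniq h2 andbT inE negb_or zp andbT; apply: contraTneq xz => ->; rewrite gi.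
have c3 : 2 < count (g x) p.
  apply: leq_trans (deg x xX) (nbr_count _) => z zN; exact: (subsetP sub).
have hp : has (g x) (rev p) by rewrite has_rev has_count; apply: leq_trans c3.
move Er: (rev p) hp => s hp; case: (split_find hp) Er => c r1 r2 gxc no E.
have Ep : p = rcons (rev r2) c ++ rev r1.
  by rewrite -[LHS]revK E rev_cat rev_rcons cat_rcons.
have [u1 _ _] := upath_catP (eq_ind _ (fun q => upath g X x q) up _ Ep).
exists (x :: rcons (rev r2) c); split.
- by rewrite /= rcons_path (upath_path u1) last_rcons gs.
- exact: upath_uniq u1.
rewrite /= ltnS; apply: leq_trans (count_size (g x) _); apply: leq_trans c3 _.
rewrite Ep count_cat -[leqRHS]addn0 leq_add2l leqn0 -leqn0 leqNgt -has_count has_rev.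
by [].
Qed.

End Blocks.

(** * Solid sets are small *)

Section Main.
Variables (V : finType) (H : {set {set V}}) (k : nat).
Hypothesis hcycle : forall l : nat, k <= l -> ~ has_berge_cycle H l.
Hypothesis hconn : hypergraph_two_connected H.
Hypothesis k5 : 4 < k.
Variables (g : rel V) (phi : {set V} -> {set V}).
Hypotheses (gs : symmetric g) (gi : irreflexive g).
Hypothesis gphi : forall x y, g x y -> [set x; y] \subset phi [set x; y] /\ phi [set x; y] \in H.
Hypothesis phi_inj : forall x y x' y', g x y -> g x' y' ->
  phi [set x; y] = phi [set x'; y'] -> [set x; y] = [set x'; y'].

Lemma no_long_cycle c : cycle (inc H) c -> uniq c -> k.*2 <= size c -> False.
Proof.
move=> h1 h2 h3; apply: (hcycle (l := (size c)./2)); first by rewrite geq_half_double.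
by apply: berge_of_cycle => //; move: h3 k5; rewrite -muln2; clear; lia.
Qed.

(** Otherwise W falls apart, after removal of at most one vertex w. In the core, two
different components contain end blocks in which any two vertices are joined
by paths with at least (k - 1)./2 + 1 edges. If W extends K, the set K stays
connected, and some component avoids it; an end block there has paths with at
least k - #|K| + 1 edges, and K has Hamiltonian paths. In both cases [link_cycle]
gives a Berge cycle of length at least k. *)
Lemma solid_two_connected W : solid g k W -> two_connected_in g W.
Proof.
move=> sol.
suff con (E : {set V}) w : E \subset W -> (forall y, y \in W -> y \in E \/ y = w) -> induced_connected g E.
  split; first by move=> x y xW; apply: (con W x) (xW) => //; auto.
  move=> w; apply: (con _ w); first exact: subD1set.
  by move=> y yW; have [->|yw] := eqVneq y w; [right | left; rewrite in_setD1 yw].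
move=> sE hE x y xE yE; set r := [rel u v in E | g u v].
have rsym : symmetric r by move=> u v; rewrite /= gs; case: (u \in E); rewrite ?andbF ?andbT.
have csym : connect_sym r := sym_connect_sym rsym.
apply/negPn/negP => nxy.
pose comp z := [set u in E | connect r z u].
have comp0 z : z \in E -> comp z != set0.
  by move=> zE; apply/set0Pn; exists z; rewrite inE zE connect0.
have compE z : comp z \subset E by apply/subsetP=> u; rewrite inE => /andP[].
have compcl z u v : u \in comp z -> v \in E -> g u v -> v \in comp z.
  rewrite !inE => /andP[uE zu] vE uv; rewrite vE; apply: connect_trans zu (connect1 _).
  by rewrite /= uE vE.
have compW z : comp z \subset W := subset_trans (compE z) sE.
have compN z u v : u \in comp z -> v \in W -> g u v -> v \in comp z \/ v = w.
  by move=> uz vW uv; case: (hE v vW) => [vE|->]; [left; apply: compcl uv | right].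
have nI := incidence_two_connected hconn.
case: sol compW compN hE {sE} => [{}W W0 deg|K {}W solK /andP[K1 K2] sKW deg] compW compN hE.
  have [D1 [B1 [c1 [[n1 s1] [s2 s3] s4 [s5 s6] nB1]]]] := end_block gs (comp0 x xE) (compW x) (compN x).
  have [D2 [B2 [c2 [[m1 t1] [t2 t3] t4 [t5 t6] nB2]]]] := end_block gs (comp0 y yE) (compW y) (compN y).
  have dis u : u \in comp x -> u \in comp y -> False.
    rewrite !inE => /andP[_ xu] /andP[_ yu]; move/negP: nxy; apply.
    by apply: connect_trans xu _; rewrite csym.
  (* The inner part of one block does not meet the other block, so the blocks share at most a cut vertex. *)
  have cross z z' (D1' D2' B2' : {set V}) u : (forall v, v \in comp z -> v \in comp z' -> False) ->
      D1' \subset comp z -> D2' \subset comp z' ->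
      (forall y0, y0 \in B2' -> y0 \notin D2' -> exists2 x0, x0 \in D2' & g x0 y0) ->
      u \in D1' -> u \in B2' -> False.
    move=> ds sD1 sD2 nb uD uB; have uz := subsetP sD1 _ uD.
    have uD2 : u \notin D2' by apply/negP=> /(subsetP sD2); apply: ds.
    have [v vD vu] := nb u uB uD2.
    apply: (ds u uz); apply: compcl (subsetP sD2 _ vD) _ vu; exact: (subsetP (compE z)).
  have d1 w' : w' \in D1 -> (k - 1)./2.+1 <= #|nbr g W w'|.
    by move=> wD; apply: deg; apply: (subsetP (compW x)); apply: (subsetP s1).
  have d2 w' : w' \in D2 -> (k - 1)./2.+1 <= #|nbr g W w'|.
    by move=> wD; apply: deg; apply: (subsetP (compW y)); apply: (subsetP t1).
  have [lk1 b1] := end_block_linked gs gi n1 s2 s3 s4 s5 nB1 d1.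
  have [lk2 b2] := end_block_linked gs gi m1 t2 t3 t4 t5 nB2 d2.
  have [|||||c [h1 h2 h3]] := link_cycle gi gphi phi_inj nI lk1 lk2 _ _ _ _ _ => //.
  - exact: leq_ltn_trans b1.
  - exact: leq_ltn_trans b2.
  - have one u : u \in B1 :&: B2 -> u = c1.
      move=> /setIP[u1 u2]; have := subsetP s4 _ u1; rewrite !inE => /orP[/eqP//|uD].
      by case: (cross x y D1 D2 B2 u dis).
    by move=> u v /one-> /one->.
  apply: no_long_cycle h1 h2 _; apply: leq_trans h3; rewrite leq_double; clear; lia.
have ltK : #|K| < k by move: K2 k5; clear; lia.
have ham := solid_hamiltonian gs gi k5 solK ltK.
have nK := hamiltonian_two_connected ham.
have conK u v : u \in K -> u \in E -> v \in K -> v \in E -> connect r u v.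
  move=> uK uE vK vE.
  have [KE|nKE] := boolP (K \subset E).
    have := nK.1 u v uK vK; apply: connect_sub => a b /= /andP[/andP[aK bK] ab].
    by apply: connect1; rewrite /= ab !(subsetP KE).
  have inE' a : a \in K :\ w -> a \in E.
    by move=> /setD1P[/eqP aw aK]; case: (hE a (subsetP sKW _ aK)).
  have wE : w \notin E.
    case/subsetPn: nKE => a aK aE; case: (hE a (subsetP sKW _ aK)) => [aE'|<-//].
    by rewrite aE' in aE.
  have [uw vw] : u != w /\ v != w by split; apply: contraNneq wE => <-.
  have := nK.2 w u v; rewrite !in_setD1 uw vw uK vK => /(_ isT isT); apply: connect_sub => a b.
  by move=> /= /andP[/andP[aK bK] ab]; apply: connect1; rewrite /= ab !inE'.
have [z zE zK] : exists2 z, z \in E & [disjoint comp z & K].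
  have [dx|/pred0Pn[a /andP[ax aK]]] := boolP [disjoint comp x & K]; first by exists x.
  have [dy|/pred0Pn[b /andP[byy bK]]] := boolP [disjoint comp y & K]; first by exists y.
  move: ax byy; rewrite !inE => /andP[aE xa] /andP[bE yb]; case/negP: nxy.
  apply: connect_trans xa _; apply: connect_trans (conK a b aK aE bK bE) _.
  by rewrite csym.
have [D [B [c0 [[n1 s1] [s2 s3] s4 [s5 s6] nB]]]] := end_block gs (comp0 z zE) (compW z) (compN z).
have DK u : u \in D -> u \notin K.
  by move=> uD; apply/negbT; apply: (disjointFr zK); apply: (subsetP s1).
have d1 w' : w' \in D -> k - #|K| < #|nbr g W w'|.
  by move=> wD; apply: deg (DK _ wD); apply: (subsetP (compW z)); apply: (subsetP s1).
have [lk b1] := end_block_linked gs gi n1 s2 s3 s4 s5 nB d1.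
have [|||||c [h1 h2 h3]] := link_cycle gi gphi phi_inj nI (linked_hamiltonian ham) lk _ _ _ _ _ => //.
- by move: K1; clear; lia.
- by move: K1; clear; lia.
- exact: leq_ltn_trans b1.
- have one u : u \in K :&: B -> u = c0.
    move=> /setIP[uK uB]; have := subsetP s4 _ uB; rewrite !inE => /orP[/eqP//|uD].
    by rewrite (negPf (DK u uD)) in uK.
  by move=> u v /one-> /one->.
apply: no_long_cycle h1 h2 _; apply: leq_trans h3; rewrite leq_double; move: K1 K2 k5; clear; lia.
Qed.

(** By [solid_cycle], #|W| < k. If #|W| = k - 1, take y outside W and a hyperedge A containing y. If A is not
in the subdivision of G[W], two disjoint paths from there to y and A, the edge
between y and A, and a Hamiltonian path of W form a Berge cycle of length at
least k. So all hyperedges at y represent edges of G[W]; there are two of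
them, and a Hamiltonian path between these is closed by y. *)
Lemma solid_card_lt W : solid g k W -> k <= #|V| -> #|W| < k - 1.
Proof.
move=> sol kV.
have nI := incidence_two_connected hconn.
have ltW : #|W| < k.
  rewrite ltnNge; apply/negP => le.
  have [c [h1 h2 h3]] := solid_cycle gs gi k5 sol (solid_two_connected sol) le.
  by apply: (hcycle h3); apply: (berge_of_gcycle gphi phi_inj) => //; move: h3 k5; clear; lia.
have [//|ge] := ltnP #|W| (k - 1).
have EW : k = #|W|.+1 by move: ge ltW k5; clear; lia.
have ham := solid_hamiltonian gs gi k5 sol ltW.
have [y yW] : exists y, y \notin W.
  apply/existsP; apply: contraTT ltW; rewrite negb_exists => /forallP all.
  by rewrite -leqNgt; apply: leq_trans kV _; apply: subset_leq_card; apply/subsetP=> z _; have := all z; rewrite negbK.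
have [w0 w0W] : exists w, w \in W.
  by apply/card_gt0P; move: EW k5; clear; lia.
have yw0 : y != w0 by apply: contraNneq yW => ->.
have yI : inr y \in incidence_set H by rewrite inE.
have wI : inr w0 \in incidence_set H by rewrite inE.
have lift z1 z2 : z1 \in subdivision g phi W -> z2 \in subdivision g phi W -> z1 != z2 ->
    exists a, [/\ upath (inc H) (subdivision g phi W) z1 a, last z1 a = z2 &
      #|W|.*2 + hyperedge_end z1 + hyperedge_end z2 <= (size a).+2].
  move=> z1W z2W z12; have [P [pP p1 _]] := subdivision_point gi z1W; have [Q [pQ p2 _]] := subdivision_point gi z2W.
  apply: (lift_point_path gphi phi_inj z1W z2W p1 p2 z12); apply: ham => //.
  by move=> E; move/eqP: z12; apply; apply: (is_point_inj gi) p1 _; rewrite E.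
have outside A : inc H (inr y) (inl A) -> inl A \notin subdivision g phi W -> False.
  move=> yA nA; have AI : inl A \in incidence_set H by rewrite inE; case/andP: yA.
  set S := subdivision g phi W in lift nA *; set Y : {set {set V} + V} := [set inr y; inl A].
  have SW : S \subset incidence_set H := subdivision_incidence_set gphi W.
  have YW : Y \subset incidence_set H by apply/subsetP=> z /set2P[]->.
  have SY z : z \in S -> z \in Y -> False.
    by move=> zS /set2P[] E; move: zS; rewrite E ?subdivision_inr ?(negPf yW) ?(negPf nA).
  have wS : inr w0 \in S by rewrite subdivision_inr.
  have yY : inr y \in Y by rewrite !inE eqxx.
  have AY : inl A \in Y by rewrite !inE eqxx orbT.
  have [s0 [p0 lk]] := conn_link nI.1 wI yI wS yY.
  (* Both y and A become ends of the links. *)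
  have [||q [z [q' [lkq lkq' dis _]]]] := two_paths nI SW YW lk => //.
  - have [w1 w1W w10] : exists2 w, w \in W & w != w0.
      have : 0 < #|W :\ w0| by move: EW k5; rewrite (cardsD1 w0 W) w0W; clear; lia.
      by case/card_gt0P=> w1; rewrite !inE => /andP[h1 h2]; exists w1.
    have [E|ne] := eqVneq s0 (inr w0); last by exists (inr w0); rewrite 1?eq_sym.
    exists (inr w1); rewrite ?subdivision_inr // E; apply: contraNneq w10 => -[->] //.
  - case: (last s0 p0) => [A'|v]; first by exists (inr y).
    by exists (inl A).
  have [sS lY _ _ _] := lkq; have [zS lY' _ _ _] := lkq'.
  have sz : s0 != z by apply/eqP=> E; apply: (dis s0); rewrite ?mem_head // E mem_head.
  have ll : last s0 q != last z q'.
    by apply/eqP=> E; apply: (dis (last s0 q)); rewrite ?mem_last // E mem_last.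
  have [a [ua la sza]] := lift s0 z sS zS sz.
  have ub : upath (inc H) Y (last s0 q) [:: last z q'].
    rewrite /upath; apply/and3P; split.
    - apply/andP; split=> //.
      move: ll; case/set2P: lY => ->; case/set2P: lY' => ->; rewrite ?eqxx //.
    - by rewrite /= inE ll.
    by apply/andP; split=> //; apply/andP.
  have [|c [h1 h2 _ h4]] := cycle_of_links (@inc_sym V H) SW YW lkq lkq' dis _ ua la ub erefl.
    by move=> u uS uY; case: (SY u uS uY).
  (* A link from a hyperedge to y has length at least one, and one from a vertex to y at least two. *)
  have short s q0 : link (inc H) (incidence_set H) S Y s q0 -> 1 <= size q0 /\
      (last s q0 = inr y -> 2 <= size q0 + hyperedge_end s).
    move=> [h5 h6 /and3P[pth _ _] _ _]; case: q0 pth h6 => [|u [|v q0]] /=.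
    - by move=> _ h6; case: (SY s h5 h6).
    - rewrite andbT => su _; split=> // E; subst u.
      by case: (s) su.
    by move=> _ _; split=> // _; rewrite addSn.
  have [o1 o2] := short _ _ lkq; have [o3 o4] := short _ _ lkq'.
  apply: no_long_cycle h1 h2 _; rewrite h4 [in leqLHS]EW.
  have [El|El] : last s0 q = inr y \/ last z q' = inr y.
    move: ll; case/set2P: lY => ->; case/set2P: lY' => ->; rewrite ?eqxx //; by auto.
    have := o2 El; move: sza o1 o3; rewrite -!muln2 /=; clear.
    by move: (size a) (size q) (size q') (hyperedge_end s0) (hyperedge_end z) #|W| => *; lia.
  have := o4 El; move: sza o1 o3; rewrite -!muln2 /=; clear.
  by move: (size a) (size q) (size q') (hyperedge_end s0) (hyperedge_end z) #|W| => *; lia.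
have [z0 z0I yz0] : exists2 z, z \in incidence_set H & inc H (inr y) z.
  apply: (conn_nbr nI.1 yI wI); apply: contraNneq yw0 => -[->] //.
case: z0 z0I yz0 => [A|//] AI yA.
have AS : inl A \in subdivision g phi W by apply/negPn/negP; apply: outside.
have [z1 z1I yz1] : exists2 z, z \in incidence_set H :\ (inl A) & inc H (inr y) z.
  apply: (conn_nbr (y := inr w0) (nI.2 _)); rewrite ?in_setD1 ?yI ?wI //.
  by apply: contraNneq yw0 => -[->].
case: z1 z1I yz1 => [A'|//] /setD1P[nAA A'I] yA'.
have AS' : inl A' \in subdivision g phi W by apply/negPn/negP; apply: outside.
have [|a [ua la sza]] := lift _ _ AS AS'; first by rewrite eq_sym.
apply: False_ind; apply: (@no_long_cycle (inl A :: rcons a (inr y))).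
- rewrite /= !rcons_path last_rcons (upath_path ua) la.
  by apply/andP; split; [rewrite inc_sym | ].
- have := upath_uniq ua; rewrite -rcons_cons rcons_uniq => ->; rewrite andbT.
  by apply/negP=> /(upath_sub ua); rewrite subdivision_inr (negPf yW).
move: sza; rewrite EW /= size_rcons -!muln2; clear.
by move: (size a) #|W| => *; lia.
Qed.

Lemma removable_set_exists : k <= #|V| ->
  exists a (K : {set V}), [/\ 2 <= a <= (k - 1)./2, #|K| = k - a & removable g a K].
Proof.
move=> kV.
case: (Classical_Prop.classic (exists W, solid g k W)) => [exW|noW]; last first.
  have [||K cK rK] := @degenerate_removable_set V g (k - 1)./2 (k - (k - 1)./2).
  - move=> X X0; apply/exists_inP; apply: contraPT noW; rewrite negb_exists => /forallP h.
    move=> nW; apply: nW; exists X; apply: solid_core => // x xX.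
    by have := h x; rewrite xX /= -ltnNge.
  - by apply: leq_trans kV; apply: leq_subr.
  by exists (k - 1)./2, K; split=> //; move: k5; clear; lia.
have [W solW maxW] : exists2 W, solid g k W & forall W', solid g k W' -> #|W'| <= #|W|.
  apply: Classical_Prop.NNPP => no.
  have grow i : exists2 W, solid g k W & i <= #|W|.
    elim: i => [|i [W solW iW]]; first by have [W solW] := exW; exists W.
    apply: Classical_Prop.NNPP => no'; apply: no; exists W => // W' solW'.
    rewrite leqNgt; apply/negP => lt; apply: no'; exists W' => //.
    exact: leq_ltn_trans lt.
  have [W solW lt] := grow k.
  by have := solid_card_lt solW kV; move: lt; clear; lia.
have c1 := solid_card gi solW; have c2 := solid_card_lt solW kV.
exists (k - #|W|), W; split.
- by move: c1 c2 k5; clear; lia.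
- by move: c2; clear; lia.
move=> X X0 sX; apply/exists_inP; apply: contraT; rewrite negb_exists => /forallP h.
have solX : solid g k (W :|: X).
  apply: (solid_grow solW); rewrite ?subsetUl //.
    by apply/andP; split=> //; move: c2; clear; lia.
  move=> x; rewrite in_setU => /orP[->//|xX] _.
  by have := h x; rewrite xX /= -ltnNge.
have := maxW _ solX; rewrite leqNgt => /negP[]; apply: proper_card.
apply/properP; split; first exact: subsetUl.
have /set0Pn[x xX] := X0; exists x; first by rewrite in_setU xX orbT.
by have := subsetP sX _ xX; rewrite in_setC.
Qed.

End Main.

(** * The bound *)

Theorem theorem2p1 (n k r : nat) (V : finType) (H : {set {set V}})
  (hr : 3 <= r) (hrk : r <= k) (hkn : k <= n)
  (hV : #|V| = n)
  (hSperner : sperner H)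
  (hconn : hypergraph_two_connected H)
  (hsize : {in H, forall A : {set V}, #|A| <= r})
  (hcycle : forall l : nat, k <= l -> ~ has_berge_cycle H l) :
  #|H| <= maxn (f n k r ((k - 1)./2)) (f n k r 2).
Proof.
have nI := incidence_two_connected hconn.
have V3 : 2 < #|V| by rewrite hV; apply: leq_trans hkn; apply: leq_trans hrk.
have szH : {in H, forall A : {set V}, 1 < #|A| <= r}.
  move=> A AH; rewrite hsize // andbT.
  have AI : inl A \in incidence_set H by rewrite inE.
  have [v0 _] : exists v : V, v \in V by apply/card_gt0P; apply: leq_trans V3.
  have [[//|v] _ /andP[_ vA]] : exists2 z, z \in incidence_set H & inc H (inl A) z.
    by apply: (conn_nbr (y := inr v0) nI.1 AI); rewrite ?inE.
  have [w wv] : exists w, w != v.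
    have : 0 < #|[set~ v]| by rewrite cardsC1; move: V3; clear; case: #|_| => // -[].
    by case/card_gt0P=> w; rewrite !inE; exists w.
  have [[//|u] /setD1P[uv _] /andP[_ uA]] : exists2 z, z \in incidence_set H :\ inr v & inc H (inl A) z.
    apply: (conn_nbr (y := inr w) (nI.2 _)); rewrite ?in_setD1 ?AI ?inE //.
    by rewrite andbT; apply: contraNneq wv => -[->].
  by apply/card_gt1P; exists v, u; split=> //; apply: contraNneq uv => ->.
have [|g [phi [F [[gs gi] gphi phi_inj [aF FP] <-]]]] := @pair_representatives V H r _ hSperner szH.
  exact: leq_trans hr.
have bound a (K : {set V}) : 2 <= a <= k -> #|K| = k - a -> removable g a K -> #|F| <= f n k r a.
  move=> ak cK rK; rewrite fE; apply: leq_trans (count_removable rK aF FP) _.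
  rewrite cK leq_add2l leq_mul2r; apply/orP; right.
  by have := cardsC K; rewrite cK hV; move: ak hkn; clear; lia.
have [k5|k4] := ltnP 4 k.
  have [|a [K [ak cK rK]]] := removable_set_exists hcycle hconn k5 gs gi gphi phi_inj; first by rewrite hV.
  have tk : (k - 1)./2 <= k by move: k5; clear; lia.
  have ak' : 2 <= a <= k by have /andP[-> /leq_trans-> //] := ak.
  exact: leq_trans (bound a K ak' cK rK) (f_le_ends hr hkn tk ak).
have [||K cK rK] := @degenerate_removable_set V g 2 (k - 2).
- move=> X X0; apply/exists_inP; apply: contraT; rewrite negb_exists => /forallP h.
  have [|c [h1 h2 h3]] := min_degree_cycle gs gi X0.
    by move=> x xX; have := h x; rewrite xX /= -ltnNge.
  have := hcycle (size c); case; first exact: leq_trans k4 h3.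
  by apply: (berge_of_gcycle gphi phi_inj) => //; apply: ltnW.
- by rewrite hV; apply: leq_trans hkn; apply: leq_subr.
by apply: leq_trans (bound 2 K _ cK rK) (leq_maxr _ _); apply: leq_trans hrk; apply: ltnW.
Qed.
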